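(* Let $l,T>0$ and assume: (F1) $\alpha\in(0,1)$, $\mu\in C([0,T])$, and there exists $\mu_0>0$ with $\mu(t)\ge\mu_0$ for all $t\in[0,T]$; (F2) $\psi\in H^3(0,l)$ with $\psi(0)=\psi(l)=0$ and $\psi''(0)=\psi''(l)=0$; (F3) $f\in L^2(0,T;H^3(0,l))$ and, for a.e. $t\in(0,T)$, $f(0,t)=f(l,t)=0$ and $f_{xx}(0,t)=f_{xx}(l,t)=0$. With $e_k,\psi_k,\mathcal A_k,\mathcal B_k$ as defined in the context, let $(u,u_0)$ be the solution of the problem $$\partial_t^\alpha u-u_{xx}-\mu(t)u_{xxt}=f\ \text{ in }(0,l)\times(0,T),\quad u(0,t)=u(l,t)=0,\quad u(x,T)=\psi(x),\quad u_0=u(\cdot,0),$$ given by $$u(x,t)=\sum_{k=1}^\infty\Big[\frac{\mathcal A_k(t)}{\mathcal A_k(T)}\psi_k+\mathcal B_k(t)-\frac{\mathcal A_k(t)}{\mathcal A_k(T)}\mathcal B_k(T)\Big]e_k(x),\qquad u_0(x)=\sum_{k=1}^\infty\frac{\psi_k-\mathcal B_k(T)}{\mathcal A_k(T)}e_k(x).$$ Then there exists a constant $C>0$, depending only on $\alpha,T,\mu_0,l$ and bounds on $\mu$, such that $$\|u_0\|_{L^2(0,l)}\le C\Big(\|\psi\|_{L^2(0,l)}+\sqrt T\,\|f\|_{L^2(0,T;L^2(0,l))}\Big).$$ Moreover, for two data sets $(\psi_1,f_1)$ and $(\psi_2,f_2)$ (satisfying the same assumptions) with corresponding reconstructions $u_{0,1},u_{0,2}$,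 one has $$\|u_{0,1}-u_{0,2}\|_{L^2(0,l)}\le C\Big(\|\psi_1-\psi_2\|_{L^2(0,l)}+\sqrt T\,\|f_1-f_2\|_{L^2(0,T;L^2(0,l))}\Big).$$
   Context: Caputo derivative: $\partial_t^\alpha u(x,t)=\frac{1}{\Gamma(1-\alpha)}\int_0^t(t-s)^{-\alpha}\partial_s u(x,s)\,ds$. Notation: for $k=1,2,\dots$, $e_k(x)=\sin(k\pi x/l)$, $\lambda_k=(k\pi/l)^2$; for data $(\psi,f)$, $\psi_k=\frac2l\int_0^l\psi(x)e_k(x)\,dx$, $f_k(t)=\frac2l\int_0^l f(x,t)e_k(x)\,dx$. For $0\le s<t\le T$ let $$H_k(t,s)=\frac{1}{\mu(t)}+\frac{1}{\mu(t)\lambda_k\Gamma(1-\alpha)}(t-s)^{-\alpha},$$ and let $R_k(t,s)$ be the resolvent kernel (given by the Neumann series) of the Volterra equation $y(t)+\int_0^tH_k(t,s)y(s)\,ds=g(t)$, with the sign convention that its solution is $y(t)=g(t)+\int_0^tR_k(t,s)g(s)\,ds$; that is, $R_k=\sum_{n\ge1}(-1)^nH_k^{(n)}$ with iterated kernels $H_k^{(1)}=H_k$, $H_k^{(n+1)}(t,s)=\int_s^tH_k(t,\sigma)H_k^{(n)}(\sigma,s)\,d\sigma$. Define, for $t\in[0,T]$, $$\mathcal A_k(t)=1-\int_0^t\frac{1}{\mu(\tau)}\,d\tau-\int_0^t\int_0^\tau R_k(\tau,s)\frac{1}{\mu(s)}\,ds\,d\tau,$$ $$\mathcal B_k(t)=\int_0^t\frac{f_k(\tau)}{\mu(\tau)\lambda_k}\,d\tau+\int_0^t\int_0^\tau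 R_k(\tau,s)\frac{f_k(s)}{\mu(s)\lambda_k}\,ds\,d\tau.$$ Under the assumption on $\alpha,\mu$ one has $\mathcal A_k(T)>0$ for all $k\ge1$, so the coefficients above are well defined. The reconstruction corresponding to data $(\psi,f)$ is the function $u_0$ given by the series in the claim. *)

(* Defs.v *)
From HB Require Import structures.
From mathcomp Require Import all_boot all_order all_algebra.
From mathcomp Require Import all_classical all_reals all_analysis.

Set Implicit Arguments.
Unset Strict Implicit.
Unset Printing Implicit Defensive.

Import Order.TTheory GRing.Theory Num.Theory.
Import numFieldNormedType.Exports.

Local Open Scope classical_set_scope.
Local Open Scope ring_scope.

Section FunctionSpaces.
Context {R : realType}.
Local Notation leb := (@lebesgue_measure R).
Implicit Types (a l T : R) (u g v phi : R -> R) (f s : R -> R -> R) (m : nat).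

(** ** Lebesgue spaces
    Elements of function spaces over [(0, l)] are represented by functions on
    the whole line whose values outside [(0, l)] are never used. *)

Definition L2norm a (w : R -> \bar R) : \bar R :=
  Lnorm leb 2%:E (w \_ `]0, a[).

Definition L2 l u : Prop :=
  measurable_fun (`]0, l[ : set R) u /\ (L2norm l (EFin \o u) < +oo)%E.

(** ** Sobolev spaces on an interval
    As in Brezis, Functional Analysis, Sobolev Spaces and PDEs, Chapter 8:
    weak derivatives are tested against [C^1] functions with compact support
    in [(0, l)], and [H^(m+1)] is the set of the [u] in [L^2] with a weak
    derivative in [H^m]. *)

Definition test_fun l phi : Prop :=
  [/\ forall x : R, derivable phi x 1,
      continuous (derive1 phi) &
      exists a b, [/\ 0 < a, b < l & forall x, x \notin `[a, b] -> phi x = 0]].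

Definition weak_derivative l u g : Prop :=
  [/\ L2 l u, L2 l g &
      forall phi, test_fun l phi ->
        \int[leb]_(x in `]0, l[) (u x * derive1 phi x) =
        - \int[leb]_(x in `]0, l[) (g x * phi x)].

Fixpoint Hspace l m u : Prop :=
  if m is m'.+1 then
    L2 l u /\ exists g, weak_derivative l u g /\ Hspace l m' g
  else L2 l u.

(* A representative of the weak derivative (it is unique up to equality almost
   everywhere); the zero function if there is none. *)
Definition wD l u : R -> R := xget (cst 0) [set g | weak_derivative l u g].

Definition Hnorm l m u : \bar R :=
  ((\sum_(j < m.+1) L2norm l (EFin \o iter j (wD l) u) `^ 2) `^ 2^-1)%E.

(* The continuous representative of [u] on [[0, l]] vanishes at [0] and [l]. *)
Definition zero_boundary l u : Prop :=
  exists v, [/\ {within `[0, l], continuous v},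
                {ae leb, forall x, x \in `]0, l[ -> v x = u x},
                v 0 = 0 & v l = 0].

(** ** The Bochner space [L^2(0, T; H^m(0, l))]
    [f x t] is the value at [x] of the element [f^~ t] of [H^m(0, l)]. *)

Definition simple_Hvalued l m s : Prop :=
  exists (n : nat) (A : 'I_n -> set R) (v : 'I_n -> R -> R),
    [/\ forall i, measurable (A i), forall i, Hspace l m (v i) &
        forall x t, s x t = \sum_(i < n) \1_(A i) t * v i x].

Definition strongly_measurable l T m f : Prop :=
  exists s : nat -> R -> R -> R,
    (forall n, simple_Hvalued l m (s n)) /\
    {ae leb, forall t, t \in `]0, T[ ->
       Hnorm l m (fun x => f x t - s n x t) @[n --> \oo] --> 0%E}.

Definition Bochner_L2H l T m f : Prop :=
  [/\ {ae leb, forall t, t \in `]0, T[ -> Hspace l m (f^~ t)},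
      strongly_measurable l T m f &
      (L2norm T (fun t => Hnorm l m (f^~ t)) < +oo)%E].

Definition L2L2norm l T f : \bar R :=
  L2norm T (fun t => L2norm l (EFin \o f^~ t)).

End FunctionSpaces.

Section Reconstruction.
Context {R : realType}.
Local Notation leb := (@lebesgue_measure R).
Implicit Types (alpha l T t s : R) (mu psi : R -> R) (f : R -> R -> R).
Implicit Types (k n : nat).

Definition Gamma (z : R) : R :=
  \int[leb]_(x in `]0, +oo[) (x `^ (z - 1) * expR (- x)).

Definition e l k (x : R) : R := sin (k%:R * pi * x / l).

Definition lambda l k : R := (k%:R * pi / l) ^+ 2.

Definition psi_coef l psi k : R :=
  2 / l * \int[leb]_(x in `]0, l[) (psi x * e l k x).

Definition f_coef l f k t : R :=
  2 / l * \int[leb]_(x in `]0, l[) (f x t * e l k x).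

Definition H alpha mu l k t s : R :=
  1 / mu t +
  1 / (mu t * lambda l k * Gamma (1 - alpha)) * (t - s) `^ (- alpha).

(* [Hiter alpha mu l k n] is the iterated kernel H_k^(n+1). *)
Fixpoint Hiter alpha mu l k n t s : R :=
  if n is n'.+1 then
    \int[leb]_(sigma in `]s, t[)
      (H alpha mu l k t sigma * Hiter alpha mu l k n' sigma s)
  else H alpha mu l k t s.

Definition resolvent alpha mu l k t s : R :=
  limn (fun N => \sum_(0 <= n < N) (-1) ^+ n.+1 * Hiter alpha mu l k n t s).

Definition A alpha mu l k t : R :=
  1 - \int[leb]_(tau in `]0, t[) (1 / mu tau)
    - \int[leb]_(tau in `]0, t[)
        \int[leb]_(s in `]0, tau[) (resolvent alpha mu l k tau s * (1 / mu s)).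

Definition B alpha mu l f k t : R :=
  \int[leb]_(tau in `]0, t[) (f_coef l f k tau / (mu tau * lambda l k))
  + \int[leb]_(tau in `]0, t[)
      \int[leb]_(s in `]0, tau[)
        (resolvent alpha mu l k tau s * (f_coef l f k s / (mu s * lambda l k))).

Definition admissible_mu (T mu0 M : R) mu : Prop :=
  {within `[0, T], continuous mu} /\
  forall t, t \in `[0, T] -> mu0 <= mu t <= M.

Definition admissible_psi l psi : Prop :=
  [/\ Hspace l 3 psi, zero_boundary l psi &
      zero_boundary l (wD l (wD l psi))].

Definition admissible_f l T f : Prop :=
  Bochner_L2H l T 3 f /\
  {ae leb, forall t, t \in `]0, T[ ->
     zero_boundary l (f^~ t) /\ zero_boundary l (wD l (wD l (f^~ t)))}.

(* The pair [(u, u0)] attached to the data [(psi, f)], as sums of series that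
   are taken pointwise on [[0, l]]. *)
Definition reconstruction alpha mu l T psi f
    (u : R -> R -> R) (u0 : R -> R) : Prop :=
  (forall x t : R, x \in `[0, l] -> t \in `[0, T] ->
     u x t = limn (fun N => \sum_(1 <= k < N)
       (A alpha mu l k t / A alpha mu l k T * psi_coef l psi k
        + B alpha mu l f k t
        - A alpha mu l k t / A alpha mu l k T * B alpha mu l f k T)
       * e l k x)) /\
  (forall x : R, x \in `[0, l] ->
     u0 x = limn (fun N => \sum_(1 <= k < N)
       (psi_coef l psi k - B alpha mu l f k T) / A alpha mu l k T * e l k x)).

End Reconstruction.

(* Main.v *)
Require Import Defs.
From HB Require Import structures.
From mathcomp Require Import all_boot all_order all_algebra.
From mathcomp Require Import all_classical all_reals all_analysis.
From mathcomp Require Import measurable_realfun.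
From mathcomp Require Import ring lra.

(** The coefficients of [u_0] are [(psi_k - B_k(T)) / A_k(T)], so that by
    orthogonality of the sines it is enough to bound [A_k(T)] below by a
    positive constant and [|B_k(T)|] above by a multiple of the [L^2(0, T)]
    norm of [f_k], uniformly in [k] and [mu].

    The lower bound on [A_k(T)].  Let [z = 1/mu + int_0^t R_k(t, s)/mu(s) ds].
    It solves the Volterra equation, that is, [mu(t) z(t) = N(t)] where
    [N(t) = 1 - int_0^t K(t - s) z(s) ds] and [K(r) = 1 + c r^(-alpha)], and
    [A_k(t) = 1 - int_0^t z].  Since [K] decreases, [N(t)] is at most
    [N(t') + int_t^t' K(t' - s) z(s) ds] for [t <= t'] as long as [z >= 0]
    before [t]; this prevents [N] from reaching zero, whence [z > 0]
    ([rem_gt0]).  Since [K >= 1], one has [N <= A_k], hence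
    [z <= A_k / mu_0]: during a time [r], [A_k] cannot lose more than the
    factor [1 - r / mu_0], and [A_k(T) >= 2^(-n)] as soon as
    [n >= 2 T / mu_0] ([decay_lower_bound]).  This bound depends neither on
    [k] nor on [mu].

    The bound on [B_k(T)].  In the weight [e^(kappa r) r^(-alpha)] with
    [kappa] large, each iteration of the kernel [H_k] gains a factor [1/2]
    ([kiter_spec]); hence the Neumann series converges and
    [|R_k(t, s)| <= C (t - s)^(-alpha)], with [C] independent of [k] because
    [lambda_k >= lambda_1].  Exchanging the integrals gives
    [B_k(T) = int_0^T f_k w_k] for a weight with [|w_k| <= C / lambda_k]
    which does not depend on [f] ([modes_uniform]).

    The norm of [u_0].  As [u_0] is a pointwise limit of partial sums, its
    norm is bounded through Fatou's lemma ([sine_series_bound]); the sums of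
    [psi_k^2] and of [int_0^T f_k^2] are bounded by Bessel's inequality
    ([bessel], [tame_energy]).  The result is [reconstruction_L2_le].

    The difference of two reconstructions.  The coefficients are linear in the
    data, but the difference of two limits is the limit of the differences
    only for convergent series.  The sine series converge pointwise because
    their coefficients are [O(1 / lambda_k)]: for [B_k(T)] this is the bound
    on [w_k], for [psi_k] it follows from two integrations by parts
    ([psi_coef_decay]).  There the derivatives of [psi] are weak ones and the
    sines have no compact support, so they are multiplied by cutoff functions
    whose contribution is shown to vanish in the limit. *)

Set Implicit Arguments.
Unset Strict Implicit.
Unset Printing Implicit Defensive.

Import Order.TTheory GRing.Theory Num.Theory.
Import numFieldNormedType.Exports.

Local Open Scope classical_set_scope.
Local Open Scope ring_scope.

(** * Negligible sets, reflections and translations *)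

Section integral_tools.
Context {d} {X : measurableType d} {R : realType}.
Variable nu : {measure set X -> \bar R}.
Local Open Scope ereal_scope.
Import HBNNSimple.

(** The integral of a nonnegative function is a supremum over the simple
    functions below it, and a simple function can be set to zero on a null set
    without changing its integral. The comparison thus holds for functions such
    as [t |-> f_k(t)] and [t |-> |f(., t)|], which are not known to be
    measurable. *)
Lemma ge0_le_integral_negligible (D N : set X) (f g : X -> \bar R) :
  measurable N -> nu N = 0 ->
  (forall x, D x -> 0 <= f x) -> (forall x, D x -> 0 <= g x) ->
  (forall x, D x -> ~ N x -> f x <= g x) ->
  \int[nu]_(x in D) f x <= \int[nu]_(x in D) g x.
Proof.
move=> mN N0 f0 g0 fg.
rewrite !ge0_integralE //= ge_ereal_sup// => _ [h/= hf] <-.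
have mCN : measurable (~` N) by exact: measurableC.
apply: le_ereal_sup_tmp; exists (sintegral nu (proj_nnsfun h mCN)).
  exists (proj_nnsfun h mCN) => //= x.
  rewrite mindicE; case: (boolP (x \in ~` N)) => [/[!inE] Nx|_]; last first.
    rewrite mulr0 /patch; case: ifP => // xD; apply: g0; exact: set_mem.
  rewrite mulr1 (le_trans (hf x))// /patch; case: ifP => // xD.
  by apply: fg => //; exact: set_mem.
rewrite -!integralT_nnsfun.
rewrite [leLHS](_ : _ = \int[nu]_x (proj_nnsfun h mCN x)%:E)//.
apply: ge0_ae_eq_integral => //.
- exact/measurable_EFinP.
- exact/measurable_EFinP.
- by move=> x _; rewrite lee_fin.
- by move=> x _; rewrite lee_fin.
- exists N; split => // x /= /not_implyP [_ neq]; apply: contrapT => nN.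
  by apply: neq; rewrite mindicE mem_set// mulr1.
Qed.

Lemma integral_eq_negligible (D N : set X) (f g : X -> \bar R) :
  measurable N -> nu N = 0 ->
  (forall x, D x -> ~ N x -> f x = g x) ->
  \int[nu]_(x in D) f x = \int[nu]_(x in D) g x.
Proof.
move=> mN N0 fg; rewrite integralE [RHS]integralE.
congr (_ - _); apply/eqP; rewrite eq_le; apply/andP; split;
  apply: (@ge0_le_integral_negligible _ N) => // x Dx Nx;
  by rewrite ?funeposE ?funenegE fg.
Qed.

End integral_tools.

Section reflection.
Context {R : realType}.
Local Notation leb := (@lebesgue_measure R).
Local Open Scope ereal_scope.

Lemma measurable_reflect (t : R) :
  measurable_fun setT (fun x : R => (t - x)%R : measurableTypeR R).
Proof. by apply: measurable_funB => //; exact: measurable_cst. Qed.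

Lemma lebesgue_measure_reflect (t : R) (S : set R) : measurable S ->
  pushforward leb (fun x : R => (t - x)%R : measurableTypeR R) S = leb S.
Proof.
move=> mS; apply/esym/lebesgue_measure_unique => //=.
  exact: measurable_reflect.
move=> mt _ [[a b]] _ <-.
rewrite /pushforward (_ : _ @^-1` _ = `[(t - b)%R, (t - a)%R[%classic); last first.
  apply/seteqP; split => x /=; rewrite !in_itv/= => /andP[h1 h2];
    apply/andP; split; lra.
rewrite !lebesgue_measure_itv/= !lte_fin ltrD2l ltrN2.
case: ifP => // ab; congr (_%:E); ring.
Qed.

Lemma ge0_integral_reflect (t : R) (g : R -> \bar R) :
  measurable_fun setT g -> (forall x, 0 <= g x) ->
  \int[leb]_x g (t - x)%R = \int[leb]_x g x.
Proof.
move=> mg g0.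
have H := @ge0_integral_pushforward _ _ (measurableTypeR R) (measurableTypeR R) R
  (fun x : R => (t - x)%R : measurableTypeR R) (measurable_reflect t) leb setT g
  measurableT mg (fun x _ => g0 x).
rewrite preimage_setT in H.
rewrite -[LHS]/(\int[leb]_x (g \o (fun x : R => (t - x)%R : measurableTypeR R)) x) -H.
apply: eq_measure_integral; first exact: measurable_reflect.
by move=> mt A mA _; exact: lebesgue_measure_reflect.
Qed.

Lemma ge0_integral_translate (s : R) (g : R -> \bar R) :
  measurable_fun setT g -> (forall x, 0 <= g x) ->
  \int[leb]_x g (x - s)%R = \int[leb]_x g x.
Proof.
move=> mg g0.
have m1 : measurable_fun setT (fun x : R => g (x - s)%R).
  by apply: (measurableT_comp mg); apply: measurable_funB.
rewrite -(ge0_integral_reflect s m1)//.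
rewrite -[RHS](ge0_integral_reflect 0%R mg)//.
apply: eq_integral => x _; congr g; lra.
Qed.

End reflection.

(** * The singular profile and its convolutions *)

Section singular_profile.
Context {R : realType}.
Variable alpha : R.
Hypotheses (alpha_gt0 : 0 < alpha) (alpha_lt1 : alpha < 1).
Local Notation leb := (@lebesgue_measure R).
Implicit Types (a b r s t u v x kappa T : R).

(** Extended by zero, so that integrals over [(s, t)] of products of profiles
    become integrals over the whole line. *)
Definition pw (u : R) : R := if 0 < u then u `^ (- alpha) else 0.

Lemma pw_ge0 u : 0 <= pw u.
Proof. by rewrite /pw; case: ifP => // _; exact: powR_ge0. Qed.

Lemma pwE u : 0 < u -> pw u = u `^ (- alpha).
Proof. by rewrite /pw => ->. Qed.

Lemma pw0 u : u <= 0 -> pw u = 0.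
Proof. by rewrite /pw ltNge => ->. Qed.

Lemma pw_gt0 u : 0 < u -> 0 < pw u.
Proof. by move=> u0; rewrite pwE// powR_gt0. Qed.

Lemma measurable_pw : measurable_fun setT pw.
Proof.
apply: measurable_fun_ifT => //.
  exact: measurable_fun_ltr.
Qed.

Lemma pw_nincr u v : 0 < u -> u <= v -> pw v <= pw u.
Proof.
move=> u0 uv; have v0 := lt_le_trans u0 uv.
rewrite !pwE// !powRN lef_pV2 ?posrE ?powR_gt0//.
by apply: ge0_ler_powR; rewrite ?nnegrE //; exact: ltW.
Qed.

Lemma pw_half u : 0 < u -> pw (u / 2) = 2 `^ alpha * pw u.
Proof.
move=> u0; rewrite !pwE ?divr_gt0// powRM// ?invr_ge0 1?ltW// mulrC; congr (_ * _).
by rewrite -[2^-1]powR_inv1// -powRrM mulN1r opprK.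
Qed.

Let P (u : R) := (1 - alpha)^-1 * u `^ (1 - alpha).

Let dP (u : R) : 0 < u -> is_derive u 1 P (u `^ (- alpha)).
Proof.
move=> u0; have h := is_derive1_powR (1 - alpha) u0.
have := is_deriveZ (1 - alpha)^-1 h.
rewrite /= [X in is_derive _ _ _ X -> _](_ : _ = u `^ (- alpha)); last first.
  rewrite -[_ *: _]/(_ * _) mulrA mulVf ?mul1r; last by rewrite subr_eq0 gt_eqF.
  by congr (_ `^ _); lra.
exact.
Qed.

(** The fundamental theorem of calculus applies on [[r / (i + 2), r]], away
    from the singularity; the intervals then exhaust [(0, r)]. *)
Lemma integral_pw_le r : 0 < r ->
  (\int[leb]_(u in `]0%R, r[) (pw u)%:E <= (r `^ (1 - alpha) / (1 - alpha))%:E)%E.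
Proof.
move=> r0.
pose F (i : nat) : set R := `[r / i.+2%:R, r]%classic.
have mpw (D : set R) : measurable_fun D (EFin \o pw).
  by apply/measurable_EFinP; apply: measurable_funTS; exact: measurable_pw.
have ndF : {homo F : n m / (n <= m)%N >-> (n <= m)%O}.
  move=> n m nm; apply/subsetPset => x; rewrite /F /= !in_itv/= => /andP[h ->].
  rewrite andbT (le_trans _ h)// ler_pM2l// lef_pV2 ?posrE// ler_nat.
  by rewrite !ltnS.
have cF := @ge0_nondecreasing_set_cvg_integral _ (measurableTypeR R) R F (EFin \o pw) leb ndF
  (fun i => measurable_itv _) (fun i => mpw _) (fun i x _ => pw_ge0 x).
have Fle i : (\int[leb]_(x in F i) (EFin \o pw) x <=
              (r `^ (1 - alpha) / (1 - alpha))%:E)%E.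
  have d0 : 0 < r / i.+2%:R by rewrite divr_gt0.
  have dr : r / i.+2%:R < r by rewrite ltr_pdivrMr// ltr_pMr// ltr1n.
  have der x : r / i.+2%:R <= x -> is_derive x 1 P (x `^ (- alpha)).
    by move=> xd; apply: dP; exact: lt_le_trans xd.
  rewrite (eq_integral (fun x : measurableTypeR R => ((x : R) `^ (- alpha))%:E)); last first.
    move=> x; rewrite inE /F /= in_itv/= => /andP[xd _]/=.
    by rewrite pwE// (lt_le_trans d0 xd).
  rewrite (@continuous_FTC2 R (fun x => x `^ (- alpha)) P)//.
  - rewrite -EFinB lee_fin lerBlDr /P mulrC lerDl.
    by rewrite mulr_ge0 ?invr_ge0 ?powR_ge0// subr_ge0 ltW.
  - apply: derivable_within_continuous => x; rewrite in_itv/= => /andP[xd _].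
    have x0 := lt_le_trans d0 xd.
    by case: (is_derive1_powR (- alpha) x0).
  - split.
    + by move=> x; rewrite in_itv/= => /andP[/ltW xd _]; case: (der x xd).
    + apply: cvg_at_right_filter; apply: differentiable_continuous.
      by apply/derivable1_diffP; case: (der _ (lexx _)).
    + apply: cvg_at_left_filter; apply: differentiable_continuous.
      by apply/derivable1_diffP; case: (der _ (ltW dr)).
  - move=> x; rewrite in_itv/= => /andP[/ltW xd _].
    by rewrite derive1E; case: (der x xd).
apply: (@le_trans _ _ (\int[leb]_(x in \bigcup_i F i) (EFin \o pw) x)%E).
  apply: ge0_subset_integral => //.
  - by apply: bigcup_measurable => i _; exact: measurable_itv.
  - exact: mpw.
  - by move=> x _; rewrite lee_fin pw_ge0.
  - move=> x /=; rewrite in_itv/= => /andP[x0 xr].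
    exists (Num.truncn (r / x)) => //; rewrite /F/= in_itv/= (ltW xr) andbT.
    rewrite ler_pdivrMr// mulrC -ler_pdivrMr//.
    rewrite (le_trans (ltW (truncnS_gt _)))// ler_nat //.
rewrite -(cvg_lim _ cF)//; apply: lime_le; last exact: nearW.
by apply/cvg_ex; eexists; exact: cF.
Qed.

(** The profile damped by [e^(-kappa u)] and cut at [T]. The damping makes the
    mass [dmass] as small as required without changing the singularity. *)
Definition dpw (T kappa u : R) : R :=
  if u < T then expR (- (kappa * u)) * pw u else 0.

Lemma dpw_ge0 T kappa u : 0 <= dpw T kappa u.
Proof. by rewrite /dpw; case: ifP => // _; rewrite mulr_ge0 ?expR_ge0 ?pw_ge0. Qed.

Lemma measurable_dpw T kappa : measurable_fun setT (dpw T kappa).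
Proof.
apply: measurable_fun_ifT => //; first exact: measurable_fun_ltr.
apply: measurable_funM; last exact: measurable_pw.
apply: measurableT_comp; first exact: measurable_expR.
by apply: measurableT_comp => //; apply: measurable_funM.
Qed.

Definition dmass T kappa : \bar R := (\int[leb]_u (dpw T kappa u)%:E)%E.

Lemma dmass0_le T : 0 < T ->
  (dmass T 0 <= (T `^ (1 - alpha) / (1 - alpha))%:E)%E.
Proof.
move=> T0; apply: le_trans (integral_pw_le T0); rewrite [leRHS]integral_mkcond.
apply: ge0_le_integral => //.
- by move=> u _; rewrite lee_fin dpw_ge0.
- by apply/measurable_EFinP; exact: measurable_dpw.
- by apply/(measurable_restrictT _ _).1 => //; apply/measurable_EFinP;
   apply: measurable_funTS; exact: measurable_pw.
- move=> u _; rewrite /dpw /patch mul0r oppr0 expR0 mul1r mem_setE in_itv/=.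
  case: ltP => uT; first rewrite andbT; case: ltP => //= u0.
    by rewrite pw0.
Qed.

Lemma dmass_cvg0 T : dmass T n%:R @[n --> \oo] --> (0 : \bar R)%E.
Proof.
rewrite /dmass.
have -> : (0 : \bar R)%E = (\int[leb]_x (cst 0 x))%E by rewrite integral0.
apply: (@dominated_cvg _ (measurableTypeR R) R leb setT measurableT _ _ (fun u => (dpw T 0 u)%:E)).
- by move=> n; apply/measurable_EFinP; exact: measurable_dpw.
- move=> x _; apply/fine_cvgP; split; first exact: nearW.
  suff : dpw T n%:R x @[n --> \oo] --> (0 : R) by [].
  have [x0|x0] := leP x 0.
    rewrite (_ : (fun n : nat => dpw T n%:R x) = cst 0); first exact: cvg_cst.
    by apply/funext => n; rewrite /dpw pw0// mulr0 if_same.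
  have [xT|xT] := ltP x T; last first.
    rewrite (_ : (fun n : nat => dpw T n%:R x) = cst 0); first exact: cvg_cst.
    by apply/funext => n; rewrite /dpw ltNge xT.
  rewrite (_ : (fun n : nat => dpw T n%:R x) = geometric (pw x) (expR (- x))).
    by apply: cvg_geometric; rewrite ger0_norm ?expR_ge0// expR_lt1 oppr_lt0.
  apply/funext => n; rewrite /dpw xT /geometric/= mulrC -expRM_natl mulrN //.
- by [].
- apply/integrableP; split; first by apply/measurable_EFinP; exact: measurable_dpw.
  under eq_integral do rewrite /= ger0_norm ?dpw_ge0//.
  have [T0|T0] := ltP 0 T.
    by rewrite (le_lt_trans (dmass0_le T0))// ltry.
  rewrite integral0_eq// => u _; rewrite /dpw; case: ifP => // uT.
  by rewrite pw0 ?mulr0// ltW// (lt_le_trans uT).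
- move=> n x _ /=; rewrite lee_fin ger0_norm ?dpw_ge0// /dpw.
  case: ifP => // xT; have [x0|x0] := leP x 0; first by rewrite pw0// !mulr0.
  by rewrite ler_wpM2r ?pw_ge0// ler_expR mul0r oppr0 oppr_le0 mulr_ge0// ltW.
Qed.

(** The larger of [a] and [b] is at least [(a + b) / 2]: its factor is bounded
    by the profile there, and the damping may be moved onto the smaller one. *)
Lemma pw_split kappa a b : 0 <= kappa -> 0 < a -> 0 < b ->
  expR (- (kappa * a)) * pw a * pw b <=
  2 `^ alpha * pw (a + b) *
    (expR (- (kappa * a)) * pw a + expR (- (kappa * b)) * pw b).
Proof.
move=> k0 a0 b0; have r0 : 0 < a + b by rewrite addr_gt0.
rewrite -(pw_half r0).
have P0 : 0 < pw ((a + b) / 2) by rewrite pw_gt0// divr_gt0.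
have ea := expR_gt0 (- (kappa * a)); have eb := expR_gt0 (- (kappa * b)).
have pa := pw_gt0 a0; have pb := pw_gt0 b0.
have [ab|ba] := leP a b.
  have h : pw b <= pw ((a + b) / 2) by apply: pw_nincr; lra.
  rewrite mulrDr; apply: ler_wpDr; first by rewrite !mulr_ge0// ltW.
  by rewrite mulrC ler_wpM2r// mulr_ge0// ltW.
have h : pw a <= pw ((a + b) / 2) by apply: pw_nincr; lra.
have he : expR (- (kappa * a)) <= expR (- (kappa * b)).
  by rewrite ler_expR lerN2 ler_wpM2l// ltW.
rewrite mulrDr; apply: ler_wpDl; first by rewrite !mulr_ge0// ltW.
rewrite mulrA ler_wpM2r ?(ltW pb)// mulrC; apply: ler_pM => //; exact: ltW.
Qed.

(** The convolution of the profile with its weighted version is a multiple of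
    the weighted profile, and the factor is small for large [kappa]: [pw_split]
    extracts the weight at [t - s], and what remains has mass [dmass T kappa]
    twice. The Neumann series can therefore be summed without the exact value
    of the convolution, a Beta integral. *)
Lemma pw_conv T kappa s t : 0 <= kappa -> t - s < T ->
  (\int[leb]_x (pw (t - x) * (expR (kappa * (x - s)) * pw (x - s)))%:E <=
   (2 `^ alpha * 2 * (expR (kappa * (t - s)) * pw (t - s)))%:E * dmass T kappa)%E.
Proof.
move=> k0 tsT.
have md r : measurable_fun setT (fun x : R => (dpw T kappa (x - r))%:E).
  apply/measurable_EFinP; apply: (measurableT_comp (measurable_dpw T kappa)).
  exact: measurable_funB.
have mr r : measurable_fun setT (fun x : R => (dpw T kappa (r - x))%:E).
  apply/measurable_EFinP; apply: (measurableT_comp (measurable_dpw T kappa)).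
  exact: measurable_funB.
pose c := 2 `^ alpha * (expR (kappa * (t - s)) * pw (t - s)).
have c0 : 0 <= c by rewrite !mulr_ge0 ?powR_ge0 ?expR_ge0 ?pw_ge0.
apply: (@le_trans _ _ (\int[leb]_x (c%:E *
    ((dpw T kappa (t - x))%:E + (dpw T kappa (x - s))%:E)))%E).
  apply: ge0_le_integral => //.
  - by move=> x _; rewrite lee_fin !mulr_ge0 ?expR_ge0 ?pw_ge0.
  - apply/measurable_EFinP; apply: measurable_funM.
      apply: (measurableT_comp measurable_pw); exact: measurable_funB.
    apply: measurable_funM.
      apply: measurableT_comp; first exact: measurable_expR.
      apply: measurable_funM => //.
      exact: measurable_funB.
    apply: (measurableT_comp measurable_pw); exact: measurable_funB.
  - apply: emeasurable_funM => //.
    by apply: emeasurable_funD; [exact: mr|exact: md].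
  - move=> x _; rewrite -EFinD -EFinM lee_fin.
    have rhs0 : 0 <= c * (dpw T kappa (t - x) + dpw T kappa (x - s)).
      by rewrite mulr_ge0// addr_ge0 ?dpw_ge0.
    have [tx|tx] := leP (t - x) 0; first by rewrite (pw0 tx) mul0r.
    have [xs|xs] := leP (x - s) 0; first by rewrite (pw0 xs) !mulr0.
    have h := pw_split k0 tx xs.
    rewrite /dpw ifT; last by lra.
    rewrite ifT; last by lra.
    have e : expR (kappa * (x - s)) =
        expR (kappa * (t - s)) * expR (- (kappa * (t - x))).
      by rewrite -expRD; congr expR; ring.
    rewrite {1}e.
    have -> : t - s = (t - x) + (x - s) by ring.
    have := ler_wpM2l (expR_ge0 (kappa * (t - x + (x - s)))) h.
    rewrite /c.
    have -> : t - s = (t - x) + (x - s) by ring.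
    move: (expR (kappa * (t - x + (x - s)))) (expR (- (kappa * (t - x))))
      (expR (- (kappa * (x - s)))) => A B C.
    move: (pw (t - x)) (pw (x - s)) (pw (t - x + (x - s))) => p q r.
    move: (2 `^ alpha) => z; nra.
rewrite ge0_integralZl//; last 2 first.
- by apply: emeasurable_funD; [exact: mr|exact: md].
- by move=> x _; rewrite -EFinD lee_fin addr_ge0 ?dpw_ge0.
rewrite (ge0_integralD (lebesgue_measure : measure (measurableTypeR R) R))//;
  last 4 first.
- by move=> x _; rewrite lee_fin dpw_ge0.
- exact: mr.
- by move=> x _; rewrite lee_fin dpw_ge0.
- exact: md.
have mE : measurable_fun setT (fun x => (dpw T kappa x)%:E).
  by apply/measurable_EFinP; exact: measurable_dpw.
have dE x : (0 <= (dpw T kappa x)%:E)%E by rewrite lee_fin dpw_ge0.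
rewrite (ge0_integral_reflect t mE dE) (ge0_integral_translate s mE dE).
rewrite -/(dmass T kappa) -[(dmass T kappa + _)%E]/(dmass T kappa + dmass T kappa)%E.
have d0 : (0 <= dmass T kappa)%E by apply: integral_ge0.
rewrite ge0_muleDr// -ge0_muleDl ?lee_fin// -EFinD.
by rewrite (_ : _ + c = 2 `^ alpha * 2 * (expR (kappa * (t - s)) * pw (t - s)))// /c; ring.
Qed.

End singular_profile.

(** * Fubini and dominated convergence for real-valued integrals *)

Section real_fubini.
Context {R : realType}.
Local Notation leb := (@lebesgue_measure R).
Local Notation mR := (measurableTypeR R).

Lemma measurable_Rintegral {d} {X : measurableType d} (f : X * mR -> R) :
  measurable_fun setT f ->
  measurable_fun setT (fun x => \int[leb]_y f (x, y)).
Proof.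
move=> mf; rewrite /Rintegral.
apply: (measurableT_comp (fine_measurable measurableT)).
under eq_fun do rewrite integralE.
have mE : measurable_fun setT (fun z : X * mR => (f z)%:E) by exact/measurable_EFinP.
apply: emeasurable_funB.
- under eq_fun do under eq_integral do rewrite funeposE.
  under eq_fun do under eq_integral do rewrite -(funeposE (fun z => (f z)%:E)).
  apply: (@measurable_fun_fubini_tonelli_F _ _ X mR R leb (fun z => (f z)%:E)^\+%E).
    exact: measurable_funepos.
  by move=> z; exact: funepos_ge0.
- under eq_fun do under eq_integral do rewrite funenegE.
  under eq_fun do under eq_integral do rewrite -(funenegE (fun z => (f z)%:E)).
  apply: (@measurable_fun_fubini_tonelli_F _ _ X mR R leb (fun z => (f z)%:E)^\-%E).
    exact: measurable_funeneg.
  by move=> z; exact: funeneg_ge0.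
Qed.

Section fubini.
Variable f : mR * mR -> R.
Hypothesis intf : (leb \x leb)%E.-integrable setT (EFin \o f).

Let finite_inner (F : mR -> \bar R) : {ae leb, forall x, F x \is a fin_num} ->
  (\int[leb]_x (fine (F x))%:E = \int[leb]_x F x)%E.
Proof.
move=> [N [mN N0 subN]].
apply: (@integral_eq_negligible _ mR R leb _ N) => // x _ nN.
by rewrite fineK//; apply: contrapT => h; exact/nN/subN.
Qed.

(** The inner integrals may be infinite on a null set, where their real parts
    are meaningless; this does not affect the outer integrals. *)
Lemma Rintegral_fubini :
  \int[leb]_x (\int[leb]_y f (x, y)) = \int[leb]_y (\int[leb]_x f (x, y)).
Proof.
rewrite {1}/Rintegral [RHS]/Rintegral; congr fine.
rewrite (@finite_inner (fun x => \int[leb]_y (f (x, y))%:E)%E); last first.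
  by apply: filterS (ae_integrable1 intf) => x; exact: integrable_fin_num.
rewrite (@finite_inner (fun y => \int[leb]_x (f (x, y))%:E)%E); last first.
  by apply: filterS (ae_integrable2 intf) => x; exact: integrable_fin_num.
exact: (Fubini intf).
Qed.

End fubini.

Lemma integrable_prod_bound (f : mR * mR -> R) (b : mR * mR -> R) :
  measurable_fun setT f -> measurable_fun setT b ->
  (forall z, `|f z| <= b z) ->
  (\int[leb]_x \int[leb]_y (b (x, y))%:E < +oo)%E ->
  (leb \x leb)%E.-integrable setT (EFin \o f).
Proof.
move=> mf mb fb boo; have b0 z : 0 <= b z by apply: le_trans (fb z).
apply: (@le_integrable _ _ _ _ _ measurableT _ (EFin \o b)).
- exact/measurable_EFinP.
- by move=> z _ /=; rewrite lee_fin (ger0_norm (b0 z)).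
- apply/integrable12ltyP; first exact/measurable_EFinP.
  apply: le_lt_trans boo; apply: ge0_le_integral => //.
  + by move=> x _; apply: integral_ge0.
  + apply: (@measurable_fun_fubini_tonelli_F _ _ mR mR R leb (fun z => `|(EFin \o b) z|%E)) => //.
    by apply/measurableT_comp => //; exact/measurable_EFinP.
  + apply: (@measurable_fun_fubini_tonelli_F _ _ mR mR R leb (EFin \o b)) => //.
    exact/measurable_EFinP.
  + move=> x _; rewrite le_eqVlt; apply/orP; left; apply/eqP.
    by apply: eq_integral => y _ /=; rewrite ger0_norm.
Qed.

End real_fubini.

Section real_dominated.
Context {d} {X : measurableType d} {R : realType}.
Variable nu : {measure set X -> \bar R}.

Lemma Rdominated_cvg (D : set X) (f_ : nat -> X -> R) (f g : X -> R) :
  measurable D -> (forall n, measurable_fun D (f_ n)) ->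
  (forall x, D x -> f_ n x @[n --> \oo] --> f x) ->
  nu.-integrable D (EFin \o g) ->
  (forall n x, D x -> `|f_ n x| <= g x) ->
  \int[nu]_(x in D) f_ n x @[n --> \oo] --> \int[nu]_(x in D) f x.
Proof.
move=> mD mf ff ig fg.
have mlim : measurable_fun D f by apply: (measurable_fun_cvg mf).
have intf : nu.-integrable D (EFin \o f).
  apply: (@le_integrable _ _ _ _ _ mD _ (EFin \o g)) => //.
    exact/measurable_EFinP.
  move=> x Dx /=; rewrite lee_fin (le_trans _ (ler_norm _))//.
  have c : `|f_ n x| @[n --> \oo] --> `|f x| by apply: cvg_norm; exact: ff.
  rewrite -(cvg_lim _ c)//.
  apply: limr_le; first by apply/cvg_ex; eexists; exact: c.
  by apply: nearW => n; exact: fg.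
apply: fine_cvg; rewrite fineK; last exact: integrable_fin_num.
apply: (@dominated_cvg _ _ _ _ _ mD _ _ (EFin \o g)) => //.
- by move=> n; exact/measurable_EFinP.
- move=> x Dx; apply/fine_cvgP; split; first exact: nearW.
  exact: ff.
Qed.

End real_dominated.

(** * Resolvents of weakly singular Volterra kernels *)

Lemma measurable_uncurry {R : realType} {d} {X : measurableType d}
    (k : R -> R -> R) (u v : X -> measurableTypeR R) :
  measurable_fun setT (fun p : measurableTypeR R * measurableTypeR R => k p.1 p.2) ->
  measurable_fun setT u -> measurable_fun setT v ->
  measurable_fun setT (fun x => k (u x) (v x)).
Proof.
move=> mk mu mv.
exact: (measurableT_comp mk (measurable_fun_pair mu mv)).
Qed.

Section volterra_kernel.
Context {R : realType}.
Local Notation leb := (@lebesgue_measure R).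
Local Notation mR := (measurableTypeR R).
Variables (alpha T C1 kappa : R).
Hypotheses (alpha_gt0 : 0 < alpha) (alpha_lt1 : alpha < 1) (T_gt0 : 0 < T)
  (C1_ge0 : 0 <= C1) (kappa_ge0 : 0 <= kappa).
Hypothesis kappaP :
  ((C1 * (2 `^ alpha * 2))%:E * dmass alpha (T + 1) kappa <= (2^-1)%:E)%E.
Implicit Types (s t : R).
Local Notation pw := (pw alpha).

Variable h : R -> R -> R.
Hypothesis mh : measurable_fun setT (fun p : mR * mR => h p.1 p.2).
Hypothesis h_ge0 : forall t s, 0 <= h t s.
Hypothesis h_le : forall t s, h t s <= C1 * pw (t - s).
Hypothesis h_supp : forall t s, ~~ ((0 < s) && (t < T)) -> h t s = 0.

(** Iterated kernels as integrals over the whole line: the kernel [h] is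
    understood to vanish unless [0 < s < t < T]. *)
Fixpoint kiter (n : nat) (t s : R) : R :=
  if n is m.+1 then \int[leb]_x (h t x * kiter m x s) else h t s.

Let bnd (n : nat) t s := C1 * 2^-1 ^+ n * (expR (kappa * (t - s)) * pw (t - s)).

Let bnd_ge0 n t s : 0 <= bnd n t s.
Proof. by rewrite !mulr_ge0 ?exprn_ge0 ?expR_ge0 ?pw_ge0. Qed.

Let m_sub1 (s : R) : measurable_fun setT (fun x : mR => (x - s)%R).
Proof. exact: measurable_funB. Qed.

Let m_sub2 (s : R) : measurable_fun setT (fun x : mR => (s - x)%R).
Proof. exact: measurable_funB. Qed.

Let m_hx (t : R) : measurable_fun setT (fun x : mR => h t x).
Proof. exact: (measurable_fun_pair2 t mh). Qed.

(** The bound [bnd n] carries the factor [2^(-n)]: by [kappaP] the factor lost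
    in [pw_conv] is at most [1/2]. *)
Lemma kiter_spec n :
  [/\ measurable_fun setT (fun p : mR * mR => kiter n p.1 p.2),
      forall t s, 0 <= kiter n t s <= bnd n t s &
      forall t s, ~~ ((0 < s) && (t < T)) -> kiter n t s = 0].
Proof.
elim: n => [|n [mk bk zk]] /=.
  split => // t s; rewrite h_ge0/= (le_trans (h_le _ _))// /bnd expr0 mulr1.
  rewrite ler_wpM2l//; have [ts|ts] := leP (t - s) 0; first by rewrite pw0 ?mulr0.
  by rewrite ler_peMl ?pw_ge0// -expR0 ler_expR mulr_ge0// ltW.
have k0 t s : 0 <= kiter n t s by have /andP[] := bk t s.
split.
- apply: (@measurable_Rintegral R _ (mR * mR)%type
    (fun z => h z.1.1 z.2 * kiter n z.2 z.1.2)).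
  apply: measurable_funM.
    apply: (measurable_uncurry mh) => //.
    exact: (measurableT_comp measurable_fst measurable_fst).
  apply: (measurable_uncurry mk) => //.
  exact: (measurableT_comp measurable_snd measurable_fst).
- move=> t s; apply/andP; split.
    by apply: Rintegral_ge0 => x _; rewrite mulr_ge0.
  have [/andP[s0 tT]|nst] := boolP ((0 < s) && (t < T)); last first.
    rewrite [X in X <= _](_ : _ = 0) ?bnd_ge0//.
    rewrite /Rintegral integral0_eq// => x _.
    have [s0|s0] := boolP (0 < s); last by rewrite zk ?mulr0// negb_and s0.
    by rewrite s0/= in nst; rewrite h_supp ?mul0r// negb_and nst orbT.
  have mk' : measurable_fun setT (fun x : mR => kiter n x s).
    exact: (measurable_fun_pair1 s mk).
  suff le : (\int[leb]_x (h t x * kiter n x s)%:E <= (bnd n.+1 t s)%:E)%E.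
    rewrite -lee_fin fineK//; apply/fin_numPlt/andP; split.
      rewrite (lt_le_trans (ltNyr 0))//; apply: integral_ge0 => x _.
      by rewrite lee_fin mulr_ge0.
    by rewrite (le_lt_trans le)// ltry.
  pose cn := C1 * (C1 * 2^-1 ^+ n).
  have cn0 : 0 <= cn by rewrite !mulr_ge0// exprn_ge0.
  apply: (@le_trans _ _ (\int[leb]_x (cn%:E *
      (pw (t - x) * (expR (kappa * (x - s)) * pw (x - s)))%:E))%E).
    apply: ge0_le_integral => //.
    + by move=> x _; rewrite lee_fin mulr_ge0.
    + by apply/measurable_EFinP; apply: measurable_funM.
    + apply: emeasurable_funM => //; apply/measurable_EFinP.
      apply: measurable_funM.
        exact: (measurableT_comp (measurable_pw _)).
      apply: measurable_funM.
        apply: measurableT_comp; first exact: measurable_expR.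
        by apply: measurable_funM.
      exact: (measurableT_comp (measurable_pw _)).
    + move=> x _; rewrite -EFinM lee_fin.
      have /andP[_ bx] := bk x s.
      have := ler_pM (h_ge0 t x) (k0 x s) (h_le t x) bx.
      move/le_trans; apply; rewrite /bnd /cn le_eqVlt; apply/orP; left; apply/eqP; ring.
  rewrite ge0_integralZl//; last 2 first.
    apply/measurable_EFinP; apply: measurable_funM.
      exact: (measurableT_comp (measurable_pw _)).
    apply: measurable_funM.
      apply: measurableT_comp; first exact: measurable_expR.
      by apply: measurable_funM.
    exact: (measurableT_comp (measurable_pw _)).
    by move=> x _; rewrite lee_fin !mulr_ge0 ?expR_ge0 ?pw_ge0.
  have tsT : t - s < T + 1 by lra.
  have := pw_conv alpha_gt0 kappa_ge0 tsT.
  move/(lee_wpmul2l (x := cn%:E)) => /(_ _)/le_trans -> //.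
  rewrite muleA -EFinM.
  have -> : cn * (2 `^ alpha * 2 * (expR (kappa * (t - s)) * pw (t - s))) =
    bnd n t s * (C1 * (2 `^ alpha * 2)) by rewrite /cn /bnd; ring.
  rewrite EFinM -muleA.
  have := lee_wpmul2l (x := (bnd n t s)%:E) _ kappaP.
  rewrite lee_fin => /(_ (bnd_ge0 _ _ _))/le_trans; apply.
  by rewrite -EFinM lee_fin /bnd exprSr le_eqVlt; apply/orP; left; apply/eqP; ring.
- move=> t s nst; rewrite /Rintegral integral0_eq// => x _.
  have [s0|s0] := boolP (0 < s); last by rewrite zk ?mulr0// negb_and s0.
  by rewrite s0/= in nst; rewrite h_supp ?mul0r// negb_and nst orbT.
Qed.

(** The signs are those of the resolvent for [y + int h y = g], whose solution
    is [g + int kres g]. *)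
Definition kpart (N : nat) t s : R :=
  \sum_(0 <= n < N) (-1) ^+ n.+1 * kiter n t s.

Definition kres t s : R := limn (kpart^~ t ^~ s).

Local Notation D := (dpw alpha (T + 1) 0).
Let C2 := 2 * (C1 * expR (kappa * (T + 1))).

Let C2_ge0 : 0 <= C2.
Proof. by rewrite !mulr_ge0// expR_ge0. Qed.

Let kiter_ge0 n t s : 0 <= kiter n t s.
Proof. by case: (kiter_spec n) => _ /(_ t s)/andP[]. Qed.

Let kiter_supp n t s : ~~ ((0 < s) && (t < T)) -> kiter n t s = 0.
Proof. by case: (kiter_spec n) => _ _; exact. Qed.

Let m_kiter n : measurable_fun setT (fun p : mR * mR => kiter n p.1 p.2).
Proof. by case: (kiter_spec n). Qed.

Lemma dpw0E s t : t - s < T + 1 -> D (t - s) = pw (t - s).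
Proof. by move=> ts; rewrite /dpw ts mul0r oppr0 expR0 mul1r. Qed.

Lemma kiter_le n t s :
  kiter n t s <= C1 * expR (kappa * (T + 1)) * D (t - s) * 2^-1 ^+ n.
Proof.
have [/andP[s0 tT]|nst] := boolP ((0 < s) && (t < T)); last first.
  by rewrite kiter_supp// !mulr_ge0 ?exprn_ge0 ?expR_ge0 ?dpw_ge0.
case: (kiter_spec n) => _ /(_ t s)/andP[_ /le_trans h1] _; apply: h1.
have ts : t - s < T + 1 by lra.
rewrite dpw0E// /bnd.
have e : expR (kappa * (t - s)) <= expR (kappa * (T + 1)).
  by rewrite ler_expR ler_wpM2l// ltW.
have -> : C1 * 2^-1 ^+ n * (expR (kappa * (t - s)) * pw (t - s)) =
  (C1 * 2^-1 ^+ n * pw (t - s)) * expR (kappa * (t - s)) by ring.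
have -> : C1 * expR (kappa * (T + 1)) * pw (t - s) * 2^-1 ^+ n =
  (C1 * 2^-1 ^+ n * pw (t - s)) * expR (kappa * (T + 1)) by ring.
by rewrite ler_wpM2l// !mulr_ge0 ?exprn_ge0 ?pw_ge0.
Qed.

Lemma kpart_le N t s : `|kpart N t s| <= C2 * D (t - s).
Proof.
have half : \sum_(0 <= n < N) (2^-1 : R) ^+ n <= 2.
  suff -> : \sum_(0 <= n < N) (2^-1 : R) ^+ n = 2 - 2 * 2^-1 ^+ N.
    by rewrite lerBlDr lerDl mulr_ge0// exprn_ge0.
  elim: N => [|N IH]; first by rewrite big_nil expr0; lra.
  by rewrite big_nat_recr//= IH exprS; field.
apply: (le_trans (ler_norm_sum _ _ _)).
pose c := C1 * expR (kappa * (T + 1)) * D (t - s).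
have c0 : 0 <= c by rewrite !mulr_ge0 ?expR_ge0 ?dpw_ge0.
apply: (@le_trans _ _ (\sum_(0 <= n < N) c * 2^-1 ^+ n)).
  apply: ler_sum => n _.
  rewrite normrM normrX normrN1 expr1n mul1r ger0_norm//; exact: kiter_le.
rewrite -mulr_sumr /C2 -[leRHS]mulrA -/c mulrC; exact: ler_wpM2r.
Qed.

Lemma kres_cvg t s : kpart N t s @[N --> \oo] --> kres t s.
Proof.
suff : cvgn (kpart^~ t ^~ s) by [].
apply: (@normed_cvg _ R^o (fun n => (-1) ^+ n.+1 * kiter n t s)).
pose c := C1 * expR (kappa * (T + 1)) * D (t - s).
apply: (@series_le_cvg _ _ (geometric c 2^-1)) => //.
- by move=> n; exact: normr_ge0.
- move=> n; rewrite /geometric/= mulr_ge0 ?exprn_ge0//.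
  by rewrite !mulr_ge0 ?expR_ge0 ?dpw_ge0.
- move=> n; rewrite /= normrM normrX normrN1 expr1n mul1r ger0_norm//.
  exact: kiter_le.
- by apply: is_cvg_geometric_series; rewrite ger0_norm//; lra.
Qed.

Lemma kres_le t s : `|kres t s| <= C2 * D (t - s).
Proof.
have c : `|kpart N t s| @[N --> \oo] --> `|kres t s|.
  by apply: cvg_norm; exact: kres_cvg.
rewrite -(cvg_lim _ c)//.
apply: limr_le; first by apply/cvg_ex; eexists; exact: c.
by apply: nearW => n; exact: kpart_le.
Qed.

Let kpart_supp N t s : ~~ ((0 < s) && (t < T)) -> kpart N t s = 0.
Proof.
by move=> nst; rewrite /kpart big1// => n _; rewrite kiter_supp// mulr0.
Qed.

Lemma kres_supp t s : ~~ ((0 < s) && (t < T)) -> kres t s = 0.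
Proof.
move=> nst; apply/cvg_lim => //.
by under eq_fun do rewrite kpart_supp//; exact: cvg_cst.
Qed.

Let m_kpart N : measurable_fun setT (fun p : mR * mR => kpart N p.1 p.2).
Proof.
apply: (@measurable_sum _ (mR * mR)%type R setT nat (index_iota 0 N)
  (fun n p => (-1) ^+ n.+1 * kiter n p.1 p.2)) => n.
by apply: measurable_funM.
Qed.

Lemma measurable_kres : measurable_fun setT (fun p : mR * mR => kres p.1 p.2).
Proof.
apply: (measurable_fun_cvg m_kpart) => p _; exact: kres_cvg.
Qed.

Let m_D1 s : measurable_fun setT (fun x : mR => D (x - s)).
Proof. exact: (measurableT_comp (measurable_dpw _ _ _)). Qed.

Let m_D2 s : measurable_fun setT (fun x : mR => D (s - x)).
Proof. exact: (measurableT_comp (measurable_dpw _ _ _)). Qed.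

Lemma h_leD t s : h t s <= C1 * D (t - s).
Proof.
have [/andP[s0 tT]|nst] := boolP ((0 < s) && (t < T)); last first.
  by rewrite h_supp// mulr_ge0 ?dpw_ge0.
by rewrite dpw0E ?h_le//; lra.
Qed.

Let DD_lty t s : t - s < T + 1 ->
  (\int[leb]_x (D (t - x) * D (x - s))%:E < +oo)%E.
Proof.
move=> ts; have := pw_conv alpha_gt0 (lexx (0 : R)) ts.
have fin : (dmass alpha (T + 1) 0 < +oo)%E.
  have T1 : 0 < T + 1 by rewrite addr_gt0.
  by rewrite (le_lt_trans (dmass0_le alpha_lt1 T1))// ltry.
have m0 : (0 <= dmass alpha (T + 1) 0)%E.
  by apply: integral_ge0 => x _; rewrite lee_fin dpw_ge0.
set c := (X in (_ <= X)%E) => le1.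
have : (c < +oo)%E.
  by rewrite /c lte_mul_pinfty// lee_fin !mulr_ge0 ?powR_ge0 ?expR_ge0 ?pw_ge0.
apply: le_lt_trans; apply: le_trans le1; apply: ge0_le_integral => //.
- by move=> x _; rewrite lee_fin mulr_ge0 ?dpw_ge0.
- by apply/measurable_EFinP; apply: measurable_funM.
- apply/measurable_EFinP; apply: measurable_funM.
    exact: (measurableT_comp (measurable_pw _)).
  apply: measurable_funM.
    apply: measurableT_comp; first exact: measurable_expR.
    by apply: measurable_funM.
  exact: (measurableT_comp (measurable_pw _)).
- move=> x _; rewrite lee_fin mul0r expR0 mul1r.
  have Dpw u : D u <= pw u.
    rewrite /dpw; case: ifP => _; rewrite ?pw_ge0//.
    by rewrite mul0r oppr0 expR0 mul1r.
  by apply: ler_pM => //; exact: dpw_ge0.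
Qed.

Let hk_bound (k : R -> R) t s x : (`|k x| <= C2 * D (x - s)) ->
  `|h t x * k x| <= (C1 * C2) * (D (t - x) * D (x - s)).
Proof.
move=> kx; rewrite normrM (ger0_norm (h_ge0 _ _)).
have := ler_pM (h_ge0 t x) (normr_ge0 (k x)) (h_leD t x) kx.
by move/le_trans; apply; rewrite le_eqVlt; apply/orP; left; apply/eqP; ring.
Qed.

Let DD_int t s : t - s < T + 1 ->
  leb.-integrable setT (EFin \o (fun x => (C1 * C2) * (D (t - x) * D (x - s)))).
Proof.
move=> ts; rewrite [X in _.-integrable _ X](_ : _ =
  fun x => ((C1 * C2)%:E * (D (t - x) * D (x - s))%:E)%E); last first.
  by apply/funext => x /=; rewrite EFinM.
apply: integrableZl => //; apply/integrableP; split.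
  by apply/measurable_EFinP; apply: measurable_funM.
rewrite (le_lt_trans _ (DD_lty ts))//; apply: ge0_le_integral => //.
- by apply/measurableT_comp => //; apply/measurable_EFinP; apply: measurable_funM.
- by apply/measurable_EFinP; apply: measurable_funM.
- by move=> x _; rewrite /= ger0_norm// mulr_ge0 ?dpw_ge0.
Qed.

Let hk_int (k : R -> R) t s : t - s < T + 1 ->
  measurable_fun setT (k : mR -> R) ->
  (forall x, `|k x| <= C2 * D (x - s)) ->
  leb.-integrable setT (EFin \o (fun x => h t x * k x)).
Proof.
move=> ts mk kb; apply: (le_integrable _ _ _ (DD_int ts)) => //.
  by apply/measurable_EFinP; apply: measurable_funM.
move=> x _; rewrite /= lee_fin (le_trans (hk_bound t (kb x)))//.
exact: ler_norm.
Qed.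

(** Term by term, this is the recursion [kiter_(n+1) = int h kiter_n]; its limit
    is the resolvent equation [kresE]. *)
Lemma kpartS N t s : 0 < s -> t < T ->
  kpart N.+1 t s = - h t s - \int[leb]_x (h t x * kpart N x s).
Proof.
move=> s0 tT; have ts : t - s < T + 1 by lra.
elim: N => [|N IH].
  rewrite /kpart big_nat1 expr1 mulN1r/=.
  under eq_Rintegral do rewrite big_nil mulr0.
  by rewrite /Rintegral integral0 subr0.
have -> : kpart N.+2 t s = kpart N.+1 t s + (-1) ^+ N.+2 * kiter N.+1 t s.
  by rewrite /kpart big_nat_recr.
rewrite IH -addrA; congr (_ + _).
under [in RHS]eq_Rintegral => x _.
  have -> : kpart N.+1 x s = kpart N x s + (-1) ^+ N.+1 * kiter N x s.
    by rewrite /kpart big_nat_recr.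
  rewrite mulrDr; over.
have mkx n : measurable_fun setT (fun x : mR => kiter n x s).
  exact: (measurable_fun_pair1 s (m_kiter n)).
have i1 : leb.-integrable setT (EFin \o (fun x => h t x * kpart N x s)).
  apply: (hk_int ts); first exact: (measurable_fun_pair1 s (m_kpart N)).
  by move=> x; exact: kpart_le.
have i3 : leb.-integrable setT (EFin \o (fun x => h t x * kiter N x s)).
  apply: (hk_int ts) => // x; rewrite ger0_norm//.
  apply: (le_trans (kiter_le _ _ _)); rewrite /C2.
  have e1 : (2^-1 : R) ^+ N <= 1 by rewrite exprn_ile1//; lra.
  have := ler_wpM2l (x := C1 * expR (kappa * (T + 1)) * D (x - s)) _ e1.
  rewrite !mulr_ge0 ?expR_ge0 ?dpw_ge0// => /(_ isT)/le_trans; apply.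
  have : 0 <= C1 * expR (kappa * (T + 1)) * D (x - s).
    by rewrite !mulr_ge0 ?expR_ge0 ?dpw_ge0.
  by move=> ?; lra.
have e x : h t x * ((-1) ^+ N.+1 * kiter N x s) =
    (-1) ^+ N.+1 * (h t x * kiter N x s) by ring.
under [in RHS]eq_Rintegral do rewrite e.
rewrite RintegralD//; last first.
  rewrite [X in _.-integrable _ X](_ : _ =
    fun x => (((-1) ^+ N.+1)%:E * (h t x * kiter N x s)%:E)%E).
    exact: integrableZl.
  by apply/funext => x /=; rewrite EFinM.
rewrite RintegralZl//= opprD; congr (_ + _).
by rewrite exprS mulN1r mulNr.
Qed.

(** The limit is taken under the integral by domination with the convolution of
    two profiles, which is finite off the diagonal. *)
Lemma kresE t s : kres t s = - h t s - \int[leb]_x (h t x * kres x s).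
Proof.
have [/andP[s0 tT]|nst] := boolP ((0 < s) && (t < T)); last first.
  rewrite kres_supp// h_supp// oppr0 add0r.
  rewrite /Rintegral integral0_eq ?oppr0// => x _.
  have [s0|s0] := boolP (0 < s); last by rewrite kres_supp ?mulr0// negb_and s0.
  by rewrite s0/= in nst; rewrite h_supp ?mul0r// negb_and nst orbT.
have ts : t - s < T + 1 by lra.
have c1 : kpart N.+1 t s @[N --> \oo] --> kres t s.
  by have := @kres_cvg t s; rewrite -cvg_shiftS.
have e : (fun N => kpart N.+1 t s) =
    (fun N => - h t s - \int[leb]_x (h t x * kpart N x s)).
  by apply/funext => N; exact: kpartS.
rewrite e in c1; apply: (cvg_unique _ c1) => //.
have c2 : \int[leb]_x (h t x * kpart N x s) @[N --> \oo] -->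
    \int[leb]_x (h t x * kres x s).
  apply: (Rdominated_cvg _ _ _ (DD_int ts)) => //.
  - move=> n; apply: measurable_funM => //.
    exact: (measurable_fun_pair1 s (m_kpart n)).
  - by move=> x _; apply: cvgMl_tmp; exact: kres_cvg.
  - by move=> n x _; apply: (hk_bound t (k := kpart n ^~ s)); exact: kpart_le.
by apply: cvgB; [exact: cvg_cst|exact: c2].
Qed.

Local Notation M0 := (dmass alpha (T + 1) 0).

Let T1_gt0 : 0 < T + 1. Proof. by rewrite addr_gt0. Qed.

Let M0_ge0 : (0 <= M0)%E.
Proof. by apply: integral_ge0 => x _; rewrite lee_fin dpw_ge0. Qed.

Let M0_fin : M0 = (fine M0)%:E.
Proof.
rewrite fineK// ge0_fin_numE//.
by rewrite (le_lt_trans (dmass0_le alpha_lt1 T1_gt0))// ltry.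
Qed.

Let fM0_ge0 : 0 <= fine M0. Proof. exact: fine_ge0. Qed.

Let m_DE : measurable_fun setT (fun x : mR => (D x)%:E).
Proof. by apply/measurable_EFinP; exact: measurable_dpw. Qed.

Let int_D2 t : (\int[leb]_x (D (t - x))%:E = (fine M0)%:E)%E.
Proof.
rewrite -M0_fin; apply: (ge0_integral_reflect t m_DE) => x.
by rewrite lee_fin dpw_ge0.
Qed.

Let int_D1 s : (\int[leb]_x (D (x - s))%:E = (fine M0)%:E)%E.
Proof.
rewrite -M0_fin; apply: (ge0_integral_translate s m_DE) => x.
by rewrite lee_fin dpw_ge0.
Qed.

Let int_cD2 t c : 0 <= c -> (\int[leb]_x (c * D (t - x))%:E = (c * fine M0)%:E)%E.
Proof.
move=> c0; under eq_integral do rewrite EFinM.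
rewrite ge0_integralZl//; first by rewrite int_D2.
- by apply/measurable_EFinP.
- by move=> x _; rewrite lee_fin dpw_ge0.
Qed.

Let int_cD1 s c : 0 <= c -> (\int[leb]_x (c * D (x - s))%:E = (c * fine M0)%:E)%E.
Proof.
move=> c0; under eq_integral do rewrite EFinM.
rewrite ge0_integralZl//; first by rewrite int_D1.
- by apply/measurable_EFinP.
- by move=> x _; rewrite lee_fin dpw_ge0.
Qed.

Let m_kres1 t : measurable_fun setT (fun x : mR => kres t x).
Proof. exact: (measurable_fun_pair2 t measurable_kres). Qed.

Let m_kres2 s : measurable_fun setT (fun x : mR => kres x s).
Proof. exact: (measurable_fun_pair1 s measurable_kres). Qed.

Let dominated_int (k b : mR -> R) c : measurable_fun setT k ->
  measurable_fun setT b -> (forall x, `|k x| <= b x) ->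
  (\int[leb]_x (b x)%:E = c%:E)%E ->
  leb.-integrable setT (EFin \o k) /\ `|\int[leb]_x k x| <= c.
Proof.
move=> mk mb kb ibc.
have mkE : measurable_fun setT (EFin \o k) by exact/measurable_EFinP.
have le : (\int[leb]_x `|(k x)%:E| <= c%:E)%E.
  rewrite -ibc; apply: ge0_le_integral => //.
  - exact/measurableT_comp.
  - exact/measurable_EFinP.
  - by move=> x _; rewrite lee_fin.
have ik : leb.-integrable setT (EFin \o k).
  by apply/integrableP; split => //; rewrite (le_lt_trans le)// ltry.
split => //; rewrite -lee_fin EFin_normr_Rintegral//.
exact: le_trans (le_abse_integral _ _ _) le.
Qed.

Let hkres_int t s : leb.-integrable setT (EFin \o (fun x => h t x * kres x s)).
Proof.
have [/andP[s0 tT]|nst] := boolP ((0 < s) && (t < T)).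
  have ts : t - s < T + 1 by lra.
  exact: (hk_int ts (m_kres2 s) (fun x => kres_le x s)).
rewrite (_ : _ \o _ = cst 0%E); first exact: integrable0.
apply/funext => x /=.
have [s0|s0] := boolP (0 < s); last by rewrite kres_supp ?mulr0// negb_and s0.
by rewrite s0/= in nst; rewrite h_supp ?mul0r// negb_and nst orbT.
Qed.

Section solution.
Variables (g : R -> R) (G : R).
Hypotheses (mg : measurable_fun setT (g : mR -> R)) (gG : forall x, `|g x| <= G).

Let G_ge0 : 0 <= G. Proof. exact: le_trans (gG 0). Qed.

Definition vsol t := g t + \int[leb]_s (kres t s * g s).

Let kg_spec t : leb.-integrable setT (EFin \o (fun s => kres t s * g s)) /\
  `|\int[leb]_s (kres t s * g s)| <= C2 * G * fine M0.
Proof.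
apply: (@dominated_int _ (fun x => C2 * G * D (t - x))).
- exact: measurable_funM.
- exact: measurable_funM.
- move=> x; rewrite normrM.
  have := ler_pM (normr_ge0 _) (normr_ge0 _) (kres_le t x) (gG x).
  by rewrite mulrAC.
- by apply: int_cD2; rewrite mulr_ge0.
Qed.

Lemma measurable_vsol : measurable_fun setT (vsol : mR -> R).
Proof.
apply: measurable_funD => //.
apply: (@measurable_Rintegral R _ mR (fun z => kres z.1 z.2 * g z.2)).
apply: measurable_funM; first exact: measurable_kres.
exact: (measurableT_comp mg).
Qed.

Lemma vsol_le t : `|vsol t| <= G + C2 * G * fine M0.
Proof.
by apply: (le_trans (ler_normD _ _)); apply: lerD => //; case: (kg_spec t).
Qed.

Let hg_int t : leb.-integrable setT (EFin \o (fun s => h t s * g s)).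
Proof.
apply: (proj1 (@dominated_int _ (fun x => C1 * G * D (t - x)) _ _ _ _ _)).
- exact: measurable_funM.
- exact: measurable_funM.
- move=> x; rewrite normrM (ger0_norm (h_ge0 _ _)).
  have := ler_pM (h_ge0 t x) (normr_ge0 _) (h_leD t x) (gG x).
  by rewrite mulrAC.
- by apply: int_cD2; rewrite mulr_ge0.
Qed.

(** By Fubini, [int h (int kres g) = int (int h kres) g], and the inner integral
    is [- kres - h] by the resolvent equation. *)
Lemma vsolE t : vsol t + \int[leb]_x (h t x * vsol x) = g t.
Proof.
(* Dominated by a product of two profiles; the integral in z.2 of the second
   one does not depend on z.1. *)
have fub : (leb \x leb)%E.-integrable setT
    (EFin \o (fun z : mR * mR => h t z.1 * (kres z.1 z.2 * g z.2))).
  apply: (@integrable_prod_bound _ _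
    (fun z => (C1 * D (t - z.1)) * (C2 * G * D (z.1 - z.2)))).
  - apply: measurable_funM; first exact: (measurableT_comp (m_hx t)).
    apply: measurable_funM; first exact: measurable_kres.
    exact: (measurableT_comp mg).
  - apply: measurable_funM.
      apply: measurable_funM => //.
      exact: (measurableT_comp (m_D2 t)).
    apply: measurable_funM => //.
    apply: (measurableT_comp (measurable_dpw _ _ _)).
    exact: measurable_funB.
  - move=> z; rewrite normrM (ger0_norm (h_ge0 _ _)) normrM.
    apply: ler_pM => //; first exact: h_leD.
    have := ler_pM (normr_ge0 _) (normr_ge0 _) (kres_le z.1 z.2) (gG z.2).
    by rewrite mulrAC.
  - rewrite (eq_integral (fun x : mR =>
      (C1 * (C2 * G * fine M0) * D (t - x))%:E)); last first.
      move=> x _ /=.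
      have -> : C1 * (C2 * G * fine M0) * D (t - x) =
        (C1 * D (t - x)) * (C2 * G) * fine M0 by ring.
      rewrite -(int_cD2 x); last by rewrite !mulr_ge0 ?dpw_ge0.
      by apply: eq_integral => y _; congr (_%:E); ring.
    by rewrite int_cD2 ?ltry// !mulr_ge0.
have i1 x : leb.-integrable setT (EFin \o (fun s => kres x s * g s)).
  by case: (kg_spec x).
have i2 : leb.-integrable setT
   (EFin \o (fun x => h t x * \int[leb]_s (kres x s * g s))).
  apply: (proj1 (@dominated_int _ (fun x => C1 * (C2 * G * fine M0) * D (t - x)) _ _ _ _ _)).
  - apply: measurable_funM => //.
    apply: (@measurable_Rintegral R _ mR (fun z => kres z.1 z.2 * g z.2)).
    apply: measurable_funM; first exact: measurable_kres.
    exact: (measurableT_comp mg).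
  - exact: measurable_funM.
  - move=> x; rewrite normrM (ger0_norm (h_ge0 _ _)).
    have := ler_pM (h_ge0 t x) (normr_ge0 _) (h_leD t x) (proj2 (kg_spec x)).
    by rewrite mulrAC.
  - by apply: int_cD2; rewrite !mulr_ge0.
under eq_Rintegral => x _ do rewrite /vsol mulrDr.
rewrite RintegralD//.
have -> : \int[leb]_x (h t x * \int[leb]_s (kres x s * g s)) =
    \int[leb]_x (- kres t x * g x - h t x * g x).
  under eq_Rintegral => x _ do rewrite -RintegralZl//.
  rewrite (Rintegral_fubini fub)/=; apply: eq_Rintegral => s _.
  under eq_Rintegral => x _ do rewrite mulrA.
  rewrite RintegralZr//.
  have := kresE t s; move: (Rintegral _ _ _) => I ->; ring.
rewrite RintegralB//; last first.
  rewrite [X in _.-integrable _ X](_ : _ = fun x => ((-1)%:E * (kres t x * g x)%:E)%E).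
    by apply: integrableZl => //; exact: (i1 t).
  by apply/funext => x /=; rewrite -EFinM; congr (_%:E); ring.
rewrite /vsol.
have -> : \int[leb]_x (- kres t x * g x) = - \int[leb]_x (kres t x * g x).
  under eq_Rintegral => x _ do rewrite mulNr -mulN1r.
  by rewrite RintegralZl// mulN1r.
ring.
Qed.

End solution.

(** The total mass that the resolvent transports from time [s] to later times;
    after exchanging the integrals in [B_k(T)] it becomes part of the weight of
    [f_k(s)]. *)
Definition kmass s := \int[leb]_t kres t s.

Lemma kmass_le s : `|kmass s| <= C2 * fine M0.
Proof.
apply: (proj2 (@dominated_int _ (fun x => C2 * D (x - s)) _ _ _ _ _)) => //.
- exact: measurable_funM.
- by move=> x; exact: kres_le.
- exact: int_cD1.
Qed.

Lemma measurable_kmass : measurable_fun setT (kmass : mR -> R).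
Proof.
apply: (@measurable_Rintegral R _ mR (fun z => kres z.2 z.1)).
exact: (measurable_uncurry measurable_kres).
Qed.

Lemma kres_swap (phi : R -> R) : leb.-integrable setT (EFin \o phi) ->
  \int[leb]_t (\int[leb]_s (kres t s * phi s)) =
  \int[leb]_s (phi s * kmass s).
Proof.
move=> iphi.
have mphi : measurable_fun setT (phi : mR -> R).
  by apply/measurable_EFinP; case/integrableP: iphi.
have mb : measurable_fun setT
    (fun z : mR * mR => C2 * D (z.1 - z.2) * `|phi z.2|).
  apply: measurable_funM.
    apply: measurable_funM => //.
    apply: (measurableT_comp (measurable_dpw _ _ _)).
    exact: measurable_funB.
  by apply: measurableT_comp => //; exact: (measurableT_comp mphi).
have fub : (leb \x leb)%E.-integrable setT
    (EFin \o (fun z : mR * mR => kres z.1 z.2 * phi z.2)).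
  apply: (integrable_prod_bound _ mb).
  - apply: measurable_funM; first exact: measurable_kres.
    exact: (measurableT_comp mphi).
  - by move=> z; rewrite normrM ler_wpM2r// kres_le.
  - rewrite (@fubini_tonelli _ _ mR mR R leb leb
      (fun z => (C2 * D (z.1 - z.2) * `|phi z.2|)%:E))/=; last 2 first.
      exact/measurable_EFinP.
      by move=> z; rewrite lee_fin !mulr_ge0 ?dpw_ge0.
    rewrite (eq_integral (fun y : mR => (C2 * fine M0)%:E * `|(phi y)%:E|)%E); last first.
      move=> y _ /=.
      under eq_integral => x _ do rewrite mulrAC.
      by rewrite int_cD1 ?mulr_ge0// -EFinM mulrAC.
    rewrite ge0_integralZl//; last 2 first.
      by apply/measurableT_comp => //; exact/measurable_EFinP.
      by rewrite lee_fin mulr_ge0.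
    rewrite lte_mul_pinfty// ?lee_fin ?mulr_ge0//.
    by case/integrableP: iphi.
rewrite (Rintegral_fubini fub)/=; apply: eq_Rintegral => s _.
rewrite RintegralZr//; first by rewrite mulrC.
apply: (proj1 (@dominated_int _ (fun x => C2 * D (x - s)) _ _ _ _ _)) => //.
- exact: measurable_funM.
- by move=> x; exact: kres_le.
- exact: int_cD1.
Qed.

End volterra_kernel.

(** * Positivity and decay for the Volterra equation *)

Lemma Rintegral_split {R : realType} (f : R -> R) (a t b : R) :
  a <= t -> t <= b ->
  (@lebesgue_measure R).-integrable `]a, b[ (EFin \o f) ->
  \int[lebesgue_measure]_(x in `]a, b[) f x =
  \int[lebesgue_measure]_(x in `]a, t[) f x +
  \int[lebesgue_measure]_(x in `]t, b[) f x.
Proof.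
move=> at_; rewrite le_eqVlt => /predU1P[<- _|tb intf].
  by rewrite [X in _ + X](_ : _ = 0) ?addr0// set_itv_ge ?Rintegral_set0// bnd_simp ltxx.
have it : (@lebesgue_measure R).-integrable `]a, t[ (EFin \o f).
  by apply: integrableS intf => //; apply: subset_itvl; rewrite bnd_simp ltW.
rewrite -(@Rintegral_itvB _ f (BRight a) (BLeft b) t intf) ?bnd_simp//.
by rewrite (Rintegral_itv_bndo_bndc it) addrCA subrr addr0.
Qed.

Section decay.
Context {R : realType}.
Local Notation leb := (@lebesgue_measure R).
Local Notation mR := (measurableTypeR R).
Variables (alpha T mu0 c Z : R) (m z : R -> R).
Hypotheses (alpha_gt0 : 0 < alpha) (alpha_lt1 : alpha < 1) (T_gt0 : 0 < T)
  (mu0_gt0 : 0 < mu0) (c_ge0 : 0 <= c).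
Implicit Types (s t r a b : R).
Local Notation pw := (pw alpha).
Hypothesis mz : measurable_fun setT (z : mR -> R).
Hypothesis zZ : forall t, `|z t| <= Z.
Hypothesis m_bounds : forall t, 0 <= t < T -> 0 < m t <= mu0^-1.

(** With [m = 1/mu], this is the function [mu z], that is, the right-hand side
    of the equation solved by [z]. *)
Definition rem t : R := 1 - \int[leb]_(s in `]0, t[) ((1 + c * pw (t - s)) * z s).

Hypothesis zE : forall t, 0 <= t < T -> z t = m t * rem t.

(** The integral of the kernel [1 + c u^(-alpha)] over [(0, r)]. *)
Definition Kprim r := r + c * (r `^ (1 - alpha) / (1 - alpha)).

Local Notation k := Kprim.

Let K_ge0 t s : 0 <= 1 + c * pw (t - s).
Proof. by rewrite addr_ge0// mulr_ge0// pw_ge0. Qed.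

Let m_K t : measurable_fun setT (fun s : mR => 1 + c * pw (t - s)).
Proof.
apply: measurable_funD => //; apply: measurable_funM => //.
apply: (measurableT_comp (measurable_pw _)); exact: measurable_funB.
Qed.

Let Z_ge0 : 0 <= Z. Proof. exact: le_trans (zZ 0). Qed.

Let K_le a b : a < b -> (\int[leb]_(s in `]a, b[) (1 + c * pw (b - s))%:E <= (k (b - a))%:E)%E.
Proof.
move=> ab.
under eq_integral do rewrite EFinD.
rewrite ge0_integralD//; last 2 first.
- by move=> x _; rewrite lee_fin mulr_ge0// pw_ge0.
- apply/measurable_EFinP; apply: measurable_funTS; apply: measurable_funM => //.
  apply: (measurableT_comp (measurable_pw _)); exact: measurable_funB.
rewrite integral_cst//= lebesgue_measure_itv/= lte_fin ab mul1e.
rewrite /Kprim EFinD -EFinB; apply: leeD => //.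
have mp : measurable_fun setT (fun x : mR => (pw (b - x))%:E).
  apply/measurable_EFinP.
  apply: (measurableT_comp (measurable_pw _)); exact: measurable_funB.
under eq_integral do rewrite EFinM.
rewrite ge0_integralZl//; last 2 first.
- exact: measurable_funTS.
- by move=> x _; rewrite lee_fin pw_ge0.
rewrite EFinM; apply: lee_wpmul2l; first by rewrite lee_fin.
have ba : 0 < b - a by rewrite subr_gt0.
apply: le_trans (integral_pw_le alpha_lt1 ba).
rewrite integral_mkcond [leRHS]integral_mkcond.
pose g : mR -> \bar R := (fun u : mR => (pw u)%:E) \_ `]0, (b - a)[.
have mg : measurable_fun setT g.
  apply/(measurable_restrictT _ _).1 => //; apply: measurable_funTS.
  by apply/measurable_EFinP; exact: measurable_pw.
have g0 x : (0 <= g x)%E.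
  by rewrite /g /patch; case: ifP => // _; rewrite lee_fin pw_ge0.
rewrite -[leRHS](ge0_integral_reflect b mg g0) le_eqVlt; apply/orP; left; apply/eqP.
apply: eq_integral => x _; rewrite /g /patch !mem_setE !in_itv/=.
by rewrite subr_gt0 ltrD2l ltrN2 andbC.
Qed.

Let K_int a b : leb.-integrable `]a, b[ (EFin \o (fun s => 1 + c * pw (b - s))).
Proof.
have [ab|ba] := ltP a b; last first.
  by rewrite set_itv_ge ?bnd_simp -?leNgt//; exact: integrable_set0.
apply/integrableP; split; first by apply/measurable_EFinP/measurable_funTS.
under eq_integral do rewrite /= ger0_norm//.
by rewrite (le_lt_trans (K_le ab))// ltry.
Qed.

Lemma weighted_integrable a b t : b <= t ->
  leb.-integrable `]a, b[ (EFin \o (fun s => (1 + c * pw (t - s)) * z s)).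
Proof.
move=> bt.
have i1 : leb.-integrable `]a, t[ (EFin \o (fun s => Z * (1 + c * pw (t - s)))).
  rewrite (_ : _ \o _ = fun x => (Z%:E * (1 + c * pw (t - x))%:E)%E); last first.
    by apply/funext => x /=; rewrite EFinM.
  by apply: integrableZl => //; exact: K_int.
have i2 : leb.-integrable `]a, b[ (EFin \o (fun s => Z * (1 + c * pw (t - s)))).
  by apply: integrableS i1 => //; apply: subset_itvl; rewrite bnd_simp.
apply: le_integrable i2 => //.
  by apply/measurable_EFinP/measurable_funTS; apply: measurable_funM.
move=> x _ /=; rewrite lee_fin !normrM mulrC ler_wpM2r//.
by rewrite (le_trans (zZ x))// ler_norm.
Qed.

Let cst_int a b (r : R) : leb.-integrable `]a, b[ (fun=> r%:E).
Proof.
apply/integrableP; split => //.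
rewrite -[X in (X < _)%E]/(\int[leb]_(x in `]a, b[) (cst `|r%:E| x))%E.
rewrite integral_cst//= lebesgue_measure_itv/=.
by case: ifP => _; rewrite ?mule0 ?ltry// -EFinB -EFinM ltry.
Qed.

Lemma bounded_integrable a b : leb.-integrable `]a, b[ (EFin \o z).
Proof.
apply: (@le_integrable _ mR R leb _ _ _ (cst Z%:E)) => //.
- by apply/measurable_EFinP/measurable_funTS.
- by move=> x _ /=; rewrite lee_fin (le_trans (zZ x))// ler_norm.
- apply/integrableP; split => //; rewrite integral_cst//= lebesgue_measure_itv/=.
  by case: ifP => _; rewrite ?mule0 ?ltry// -EFinB -EFinM ltry.
Qed.

(** Moving the pole of the decreasing kernel from [t] to a later [t'] decreases
    the integral over [(0, t)], on which [z] is nonnegative. *)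
Let rem_le t t' : 0 <= t -> t <= t' ->
  (forall s, 0 < s < t -> 0 <= z s) ->
  rem t <= rem t' + \int[leb]_(s in `]t, t'[) ((1 + c * pw (t' - s)) * z s).
Proof.
move=> t0 tt' zge; rewrite /rem (Rintegral_split t0 tt')//; last exact: weighted_integrable.
suff : \int[leb]_(s in `]0, t[) ((1 + c * pw (t' - s)) * z s) <=
       \int[leb]_(s in `]0, t[) ((1 + c * pw (t - s)) * z s).
  by rewrite opprD addrA addrNK lerD2l lerN2.
apply: le_Rintegral => //; [exact: weighted_integrable|exact: weighted_integrable|].
move=> x /=; rewrite in_itv/= => xt; apply: ler_wpM2r; first exact: zge.
rewrite lerD2l ler_wpM2l//; case/andP: xt => _ xt.
by apply: pw_nincr => //; [rewrite subr_gt0|rewrite lerD2r].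
Qed.

Let Kz_le t t' b : t < t' -> 0 <= b -> (forall s, t < s < t' -> z s <= b) ->
  \int[leb]_(s in `]t, t'[) ((1 + c * pw (t' - s)) * z s) <= b * k (t' - t).
Proof.
move=> tt' b0 zb.
apply: (@le_trans _ _ (\int[leb]_(s in `]t, t'[) (b * (1 + c * pw (t' - s))))).
  apply: le_Rintegral => //; first exact: weighted_integrable.
    rewrite (_ : _ \o _ = fun x => (b%:E * (1 + c * pw (t' - x))%:E)%E); last first.
      by apply/funext => x /=; rewrite EFinM.
    by apply: integrableZl => //; exact: K_int.
  move=> x /=; rewrite in_itv/= => xt.
  by rewrite mulrC ler_wpM2r//; exact: zb.
rewrite RintegralZl//.
rewrite ler_wpM2l// -lee_fin /Rintegral fineK; first exact: K_le.
exact: (integrable_fin_num _ (K_int _ _)).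
Qed.

Let k_small (e : R) : 0 < e -> exists d : R, 0 < d /\ forall r, 0 < r <= d -> k r <= e.
Proof.
move=> e0.
have kc : k r @[r --> 0^'+] --> (0 : R).
  rewrite /Kprim -[X in _ --> X](addr0 0) -[X in _ --> _ + X](mulr0 c).
  apply: cvgD; first exact: (cvg_at_right_filter cvg_id).
  apply: cvgMl_tmp; rewrite -[X in _ --> X](mul0r (1 - alpha)^-1).
  by apply: cvgMr_tmp; apply: powR_cvg0; rewrite subr_gt0.
have := cvgr_le _ kc e e0; move=> -[d /= d0 Hd].
exists (d / 2); split; first by rewrite divr_gt0.
move=> r /andP[r0 rd]; apply: Hd => //=.
by rewrite sub0r normrN gtr0_norm//; lra.
Qed.

(** Let [t0] be the infimum of the times where [rem <= 0]. If [rem t0 > 0], the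
    comparison [rem_le] between [t0] and such times close to [t0] contradicts
    the smallness of the kernel's integral over short intervals. If
    [rem t0 <= 0], the same comparison between [s < t0] and [t0] bounds [z] on a
    left neighbourhood of [t0] by half of any previous bound, so that [z <= 0]
    there, although [z > 0] before [t0]. *)
Lemma rem_gt0 t : 0 <= t < T -> 0 < rem t.
Proof.
move=> tT; rewrite ltNge; apply/negP => Nt.
pose S := [set s : R | 0 <= s < T /\ rem s <= 0].
have S0 : S !=set0 by exists t.
have lbS : has_lbound S by exists 0 => s [/andP[]].
have [t0 t0E] : exists x, x = inf S by exists (inf S).
have t0_ge0 : 0 <= t0 by rewrite t0E; apply: lb_le_inf => // s [/andP[]].
have t0_lt : t0 < T by rewrite t0E (le_lt_trans (@ge_inf _ S lbS t _))//; case/andP: tT.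
have pos s : 0 <= s < t0 -> 0 < rem s.
  move=> /andP[s0 st]; rewrite ltNge; apply/negP => rs.
  have : t0 <= s by rewrite t0E; apply: ge_inf => //; split => //; rewrite s0 (lt_trans st).
  by rewrite leNgt st.
have zpos s : 0 <= s < t0 -> 0 < z s.
  move=> st; have sT : 0 <= s < T by case/andP: st => -> /= /lt_trans ->.
  by rewrite zE// mulr_gt0 ?pos//; case/andP: (m_bounds sT).
have zge s : 0 < s < t0 -> 0 <= z s.
  by move=> /andP[/ltW s0 st]; rewrite ltW// zpos// s0.
have zleZ s : z s <= Z by rewrite (le_trans (ler_norm _)).
have [r0|r0] := ltP 0 (rem t0).
  have Z1 : 0 < Z + 1 by rewrite ltr_wpDl.
  have [d [d0 kd]] := k_small (divr_gt0 (divr_gt0 r0 (ltr0Sn R 1)) Z1).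
  have [] := @inf_adherent _ S d d0; first by split.
  move=> t' [/andP[t'0 t'T] rt'] t'd; rewrite -t0E in t'd.
  have tt' : t0 <= t' by rewrite t0E; apply: ge_inf => //; split => //; rewrite t'0.
  have tt'1 : t0 < t'.
    by rewrite lt_neqAle tt' andbT; apply/eqP => e; rewrite e ltNge rt' in r0.
  have rl := rem_le t0_ge0 tt' zge.
  have kz := Kz_le tt'1 Z_ge0 (fun s _ => zleZ s).
  have kb : k (t' - t0) <= rem t0 / 2 / (Z + 1) by apply: kd; rewrite subr_gt0 tt'1/= lerBlDl ltW.
  have Zk := ler_wpM2l Z_ge0 kb.
  have Zr : Z * (rem t0 / 2 / (Z + 1)) <= rem t0 / 2.
    rewrite mulrCA ler_piMr//; first by rewrite divr_ge0// ltW.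
    by rewrite ler_pdivrMr// mul1r lerDl.
  have : rem t0 <= 0 + rem t0 / 2.
    by apply: (le_trans rl); apply: lerD => //; rewrite (le_trans kz)// (le_trans Zk).
  rewrite add0r leNgt ltr_pdivrMr// ltr_pMr// ltr1n //.
(* The time 0 is excluded by rem 0 = 1. *)
have t0_gt0 : 0 < t0.
  rewrite lt_neqAle t0_ge0 andbT; apply/eqP => e.
  move: r0; rewrite -e /rem set_itv_ge ?Rintegral_set0 ?bnd_simp ?ltxx//.
  by rewrite subr0 ler10.
have [d [d0 kd]] := k_small (divr_gt0 mu0_gt0 (ltr0Sn R 1)).
pose a := Num.max 0 (t0 - d).
have a_lt : a < t0 by rewrite /a gt_max t0_gt0/= ltrBlDr ltrDl.
have a_ge0 : 0 <= a by rewrite /a le_max lexx.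
have a_d : t0 - d <= a by rewrite /a le_max lexx orbT.
(* On (a, t0) the kernel has mass at most mu0 / 2, and z <= rem / mu0. *)
have halve n : forall s, a < s < t0 -> z s <= Z * 2^-1 ^+ n.
  elim: n => [|n IH] s st; first by rewrite expr0 mulr1.
  have /andP[as_ st0] := st.
  have sT : 0 <= s < T by rewrite (le_trans a_ge0 (ltW as_)) (lt_trans st0).
  have s0 : 0 <= s by case/andP: sT.
  have b0 : 0 <= Z * 2^-1 ^+ n by rewrite mulr_ge0// exprn_ge0.
  have h1 : rem s <= Z * 2^-1 ^+ n * (mu0 / 2).
    apply: (le_trans (rem_le s0 (ltW st0) _)).
      move=> u /andP[u0 us]; apply: zge; rewrite u0 (lt_trans us)//.
    apply: (@le_trans _ _ (0 + Z * 2^-1 ^+ n * k (t0 - s))).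
      apply: lerD => //; apply: Kz_le => // u /andP[su ut].
      by apply: IH; rewrite ut (lt_trans as_).
    by rewrite add0r ler_wpM2l// kd// subr_gt0 st0/= lerBlDr -lerBlDl (le_trans a_d)// ltW.
  have /andP[m0 m1] := m_bounds sT.
  rewrite zE// exprSr mulrA.
  have r_ge0 : 0 <= rem s by rewrite ltW// pos// s0.
  have := ler_pM (ltW m0) r_ge0 m1 h1.
  move/le_trans; apply; rewrite le_eqVlt; apply/orP; left; apply/eqP.
  by field; rewrite gt_eqF.
pose u := (a + t0) / 2.
have u1 : a < u < t0 by rewrite !midf_lt.
have : z u <= 0.
  have gc : Z * 2^-1 ^+ n @[n --> \oo] --> (0 : R).
    by apply: (@cvg_geometric R Z 2^-1); rewrite ger0_norm// invf_lt1// ltr1n.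
  rewrite -(cvg_lim _ gc)//; apply: limr_ge; first by apply/cvg_ex; eexists; exact: gc.
  by apply: nearW => n; exact: halve.
by rewrite leNgt zpos//; case/andP: u1 => au ->; rewrite andbT (le_trans a_ge0 (ltW au)).
Qed.

Let Acal t := 1 - \int[leb]_(s in `]0, t[) z s.

Let z_ge0 t : 0 <= t < T -> 0 <= z t.
Proof.
move=> tT; rewrite zE// mulr_ge0//; last exact/ltW/rem_gt0.
by case/andP: (m_bounds tT) => /ltW.
Qed.

Let rem_leA t : 0 <= t < T -> rem t <= Acal t.
Proof.
move=> /andP[t0 tT]; rewrite /rem /Acal lerD2l lerN2; apply: le_Rintegral.
- exact: measurable_itv.
- exact: bounded_integrable.
- exact: weighted_integrable.
- move=> s /=; rewrite in_itv/= => /andP[s0 st].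
  rewrite ler_peMl ?lerDl ?mulr_ge0 ?pw_ge0//.
  by apply: z_ge0; rewrite (ltW s0) (lt_trans st).
Qed.

(** [z <= A / mu0], and [A] decreases: over [(t, t')] it loses at most
    [A t * (t' - t) / mu0]. *)
Let A_step t t' : 0 <= t -> t <= t' -> t' <= T ->
  Acal t * (1 - (t' - t) / mu0) <= Acal t'.
Proof.
move=> t0 tt' t'T.
have [tT|Tt] := ltP t T; last first.
  have -> : t' = t by apply/eqP; rewrite eq_le tt' (le_trans t'T).
  by rewrite subrr mul0r subr0 mulr1.
have A0 : 0 <= Acal t.
  by rewrite (le_trans _ (rem_leA _)) ?t0// ltW// rem_gt0 ?t0.
rewrite {2}/Acal (Rintegral_split t0 tt'); last exact: bounded_integrable.
rewrite opprD addrA -/(Acal t) mulrBr mulr1 lerD2l lerN2.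
have -> : Acal t * ((t' - t) / mu0) = \int[leb]_(s in `]t, t'[) (Acal t / mu0).
  rewrite Rintegral_cst//= lebesgue_measure_itv/= lte_fin.
  have [tt|tt] := ltP t t'; first by rewrite -EFinB/= mulrAC mulrA.
  have -> : t' = t by apply/eqP; rewrite eq_le tt' tt.
  by rewrite subrr mul0r !mulr0.
apply: le_Rintegral => //; [exact: bounded_integrable|exact: cst_int|].
move=> s /=; rewrite in_itv/= => /andP[ts st'].
have s0 : 0 <= s by rewrite (le_trans t0)// ltW.
have sT : 0 <= s < T by rewrite s0/= (lt_le_trans st').
have /andP[m0 m1] := m_bounds sT.
rewrite zE// mulrC; apply: ler_pM => //; [exact/ltW/rem_gt0|exact: ltW|].
apply: (le_trans (rem_leA sT)).
rewrite /Acal lerD2l lerN2 (Rintegral_split t0 (ltW ts)); last exact: bounded_integrable.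
rewrite lerDl; apply: Rintegral_ge0 => x /=; rewrite in_itv/= => /andP[tx xs].
by apply: z_ge0; rewrite (le_trans t0 (ltW tx)) (lt_trans xs) //; case/andP: sT.
Qed.

(** In [n] steps of length [T / n <= mu0 / 2], each of which keeps at least one
    half. *)
Lemma decay_lower_bound (n : nat) : 2 * T / mu0 <= n%:R ->
  2^-1 ^+ n <= 1 - \int[leb]_(s in `]0, T[) z s.
Proof.
move=> nT; have n0 : 0 < n%:R :> R by rewrite (lt_le_trans _ nT)// !mulr_gt0// invr_gt0.
pose p (j : nat) := T * (j%:R / n%:R).
suff H j : (j <= n)%N -> 2^-1 ^+ j <= Acal (p j).
  by have := H n (leqnn n); rewrite /p divff ?mulr1// gt_eqF.
elim: j => [_|j IH jn].
  rewrite /p mul0r mulr0 /Acal set_itv_ge ?Rintegral_set0 ?bnd_simp ?ltxx//.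
  by rewrite subr0 expr0.
have pj0 : 0 <= p j by rewrite mulr_ge0 ?divr_ge0// ltW.
have pp : p j.+1 = p j + T / n%:R.
  by rewrite /p -natr1; field; rewrite gt_eqF.
have Tn0 : 0 <= T / n%:R by rewrite divr_ge0 ?ltW.
have ppT : p j.+1 <= T.
  by rewrite /p ler_piMr ?(ltW T_gt0)// ler_pdivrMr// mul1r ler_nat.
apply: (le_trans _ (A_step pj0 _ ppT)); last by rewrite pp lerDl.
rewrite exprSr; apply: ler_pM; rewrite ?exprn_ge0 ?invr_ge0//.
  by apply: IH; exact: ltnW.
rewrite pp addrAC subrr add0r.
have : T / n%:R / mu0 <= 2^-1.
  rewrite ler_pdivrMr// ler_pdivrMr// mulrC.
  by move: nT; rewrite ler_pdivrMr// -ler_pdivlMl// mulrCA.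
move=> Tn; rewrite lerBrDr -lerBrDl (le_trans Tn)// le_eqVlt; apply/orP; left.
by apply/eqP; field.
Qed.

End decay.

(** * Uniform bounds on A_k(T) and B_k(T) *)

Section modes.
Context {R : realType}.
Local Notation leb := (@lebesgue_measure R).
Local Notation mR := (measurableTypeR R).
Variables (alpha l T mu0 M : R).
Hypotheses (alpha_gt0 : 0 < alpha) (alpha_lt1 : alpha < 1)
  (l_gt0 : 0 < l) (T_gt0 : 0 < T) (mu0_gt0 : 0 < mu0).
Implicit Types (s t r x tau : R) (k n : nat).
Local Notation pw := (pw alpha).

Lemma Gamma_ge0 (a : R) : 0 <= Gamma a.
Proof.
by apply: Rintegral_ge0 => x _; rewrite mulr_ge0 ?powR_ge0 ?expR_ge0.
Qed.

Lemma lambda_gt0 k : (0 < k)%N -> 0 < lambda l k.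
Proof.
by move=> k0; rewrite /lambda exprn_gt0// divr_gt0// mulr_gt0 ?pi_gt0// ltr0n.
Qed.

Lemma lambda1_le k : (0 < k)%N -> lambda l 1 <= lambda l k.
Proof.
move=> k0; rewrite /lambda lerXn2r ?nnegrE ?divr_ge0 ?mulr_ge0 ?pi_ge0 ?(ltW l_gt0)//.
by rewrite ler_pM2r ?invr_gt0// ler_pM2r ?pi_gt0// ler_nat.
Qed.

Definition mode_weight k : R := (lambda l k * Gamma (1 - alpha))^-1.

Lemma mode_weight_ge0 k : (0 < k)%N -> 0 <= mode_weight k.
Proof.
by move=> k0; rewrite invr_ge0 mulr_ge0 ?Gamma_ge0// ltW// lambda_gt0.
Qed.

Lemma mode_weight_le k : (0 < k)%N -> mode_weight k <= mode_weight 1.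
Proof.
move=> k0; rewrite /mode_weight (invfM (lambda l k)) (invfM (lambda l 1)).
rewrite ler_wpM2r ?invr_ge0 ?Gamma_ge0//.
by rewrite lef_pV2 ?posrE ?lambda_gt0// lambda1_le.
Qed.

(** A bound for the kernels [H_k] relative to the profile: the regular part is
    absorbed by [T^alpha (t - s)^(-alpha) >= 1], and [mode_weight] is largest
    for the first mode. *)
Definition kernel_cst : R := mu0^-1 * (T `^ alpha + mode_weight 1).

Lemma kernel_cst_ge0 : 0 <= kernel_cst.
Proof.
by rewrite mulr_ge0 ?invr_ge0 ?(ltW mu0_gt0)// addr_ge0 ?powR_ge0// mode_weight_ge0.
Qed.

Lemma exists_damping : exists kappa : R, 0 <= kappa /\
  ((kernel_cst * (2 `^ alpha * 2))%:E * dmass alpha (T + 1) kappa <= (2^-1)%:E)%E.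
Proof.
have c0 : 0 <= kernel_cst * (2 `^ alpha * 2).
  by rewrite mulr_ge0 ?kernel_cst_ge0// mulr_ge0 ?powR_ge0.
set b := kernel_cst * _ in c0 *.
have b1 : 0 < b + 1 by rewrite ltr_wpDl.
have /fine_cvgP[[n2 _ h2] cv] := @dmass_cvg0 R alpha alpha_lt1 (T + 1).
have e0 : 0 < (2 * (b + 1))^-1 by rewrite invr_gt0 mulr_gt0.
have [n1 _ h1] := cvgr_le _ cv _ e0.
pose n := maxn n1 n2; exists n%:R; split => //.
have {}h1 := h1 n (leq_maxl _ _); have {}h2 := h2 n (leq_maxr _ _).
rewrite /= in h1 h2.
rewrite -(fineK h2) -EFinM lee_fin.
have := ler_wpM2l c0 h1 => /le_trans; apply.
rewrite invfM mulrCA ler_piMr ?invr_ge0// ler_pdivrMr// mul1r lerDl //.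
Qed.

Section one_mode.
Variables (kappa : R) (mu : R -> R) (k : nat).
Hypothesis kappa_ge0 : 0 <= kappa.
Hypothesis kappaP :
  ((kernel_cst * (2 `^ alpha * 2))%:E * dmass alpha (T + 1) kappa <= (2^-1)%:E)%E.
Hypothesis mu_adm : admissible_mu T mu0 M mu.
Hypothesis k_gt0 : (0 < k)%N.

Local Notation c := (mode_weight k).

Let inv_mu t : R := if (0 <= t) && (t <= T) then (mu t)^-1 else 0.

Let mu_ge t : 0 <= t -> t <= T -> mu0 <= mu t.
Proof.
by move=> t0 tT; case: mu_adm => _ /(_ t); rewrite in_itv/= t0 tT => /(_ isT)/andP[].
Qed.

Let inv_mu_ge0 t : 0 <= inv_mu t.
Proof.
rewrite /inv_mu; case: ifP => // /andP[t0 tT].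
by rewrite invr_ge0 (le_trans (ltW mu0_gt0))// mu_ge.
Qed.

Let inv_mu_le t : inv_mu t <= mu0^-1.
Proof.
rewrite /inv_mu; case: ifP => [/andP[t0 tT]|_]; last by rewrite invr_ge0 ltW.
by rewrite lef_pV2 ?posrE ?mu_ge// (lt_le_trans mu0_gt0)// mu_ge.
Qed.

Let inv_mu_norm t : `|inv_mu t| <= mu0^-1.
Proof. by rewrite ger0_norm. Qed.

Let measurable_inv_mu : measurable_fun setT (inv_mu : mR -> R).
Proof.
have m1 : measurable_fun setT (mu \_ `[0, T] : mR -> R).
  apply/(measurable_restrictT _ _).1 => //.
  apply: subspace_continuous_measurable_fun => //.
  by case: mu_adm.
have -> : inv_mu = fun t => if (0 <= t) && (t <= T) then (mu \_ `[0, T]) t `^ (-1) else 0.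
  apply/funext => t; rewrite /inv_mu; case: ifPn => // /andP[t0 tT].
  rewrite /patch mem_setE in_itv/= t0 tT powR_inv1//.
  by rewrite (le_trans (ltW mu0_gt0))// mu_ge.
apply: measurable_fun_ifT => //.
  by apply: measurable_and; exact: measurable_fun_ler.
exact: (measurableT_comp (measurable_powR _)).
Qed.

(** [H_k], extended by zero outside the triangle [0 < s < t < T] so that the
    theory of kernels on the line applies. *)
Let h t s : R :=
  if (0 < s) && (s < t) && (t < T) then inv_mu t * (1 + c * pw (t - s)) else 0.

Let c_ge0 : 0 <= c. Proof. exact: mode_weight_ge0. Qed.

Let measurable_h : measurable_fun setT (fun p : mR * mR => h p.1 p.2).
Proof.
apply: measurable_fun_ifT => //.
  apply: measurable_and.
    by apply: measurable_and; exact: measurable_fun_ltr.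
  exact: measurable_fun_ltr.
apply: measurable_funM; first exact: (measurableT_comp measurable_inv_mu).
apply: measurable_funD => //; apply: measurable_funM => //.
apply: (measurableT_comp (measurable_pw _)); exact: measurable_funB.
Qed.

Let h_ge0 t s : 0 <= h t s.
Proof.
rewrite /h; case: ifP => // _; rewrite mulr_ge0// addr_ge0// mulr_ge0//.
exact: pw_ge0.
Qed.

Let h_le t s : h t s <= kernel_cst * pw (t - s).
Proof.
rewrite /h; case: ifP => [/andP[/andP[s0 st] tT]|_]; last first.
  by rewrite mulr_ge0 ?pw_ge0 ?kernel_cst_ge0.
have r0 : 0 < t - s by rewrite subr_gt0.
rewrite /kernel_cst -mulrA; apply: ler_pM => //.
  by rewrite addr_ge0// mulr_ge0 ?pw_ge0.
rewrite mulrDl; apply: lerD; last by rewrite ler_wpM2r ?pw_ge0// mode_weight_le.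
rewrite pwE// powRN ler_pdivlMr ?powR_gt0// mul1r.
apply: ge0_ler_powR; rewrite ?nnegrE; [exact: ltW|exact: ltW|exact: ltW|].
by rewrite lerBlDr (le_trans (ltW tT))// lerDl ltW.
Qed.

Let h_supp t s : ~~ ((0 < s) && (t < T)) -> h t s = 0.
Proof. by rewrite /h -andbA (andbC (s < t)) andbA => /negbTE ->. Qed.

Let H_h t s : 0 < s -> s < t -> t < T -> H alpha mu l k t s = h t s.
Proof.
move=> s0 st tT; have t0 := lt_trans s0 st.
rewrite /h s0 st tT/= /inv_mu (ltW t0) (ltW tT)/= /H pwE ?subr_gt0//.
rewrite /mode_weight !div1r mulrDr mulr1; congr (_ + _).
by rewrite -(mulrA (mu t)) (invfM (mu t)) mulrA.
Qed.

Let kiter_h0 n t s : t <= s -> kiter h n t s = 0.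
Proof.
move=> ts; have [_ /(_ t s) + _] := kiter_spec alpha_gt0
  kernel_cst_ge0 kappa_ge0 kappaP measurable_h h_ge0 h_le h_supp n.
rewrite pw0 ?subr_le0// !mulr0 => /andP[? ?].
by apply/eqP; rewrite eq_le; apply/andP.
Qed.

Let Hiter_kiter n : forall t s, 0 < s -> s < t -> t < T ->
  Hiter alpha mu l k n t s = kiter h n t s.
Proof.
elim: n => [|n IH] t s s0 st tT /=; first exact: H_h.
rewrite Rintegral_mkcond; apply: eq_Rintegral => x _.
rewrite /patch mem_setE in_itv/=; case: ifPn => [/andP[sx xt]|].
  by rewrite H_h ?(lt_trans s0)// IH// (lt_trans xt).
rewrite negb_and -!leNgt => /orP[xs|tx]; first by rewrite kiter_h0 ?mulr0.
by rewrite /h (ltNge x t) tx andbF mul0r.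
Qed.

Let resolvent_kres t s : 0 < s -> s < t -> t < T ->
  resolvent alpha mu l k t s = kres h t s.
Proof.
move=> s0 st tT; rewrite /resolvent /kres; congr (limn _).
by apply/funext => N; apply: eq_bigr => n _; rewrite Hiter_kiter.
Qed.

Let kres_h0 t s : ~~ ((0 < s) && (s < t) && (t < T)) -> kres h t s = 0.
Proof.
move=> nst; have [ts|ts] := ltP s t; last first.
  have := kres_le alpha_gt0 kernel_cst_ge0 kappa_ge0 kappaP
    measurable_h h_ge0 h_le h_supp t s.
  by rewrite /dpw pw0 ?subr_le0// mulr0 if_same mulr0 normr_le0 => /eqP.
apply: (kres_supp alpha_gt0 kernel_cst_ge0 kappa_ge0 kappaP
    measurable_h h_ge0 h_le h_supp).
by move: nst; rewrite ts andbT.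
Qed.

(** On the triangle the resolvent is the one of [h]; the other factor may be
    changed on a null set. *)
Let resolvent_int tau (g g' : R -> R) (N : set mR) :
  measurable N -> leb N = 0%E -> 0 < tau < T ->
  (forall s, 0 < s < tau -> ~ N s -> g s = g' s) ->
  \int[leb]_(s in `]0, tau[) (resolvent alpha mu l k tau s * g s) =
  \int[leb]_s (kres h tau s * g' s).
Proof.
move=> mN N0 /andP[t0 tT] gg; rewrite [RHS](_ : _ =
    \int[leb]_(s in `]0, tau[) (kres h tau s * g' s)).
  congr fine; apply: (@integral_eq_negligible _ mR R leb _ N) => // s /=.
  rewrite in_itv/= => /andP[s0 st] Ns.
  by rewrite resolvent_kres// gg// s0.
rewrite [RHS]Rintegral_mkcond; apply: eq_Rintegral => s _.
rewrite /patch mem_setE in_itv/=; case: ifPn => // nst.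
by rewrite kres_h0 ?mul0r// tT andbT.
Qed.

Let z := vsol h inv_mu.

Let vsol_z t : z t + \int[leb]_x (h t x * z x) = inv_mu t.
Proof.
exact: (vsolE alpha_gt0 alpha_lt1 T_gt0 kernel_cst_ge0 kappa_ge0 kappaP
  measurable_h h_ge0 h_le h_supp measurable_inv_mu inv_mu_norm).
Qed.

Let Zcst := mu0^-1 + 2 * (kernel_cst * expR (kappa * (T + 1))) * mu0^-1 *
  fine (dmass alpha (T + 1) 0).

Let z_le t : `|z t| <= Zcst.
Proof.
exact: (vsol_le alpha_gt0 alpha_lt1 T_gt0 kernel_cst_ge0 kappa_ge0 kappaP
  measurable_h h_ge0 h_le h_supp measurable_inv_mu inv_mu_norm).
Qed.

Let measurable_z : measurable_fun setT (z : mR -> R).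
Proof.
exact: (measurable_vsol alpha_gt0 kernel_cst_ge0 kappa_ge0 kappaP
  measurable_h h_ge0 h_le h_supp measurable_inv_mu).
Qed.

Let z_eq t : 0 <= t < T -> z t = inv_mu t * rem alpha c z t.
Proof.
move=> /andP[t0 tT]; have /eqP := vsol_z t; rewrite eq_sym -subr_eq => /eqP <-.
rewrite /rem mulrBr mulr1; congr (_ - _).
rewrite -RintegralZl//; last first.
  exact: (weighted_integrable alpha_lt1 c_ge0 measurable_z z_le _ (lexx t)).
rewrite [RHS]Rintegral_mkcond; apply: eq_Rintegral => x _.
rewrite /patch mem_setE in_itv/= /h tT andbT; case: ifP => _; last by rewrite mul0r.
by rewrite mulrA.
Qed.

Let inv_mu_bounds t : 0 <= t < T -> 0 < inv_mu t <= mu0^-1.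
Proof.
move=> /andP[t0 tT]; rewrite inv_mu_le andbT /inv_mu t0 (ltW tT)/= invr_gt0.
by rewrite (lt_le_trans mu0_gt0)// mu_ge// ltW.
Qed.

Lemma A_lower_bound n : 2 * T / mu0 <= n%:R -> 2^-1 ^+ n <= A alpha mu l k T.
Proof.
move=> nT.
have := decay_lower_bound alpha_gt0 alpha_lt1 T_gt0 mu0_gt0 c_ge0 measurable_z z_le
  inv_mu_bounds z_eq nT.
move/le_trans; apply; rewrite le_eqVlt; apply/orP; left; apply/eqP; rewrite /A.
have -> : \int[leb]_(tau in `]0, T[) (1 / mu tau) = \int[leb]_(tau in `]0, T[) inv_mu tau.
  apply: eq_Rintegral => t; rewrite inE/= in_itv/= => /andP[t0 tT].
  by rewrite div1r /inv_mu (ltW t0) (ltW tT).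
rewrite -addrA -opprD; congr (_ - _).
have -> : \int[leb]_(tau in `]0, T[) \int[leb]_(s in `]0, tau[)
    (resolvent alpha mu l k tau s * (1 / mu s)) =
    \int[leb]_(tau in `]0, T[) (z tau - inv_mu tau).
  apply: eq_Rintegral => tau; rewrite inE/= in_itv/= => tauT.
  rewrite (@resolvent_int tau _ inv_mu set0)//.
    by rewrite /z /vsol addrAC subrr add0r.
  move=> s /andP[s0 st] _; case/andP: tauT => _ tT.
  by rewrite div1r /inv_mu (ltW s0) (ltW (lt_trans st tT)).
rewrite RintegralB//; first by rewrite addrCA subrr addr0.
  exact: (bounded_integrable measurable_z z_le).
exact: (bounded_integrable measurable_inv_mu inv_mu_norm).
Qed.

Let Kcst := 2 * (kernel_cst * expR (kappa * (T + 1))) * fine (dmass alpha (T + 1) 0).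

Let kmass_bound s : `|kmass h s| <= Kcst.
Proof.
exact: (kmass_le alpha_gt0 alpha_lt1 T_gt0 kernel_cst_ge0 kappa_ge0 kappaP
  measurable_h h_ge0 h_le h_supp).
Qed.

Let m_kmass : measurable_fun setT (kmass h : mR -> R).
Proof.
exact: (measurable_kmass alpha_gt0 kernel_cst_ge0 kappa_ge0 kappaP
  measurable_h h_ge0 h_le h_supp).
Qed.

(** Obtained from [B_k(T)] by collecting everything that multiplies
    [f_k(s)]. *)
Let W s := inv_mu s * (lambda l k)^-1 * (1 + kmass h s).

Let W_le s : `|W s| <= mu0^-1 * (1 + Kcst) / lambda l k.
Proof.
have lk := lambda_gt0 k_gt0.
rewrite /W mulrAC !normrM [`|_^-1|]ger0_norm ?invr_ge0 ?(ltW lk)//.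
rewrite ler_wpM2r ?invr_ge0 ?(ltW lk)//; apply: ler_pM => //.
by rewrite (le_trans (ler_normD _ _))// normr1 lerD2l.
Qed.

Let measurable_W : measurable_fun setT (W : mR -> R).
Proof.
apply: measurable_funM; first exact: measurable_funM.
exact: measurable_funD.
Qed.

Lemma B_weighted (f : R -> R -> R) (F : R -> R) (N : set mR) :
  measurable N -> leb N = 0%E ->
  (forall t, 0 < t < T -> ~ N t -> f_coef l f k t = F t) ->
  leb.-integrable `]0, T[ (EFin \o F) ->
  B alpha mu l f k T = \int[leb]_(s in `]0, T[) (F s * W s).
Proof.
move=> mN N0 fF iF.
have lk := lambda_gt0 k_gt0.
pose g s := F s * (inv_mu s / lambda l k).
have ig : leb.-integrable `]0, T[ (EFin \o g).
  apply: (@le_integrable _ mR R leb _ _ _ (fun s => (mu0^-1 / lambda l k)%:E * (F s)%:E)%E) => //.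
  - apply/measurable_EFinP; apply: measurable_funM.
      by apply/measurable_EFinP; case/integrableP: iF.
    by apply: measurable_funTS; apply: measurable_funM.
  - move=> s _ /=; rewrite lee_fin !normrM mulrC ler_wpM2r//.
    rewrite [`|_^-1|]ger0_norm ?invr_ge0 ?(ltW lk)//.
    rewrite ler_wpM2r ?invr_ge0 ?(ltW lk)// (le_trans (inv_mu_norm s))//.
    exact: ler_norm.
  - exact: integrableZl.
pose phi := g \_ `]0, T[.
have iphi : leb.-integrable setT (EFin \o phi).
  rewrite /phi -restrict_EFin.
  by apply/(@integrable_mkcond _ mR R leb `]0, T[%classic (EFin \o g) (measurable_itv _)).
have e1 : \int[leb]_(tau in `]0, T[) (f_coef l f k tau / (mu tau * lambda l k)) =
    \int[leb]_s phi s.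
  rewrite /phi -Rintegral_mkcond; congr fine.
  apply: (@integral_eq_negligible _ mR R leb _ N) => // s /=.
  rewrite in_itv/= => /andP[s0 st] Ns.
  by rewrite fF ?s0// /g /inv_mu (ltW s0) (ltW st)/= (invfM (mu s)).
have e2 : \int[leb]_(tau in `]0, T[) (\int[leb]_(s in `]0, tau[)
    (resolvent alpha mu l k tau s * (f_coef l f k s / (mu s * lambda l k)))) =
    \int[leb]_s (phi s * kmass h s).
  rewrite -(kres_swap alpha_gt0 alpha_lt1 T_gt0 kernel_cst_ge0 kappa_ge0 kappaP
    measurable_h h_ge0 h_le h_supp iphi) Rintegral_mkcond.
  apply: eq_Rintegral => tau _; rewrite /patch mem_setE in_itv/=; case: ifPn => [tT|nT].
    apply: (resolvent_int mN N0 tT) => s /andP[s0 st] Ns.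
    have sT : s < T by case/andP: tT => _; exact: lt_trans.
    rewrite fF ?s0// /phi /patch mem_setE in_itv/= s0 sT/=.
    by rewrite /g /inv_mu (ltW s0) (ltW sT)/= (invfM (mu s)).
  rewrite /Rintegral integral0_eq// => s _.
  rewrite kres_h0 ?mul0r//; apply: contra nT => /andP[/andP[s0 st] ->].
  by rewrite andbT (lt_trans s0).
rewrite /B e1 e2 -RintegralD//; last first.
  apply: (@le_integrable _ mR R leb _ _ _ (fun s => Kcst%:E * (phi s)%:E)%E) => //.
  - apply/measurable_EFinP; apply: measurable_funM => //.
    by apply/measurable_EFinP; case/integrableP: iphi.
  - move=> s _ /=; rewrite lee_fin (normrM (phi s)) (normrM Kcst) mulrC ler_wpM2r//.
    by rewrite (le_trans (kmass_bound s))// ler_norm.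
  - exact: integrableZl.
rewrite [RHS]Rintegral_mkcond; apply: eq_Rintegral => s _.
rewrite /phi /patch; case: ifP => _; last by rewrite mul0r addr0.
by rewrite /g /W; ring.
Qed.

Lemma B_weight_exists : exists w : R -> R,
  [/\ measurable_fun setT (w : mR -> R),
      forall s, `|w s| <= mu0^-1 * (1 + Kcst) / lambda l k &
      forall (f : R -> R -> R) (F : R -> R) (N : set mR),
        measurable N -> leb N = 0%E ->
        (forall t, 0 < t < T -> ~ N t -> f_coef l f k t = F t) ->
        leb.-integrable `]0, T[ (EFin \o F) ->
        B alpha mu l f k T = \int[leb]_(s in `]0, T[) (F s * w s)].
Proof. by exists W; split => //; exact: B_weighted. Qed.

End one_mode.

End modes.

(** The constants are chosen before [mu] and [k], which is what makes the final
    constant independent of them. The function [F] is a measurable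
    representative of [f_k]. *)
Lemma modes_uniform {R : realType} (alpha l T mu0 : R) :
  0 < alpha -> alpha < 1 -> 0 < l -> 0 < T -> 0 < mu0 ->
  exists c0 Cw : R, [/\ 0 < c0, 0 < Cw & forall (M : R) (mu : R -> R),
  admissible_mu T mu0 M mu -> forall k, (0 < k)%N ->
  c0 <= A alpha mu l k T /\
  exists w : R -> R,
  [/\ measurable_fun setT (w : measurableTypeR R -> R),
      forall s, `|w s| <= Cw / lambda l k &
      forall (f : R -> R -> R) (F : R -> R) (N : set (measurableTypeR R)),
        measurable N -> lebesgue_measure N = 0%E ->
        (forall t, 0 < t < T -> ~ N t -> f_coef l f k t = F t) ->
        lebesgue_measure.-integrable `]0, T[ (EFin \o F) ->
        B alpha mu l f k T = \int[lebesgue_measure]_(s in `]0, T[) (F s * w s)]].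
Proof.
move=> a0 a1 l0 T0 mu00.
have [kappa [kappa0 kappaP]] := @exists_damping R alpha l T mu0 a1 l0 mu00.
pose n := (Num.truncn (2 * T / mu0)).+1.
have nT : 2 * T / mu0 <= n%:R by rewrite ltW// truncnS_gt.
set K := 2 * (kernel_cst alpha l T mu0 * expR (kappa * (T + 1))) * fine (dmass alpha (T + 1) 0).
have K0 : 0 <= K.
  rewrite mulr_ge0//; last by apply: fine_ge0; apply: integral_ge0 => x _; rewrite lee_fin dpw_ge0.
  by rewrite mulr_ge0// mulr_ge0 ?expR_ge0// kernel_cst_ge0.
(* K bounds the mass of the resolvents, so that |w| <= (1 + K) / (mu0 lambda_k). *)
exists (2^-1 ^+ n), (mu0^-1 * (1 + K)); split.
- by rewrite exprn_gt0// invr_gt0.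
- by rewrite mulr_gt0 ?invr_gt0// ltr_wpDr.
- move=> M mu muA k k0; split.
    exact: (A_lower_bound a0 a1 l0 T0 mu00 kappa0 kappaP muA k0 nT).
  exact: (B_weight_exists a0 a1 l0 T0 mu00 kappa0 kappaP muA k0).
Qed.

(** * Sine series in L^2 *)

Section sine_basis.
Context {R : realType}.
Local Notation leb := (@lebesgue_measure R).
Local Notation mR := (measurableTypeR R).
Variable l : R.
Hypothesis l_gt0 : 0 < l.
Implicit Types (u v w : R -> R) (k j n N : nat) (c x : R).

Lemma L2norm_sqr (a : R) u :
  ((L2norm a (EFin \o u)) `^ 2 = \int[leb]_(x in `]0%R, a[) (u x ^+ 2)%:E)%E.
Proof.
rewrite /L2norm poweR_Lnorm// [RHS]integral_mkcond; apply: eq_integral => x _.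
rewrite /patch; case: ifP => _; last by rewrite abse0 poweR0r.
by rewrite /= -[2]/(2%:R) powR_mulrn// real_normK// num_real.
Qed.

Lemma L2normE (a : R) u :
  (L2norm a (EFin \o u) = (\int[leb]_(x in `]0%R, a[) (u x ^+ 2)%:E) `^ 2^-1)%E.
Proof.
rewrite -L2norm_sqr -poweRrM mulfV// poweRe1//; exact: Lnorm_ge0.
Qed.

Lemma L2P u : L2 l u <-> measurable_fun (`]0, l[ : set R) u /\
  leb.-integrable `]0, l[ (EFin \o (fun x => u x ^+ 2)).
Proof.
split=> [[mu un]|[mu iu]]; split => //.
- apply/integrableP; split.
    by apply/measurable_EFinP; exact: measurable_funX.
  under eq_integral do rewrite /= ger0_norm ?sqr_ge0//.
  by rewrite -L2norm_sqr poweR_lty.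
- rewrite L2normE poweR_lty//; case/integrableP: iu => _.
  by under eq_integral do rewrite /= ger0_norm ?sqr_ge0//.
Qed.

Definition ip u v : R := \int[leb]_(x in `]0, l[) (u x * v x).

Lemma L2_prod u v : L2 l u -> L2 l v ->
  leb.-integrable `]0, l[ (EFin \o (fun x => u x * v x)).
Proof.
move=> /L2P[mu iu] /L2P[mv iv].
apply: (@le_integrable _ mR R leb _ _ _ (fun x => (u x ^+ 2)%:E + (v x ^+ 2)%:E)%E) => //.
- by apply/measurable_EFinP; exact: measurable_funM.
- move=> x _ /=; rewrite lee_fin (le_trans _ (ler_norm _))// normrM.
  rewrite -(real_normK (num_real (u x))) -(real_normK (num_real (v x))).
  by move: `|u x| `|v x| => a b; nra.
- exact: integrableD.
Qed.

Lemma L2_comb u v c : L2 l u -> L2 l v -> L2 l (fun x => u x + c * v x).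
Proof.
move=> Lu Lv; have iuv := L2_prod Lu Lv.
move: Lu Lv => /L2P[mu iu] /L2P[mv iv]; apply/L2P; split.
  by apply: measurable_funD => //; exact: measurable_funM.
rewrite (_ : _ \o _ = fun x => ((u x ^+ 2)%:E + ((2 * c)%:E * (u x * v x)%:E) +
  ((c ^+ 2)%:E * (v x ^+ 2)%:E))%E); last first.
  by apply/funext => x /=; rewrite -!EFinM -!EFinD; congr EFin; ring.
apply: integrableD => //; last exact: integrableZl.
by apply: integrableD => //; exact: integrableZl.
Qed.

Lemma L2_bounded (b : R) u : measurable_fun setT (u : mR -> R) ->
  (forall x, `|u x| <= b) -> L2 l u.
Proof.
move=> mu ub; apply/L2P; split; first exact: measurable_funTS.
apply: (@bounded_integrable _ (b ^+ 2)); first exact: measurable_funX.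
by move=> x; rewrite normrX lerXn2r// nnegrE (le_trans _ (ub x)).
Qed.

Lemma ipC u v : ip u v = ip v u.
Proof. by apply: eq_Rintegral => x _; rewrite mulrC. Qed.

Lemma ip_ge0 u : 0 <= ip u u.
Proof. by apply: Rintegral_ge0 => x _; rewrite -expr2 sqr_ge0. Qed.

Lemma ip_comb u v w c : L2 l u -> L2 l v -> L2 l w ->
  ip (fun x => u x + c * v x) w = ip u w + c * ip v w.
Proof.
move=> Lu Lv Lw; rewrite /ip -RintegralZl//; last exact: L2_prod.
rewrite -RintegralD//; last 2 first.
- exact: L2_prod.
- rewrite (_ : _ \o _ = fun x => (c%:E * (v x * w x)%:E)%E).
    by apply: integrableZl => //; exact: L2_prod.
  by apply/funext => x /=; rewrite EFinM.
by apply: eq_Rintegral => x _; ring.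
Qed.

Lemma measurable_e k : measurable_fun setT (e l k : mR -> R).
Proof.
apply: measurableT_comp; first exact: (continuous_measurable_fun (@continuous_sin R)).
by apply: measurable_funM => //; apply: measurable_funM.
Qed.

Lemma e_le1 k x : `|e l k x| <= 1. Proof. exact: sin_max. Qed.

Lemma L2_e k : L2 l (e l k).
Proof. exact: (L2_bounded (measurable_e k) (e_le1 k)). Qed.

Lemma sin_natpi n : sin (n%:R * pi : R) = 0.
Proof.
elim: n => [|n IH]; first by rewrite mul0r sin0.
by rewrite -natr1 mulrDl mul1r sinD sinpi mulr0 IH mul0r addr0.
Qed.

Lemma int_cos n : \int[leb]_(x in `]0, l[) cos (n%:R * pi / l * x) =
  if n == 0%N then l else 0.
Proof.
case: n => [|n] /=.
  under eq_Rintegral do rewrite !mul0r cos0.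
  by rewrite Rintegral_cst//= lebesgue_measure_itv/= lte_fin l_gt0 -EFinB/= subr0 mul1r.
pose a : R := n.+1%:R * pi / l.
have a0 : a != 0 by rewrite gt_eqF// divr_gt0// mulr_gt0// pi_gt0.
pose F x := a^-1 * sin (a * x).
have dF x : is_derive x 1 F (cos (a * x)).
  rewrite /F; apply: is_derive_eq.
  by rewrite /GRing.scale/=; field.
rewrite /Rintegral -(@integral_itv_bndoo _ 0 l _ true false); last first.
  apply/measurable_EFinP; apply: measurable_funTS.
  apply: measurableT_comp; first exact: (continuous_measurable_fun (@continuous_cos R)).
  exact: measurable_funM.
rewrite (@continuous_FTC2 R (fun x => cos (a * x)) F)//.
- by rewrite /F mulr0 sin0 mulr0 -EFinB/= subr0 /a divfK ?gt_eqF// sin_natpi mulr0.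
- apply: continuous_subspaceT => x; apply: continuous_comp.
    exact: mulrl_continuous.
  exact: continuous_cos.
- have cF x : {for x, continuous F}.
    apply: differentiable_continuous; apply/derivable1_diffP.
    by case: (dF x).
  split.
  + by move=> x _; case: (dF x).
  + by apply: cvg_at_right_filter; exact: cF.
  + by apply: cvg_at_left_filter; exact: cF.
- by move=> x _; rewrite derive1E; case: (dF x).
Qed.

Lemma ip_e j k : (0 < j)%N -> (0 < k)%N ->
  ip (e l j) (e l k) = if j == k then l / 2 else 0.
Proof.
wlog jk : j k / (j <= k)%N.
  move=> H j0 k0; have [jk|/ltnW jk] := leqP j k; first exact: H.
  by rewrite ipC H// eq_sym.
move=> j0 k0.
have i n : leb.-integrable `]0, l[ (EFin \o (fun x => cos (n%:R * pi / l * x))).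
  apply: (@bounded_integrable _ 1); last by move=> x; exact: cos_max.
  apply: measurableT_comp; first exact: (continuous_measurable_fun (@continuous_cos R)).
  exact: measurable_funM.
have -> : ip (e l j) (e l k) = \int[leb]_(x in `]0, l[)
   (2^-1 * (cos ((k - j)%:R * pi / l * x) - cos ((k + j)%:R * pi / l * x))).
  apply: eq_Rintegral => x _; rewrite /e natrB// natrD.
  have -> : (k%:R - j%:R) * pi / l * x = k%:R * pi * x / l - j%:R * pi * x / l by ring.
  have -> : (k%:R + j%:R) * pi / l * x = k%:R * pi * x / l + j%:R * pi * x / l by ring.
  by rewrite cosB cosD; field.
rewrite RintegralZl//; last first.
  have := @integrableB _ mR R leb `]0, l[%classic (measurable_itv _) _ _ (i (k - j)%N) (i (k + j)%N).
  by apply: eq_integrable => // x _ /=; rewrite EFinB.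
rewrite RintegralB// !int_cos addn_eq0 subn_eq0.
rewrite (gtn_eqF j0) andbF subr0.
have -> : (k <= j)%N = (j == k) by rewrite eqn_leq jk.
by case: ifP => _; rewrite ?mulr0// mulrC.
Qed.

Section partial_sums.
Variable c : nat -> R.

Definition sine_sum N x : R := \sum_(1 <= k < N.+1) c k * e l k x.

Lemma sine_sumS N :
  sine_sum N.+1 = fun x => sine_sum N x + c N.+1 * e l N.+1 x.
Proof. by apply/funext => x; rewrite /sine_sum big_nat_recr. Qed.

Lemma L2_sine_sum N : L2 l (sine_sum N).
Proof.
elim: N => [|N IH].
  rewrite (_ : sine_sum 0 = cst 0); last first.
    by apply/funext => x; rewrite /sine_sum big_nil.
  by apply: (@L2_bounded 0) => // x; rewrite normr0.
by rewrite sine_sumS; apply: L2_comb => //; exact: L2_e.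
Qed.

Lemma ip_sine_sum N u : L2 l u ->
  ip (sine_sum N) u = \sum_(1 <= k < N.+1) c k * ip (e l k) u.
Proof.
move=> Lu; elim: N => [|N IH].
  rewrite big_nil /ip; under eq_Rintegral do rewrite /sine_sum big_nil mul0r.
  by rewrite Rintegral_cst// mul0r.
have LS := L2_sine_sum N; have Le := L2_e N.+1.
by rewrite sine_sumS ip_comb// IH [RHS]big_nat_recr.
Qed.

Lemma ip_sine_sum_e N k : (0 < k)%N ->
  ip (sine_sum N) (e l k) = if (k <= N)%N then c k * (l / 2) else 0.
Proof.
move=> k0; rewrite ip_sine_sum; last exact: L2_e.
elim: N => [|N IH]; first by rewrite big_nil leqNgt k0.
rewrite big_nat_recr//= IH ip_e//.
have [kN|kN] := leqP k N; first by rewrite leqW// gtn_eqF ?mulr0 ?addr0// ltnS.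
rewrite add0r; have [->|ne] := eqVneq N.+1 k; first by rewrite leqnn.
by rewrite mulr0 leqNgt ltn_neqAle ne kN.
Qed.

Lemma ip_sine_sum_sqr N :
  ip (sine_sum N) (sine_sum N) = l / 2 * \sum_(1 <= k < N.+1) c k ^+ 2.
Proof.
rewrite ip_sine_sum; last exact: L2_sine_sum.
rewrite mulr_sumr !big_nat; apply: eq_bigr => k /andP[k0 kN].
by rewrite ipC ip_sine_sum_e// -ltnS kN; ring.
Qed.

End partial_sums.

(** The squared distance from [u] to the partial sum of its sine series is
    nonnegative. *)
Lemma bessel u N : L2 l u ->
  \sum_(1 <= k < N.+1) psi_coef l u k ^+ 2 <= 2 / l * ip u u.
Proof.
move=> Lu; pose c := psi_coef l u; rewrite -/c.
have cE k : ip (e l k) u = l / 2 * c k.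
  by rewrite /c /psi_coef -/(ip u (e l k)) ipC; field; rewrite gt_eqF.
have LS := L2_sine_sum c N.
pose d x := u x + -1 * sine_sum c N x.
have Ld : L2 l d by exact: L2_comb.
have := ip_ge0 d.
rewrite (ip_comb (-1) Lu LS Ld) (ipC u d) (ip_comb (-1) Lu LS Lu).
rewrite (ipC (sine_sum c N) d) (ip_comb (-1) Lu LS LS).
rewrite (ipC u (sine_sum c N)) ip_sine_sum_sqr.
rewrite (ip_sine_sum _ _ Lu).
have -> : \sum_(1 <= k < N.+1) c k * ip (e l k) u =
    l / 2 * \sum_(1 <= k < N.+1) c k ^+ 2.
  by rewrite mulr_sumr; apply: eq_bigr => k _; rewrite cE; ring.
move: (\sum_(1 <= k < N.+1) c k ^+ 2) (ip u u) => s p h.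
have h2 : l / 2 * s <= p by lra.
have -> : s = 2 / l * (l / 2 * s) by field; rewrite gt_eqF.
by rewrite ler_wpM2l// divr_ge0// ltW.
Qed.

(** The norm of the pointwise limit is at most the lower limit of the norms of
    the partial sums, by Fatou's lemma; by orthogonality those are explicit. *)
Lemma sine_series_bound (c : nat -> R) v (b : R) :
  (forall N, \sum_(1 <= k < N.+1) c k ^+ 2 <= b) ->
  (forall x, 0 < x < l -> \sum_(1 <= k < N) c k * e l k x @[N --> \oo] --> v x) ->
  (\int[leb]_(x in `]0%R, l[) (v x ^+ 2)%:E <= (l / 2 * b)%:E)%E.
Proof.
move=> cb cv.
have mS N : measurable_fun setT (sine_sum c N : mR -> R).
  apply: measurable_sum => k; apply: measurable_funM => //; exact: measurable_e.
pose g N : mR -> \bar R := fun x => ((sine_sum c N x) ^+ 2)%:E.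
have mg N : measurable_fun (`]0, l[ : set mR) (g N).
  by apply/measurable_EFinP; apply: measurable_funTS; exact: measurable_funX.
have -> : (\int[leb]_(x in `]0%R, l[) (v x ^+ 2)%:E =
    \int[leb]_(x in `]0%R, l[) limn_einf (g ^~ x))%E.
  apply: eq_integral => x; rewrite inE/= in_itv/= => xl.
  have gx : g N x @[N --> \oo] --> (v x ^+ 2)%:E.
    apply/fine_cvgP; split; first exact: nearW.
    have h := cv x xl; rewrite -cvg_shiftS in h.
    exact: (cvgM h h).
  by rewrite (cvg_limn_einf_sup gx).
apply: le_trans (fatou _ _ mg _) _ => //.
  by move=> N x _; rewrite lee_fin sqr_ge0.
have gi N : (\int[leb]_(x in `]0%R, l[) g N x)%E =
    (l / 2 * \sum_(1 <= k < N.+1) c k ^+ 2)%:E.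
  rewrite -ip_sine_sum_sqr /ip /Rintegral fineK//.
  exact: (integrable_fin_num _ (L2_prod (L2_sine_sum c N) (L2_sine_sum c N))).
rewrite limn_einf_lim; apply: lime_le; first exact: is_cvg_einfs.
apply: nearW => N; apply: (@le_trans _ _ (\int[leb]_(x in `]0%R, l[) g N x)%E).
  by apply: ereal_inf_lbound; exists N => //=.
by rewrite gi lee_fin ler_wpM2l// divr_ge0// ltW.
Qed.

End sine_basis.

(** * Sine coefficients of time-dependent data *)

Section time_coefficients.
Context {R : realType}.
Local Notation leb := (@lebesgue_measure R).
Local Notation mR := (measurableTypeR R).
Variables l T : R.
Hypothesis l_gt0 : 0 < l.
Implicit Types (u v w : R -> R) (k j n K : nat) (x t : R).

Lemma L2_lincomb (I : Type) (r : seq I) (a : I -> R) (v : I -> R -> R) :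
  (forall i, L2 l (v i)) -> L2 l (fun x => \sum_(i <- r) a i * v i x).
Proof.
move=> Lv; elim: r => [|i r IH].
  rewrite (_ : (fun _ => _) = cst 0); last by apply/funext => x; rewrite big_nil.
  by apply: (@L2_bounded _ l 0) => // x; rewrite normr0.
rewrite (_ : (fun _ => _) = fun x => \sum_(i <- r) a i * v i x + a i * v i x).
  exact: L2_comb.
by apply/funext => x; rewrite big_cons addrC.
Qed.

Lemma ip_lincomb (I : Type) (r : seq I) (a : I -> R) (v : I -> R -> R) w :
  (forall i, L2 l (v i)) -> L2 l w ->
  ip l (fun x => \sum_(i <- r) a i * v i x) w = \sum_(i <- r) a i * ip l (v i) w.
Proof.
move=> Lv Lw; elim: r => [|i r IH].
  rewrite big_nil /ip; under eq_Rintegral do rewrite big_nil mul0r.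
  by rewrite Rintegral_cst// mul0r.
rewrite (_ : (fun _ => _) = fun x => \sum_(i <- r) a i * v i x + a i * v i x); last first.
  by apply/funext => x; rewrite big_cons addrC.
rewrite ip_comb ?IH ?big_cons 1?addrC//; exact: L2_lincomb.
Qed.

Lemma psi_coefE u k : psi_coef l u k = 2 / l * ip l u (e l k).
Proof. by []. Qed.

Lemma psi_coefB u v k : L2 l u -> L2 l v ->
  psi_coef l (fun x => u x - v x) k = psi_coef l u k - psi_coef l v k.
Proof.
move=> Lu Lv; rewrite !psi_coefE.
rewrite (_ : (fun x => u x - v x) = fun x => u x + -1 * v x); last first.
  by apply/funext => x; rewrite mulN1r.
by rewrite (ip_comb (-1) Lu Lv (L2_e l k)); ring.
Qed.

Lemma L2B u v : L2 l u -> L2 l v -> L2 l (fun x => u x - v x).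
Proof.
move=> Lu Lv; rewrite (_ : (fun x => u x - v x) = fun x => u x + -1 * v x).
  exact: L2_comb.
by apply/funext => x; rewrite mulN1r.
Qed.

Lemma psi_coef_le u k : L2 l u -> psi_coef l u k ^+ 2 <= 2 / l * ip l u u.
Proof.
case: k => [|k] Lu.
  rewrite psi_coefE /ip; under eq_Rintegral do rewrite /e !mul0r sin0 mulr0.
  rewrite Rintegral_cst// mul0r mulr0 expr0n/= mulr_ge0 ?ip_ge0//.
  by rewrite divr_ge0// ltW.
 apply: le_trans (bessel l_gt0 k.+1 Lu).
rewrite big_nat_recr//= lerDr sumr_ge0// => j _; exact: sqr_ge0.
Qed.

Lemma L2norm_ip u : L2 l u -> ((L2norm l (EFin \o u)) `^ 2 = (ip l u u)%:E)%E.
Proof.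
move=> Lu; rewrite L2norm_sqr /ip /Rintegral fineK//.
exact: (integrable_fin_num _ (L2_prod Lu Lu)).
Qed.

Lemma L2norm_le_Hnorm m u : (L2norm l (EFin \o u) <= Hnorm l m u)%E.
Proof.
rewrite /Hnorm big_ord_recl/=.
have L0 : (0 <= L2norm l (EFin \o u))%E by exact: Lnorm_ge0.
have L2E : (L2norm l (EFin \o u) = (L2norm l (EFin \o u) `^ 2) `^ 2^-1)%E.
  by rewrite -poweRrM mulfV// poweRe1.
rewrite [leLHS]L2E.
set S := (X in ((_ + X) `^ _)%E).
have S0 : (0 <= S)%E.
  by rewrite sume_ge0// => i _; exact: poweR_ge0.
apply: gt0_ler_poweR; rewrite ?in_itv/= ?leey ?andbT ?poweR_ge0//.
- by rewrite adde_ge0 ?poweR_ge0.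
- by rewrite leeDl.
Qed.

Lemma Hspace_L2 m u : Hspace l m u -> L2 l u.
Proof. by case: m => [//|m [] ]. Qed.

(** Strong measurability gives regularity of [t |-> f(., t)] only off a null set
    [N]; [F k] is a measurable function which represents the coefficient [f_k]
    there. *)
Record tame (f : R -> R -> R) (F : nat -> R -> R) (N : set mR) : Prop := Tame {
  tame_meas : measurable N;
  tame_null : leb N = 0%E;
  tame_L2 : forall t, 0 < t < T -> ~ N t -> L2 l (f^~ t);
  tame_coef : forall t, 0 < t < T -> ~ N t -> forall k, f_coef l f k t = F k t;
  tame_sqr : forall k, L2 T (F k) }.

Lemma tameB f1 f2 F1 F2 N1 N2 : tame f1 F1 N1 -> tame f2 F2 N2 ->
  tame (fun x t => f1 x t - f2 x t) (fun k t => F1 k t - F2 k t) (N1 `|` N2).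
Proof.
move=> [mN1 N10 L1 c1 s1] [mN2 N20 L2' c2 s2]; split.
- exact: measurableU.
- by apply/eqP; rewrite eq_le measure_ge0 andbT -[leRHS]adde0 -{1}N10 -N20 measureU2.
- move=> t tT; rewrite not_orP => -[n1 n2]; apply: L2B; [exact: L1|exact: L2'].
- move=> t tT; rewrite not_orP => -[n1 n2] k.
  rewrite -[LHS]/(psi_coef l (fun x => f1 x t - f2 x t) k).
  by rewrite (psi_coefB k (L1 t tT n1) (L2' t tT n2)) -c1// -c2.
- move=> k; rewrite (_ : (fun t => _) = fun t => F1 k t + -1 * F2 k t).
    by apply: L2_comb; [exact: s1|exact: s2].
  by apply/funext => t; rewrite mulN1r.
Qed.

Lemma integral_sum_sqr (F : nat -> R -> R) K : (forall k, L2 T (F k)) ->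
  leb.-integrable `]0, T[ (EFin \o (fun t => \sum_(1 <= k < K.+1) F k t ^+ 2)) /\
  \int[leb]_(t in `]0, T[) (\sum_(1 <= k < K.+1) F k t ^+ 2) =
  \sum_(1 <= k < K.+1) ip T (F k) (F k).
Proof.
move=> LF; elim: K => [|K [iK eK]].
  rewrite big_nil (_ : (fun t => _) = cst 0); last first.
    by apply/funext => t; rewrite big_nil.
  split; first by apply: (@bounded_integrable _ 0) => // t; rewrite normr0.
  by rewrite Rintegral_cst// mul0r.
have iF : leb.-integrable `]0, T[ (EFin \o (fun t => F K.+1 t ^+ 2)).
  by have /L2P[] := LF K.+1.
rewrite (_ : (fun t => _) = fun t => \sum_(1 <= k < K.+1) F k t ^+ 2 + F K.+1 t ^+ 2); last first.
  by apply/funext => t; rewrite big_nat_recr.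
split; last by rewrite RintegralD// eK [RHS]big_nat_recr.
have := @integrableD _ mR R leb `]0, T[%classic (measurable_itv _) _ _ iK iF.
by apply: eq_integrable => // t _ /=; rewrite EFinD.
Qed.

(** Bessel's inequality at almost every time, integrated in time. *)
Lemma tame_energy f F N K : tame f F N ->
  ((l / 2 * \sum_(1 <= k < K.+1) ip T (F k) (F k))%:E <= (L2L2norm l T f) `^ 2)%E.
Proof.
move=> [mN N0 Lf cf sF].
have [iG eG] := integral_sum_sqr K sF.
have l2 : 0 <= l / 2 by rewrite divr_ge0// ltW.
rewrite -eG EFinM /Rintegral fineK; last exact: (integrable_fin_num _ iG).
rewrite -ge0_integralZl//; last 2 first.
- by case/integrableP: iG.
- by move=> t _; rewrite lee_fin sumr_ge0// => k _; exact: sqr_ge0.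
rewrite /L2L2norm [X in (_ <= X `^ _)%E]/L2norm poweR_Lnorm//.
rewrite [leLHS]integral_mkcond.
apply: (@ge0_le_integral_negligible _ mR R leb _ N) => //.
- move=> t _; rewrite /patch; case: ifP => // _; rewrite -EFinM lee_fin mulr_ge0//.
  by rewrite sumr_ge0// => k _; exact: sqr_ge0.
- by move=> t _; exact: poweR_ge0.
- move=> t _ nN; rewrite /patch mem_setE in_itv/=; case: ifP => [tT|_]; last exact: poweR_ge0.
  rewrite gee0_abs; last exact: Lnorm_ge0.
  rewrite (L2norm_ip (Lf t tT nN)) -EFinM lee_fin.
  have := bessel l_gt0 K (Lf t tT nN).
  rewrite big_nat (eq_bigr (fun k => F k t ^+ 2)); last by move=> k _; rewrite -cf.
  rewrite -big_nat => h; rewrite -ler_pdivlMl; last by rewrite divr_gt0.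
  by rewrite invf_div.
Qed.

Lemma simple_coef s k : simple_Hvalued l 3 s ->
  (forall t, L2 l (s^~ t)) /\ measurable_fun setT (f_coef l s k : mR -> R).
Proof.
move=> [n [A [v [mA Hv sE]]]].
have Lv i : L2 l (v i) by exact: Hspace_L2 (Hv i).
have st t : s^~ t = fun x => \sum_(i < n) \1_(A i) t * v i x.
  by apply/funext => x; rewrite sE.
split=> [t|]; first by rewrite st; exact: L2_lincomb.
rewrite (_ : f_coef l s k = fun t => 2 / l * \sum_(i < n) \1_(A i) t * ip l (v i) (e l k)).
  apply: measurable_funM => //; apply: measurable_sum => i.
  apply: measurable_funM => //; apply: measurable_indic; exact: mA.
apply/funext => t; rewrite -[LHS]/(psi_coef l (s^~ t) k) psi_coefE st ip_lincomb//.
exact: L2_e.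
Qed.

(** Outside the null set, [f_k(t)] is the limit of the coefficients of the
    approximating simple functions, since a coefficient is bounded by the
    [L^2] norm; and those are measurable in [t]. *)
Lemma bochner_tame f : Bochner_L2H l T 3 f -> exists F N, tame f F N.
Proof.
move=> [[N1 [mN1 N10 H1]] [s [ss [N2 [mN2 N20 H2]]]] fT].
pose N := N1 `|` N2.
have mN : measurable N by exact: measurableU.
have N0 : leb N = 0%E.
  by apply/eqP; rewrite eq_le measure_ge0 andbT -[leRHS]adde0 -{1}N10 -N20 measureU2.
have Lf t : 0 < t < T -> ~ N t -> L2 l (f^~ t).
  move=> tT; rewrite not_orP => -[n1 _]; apply: (@Hspace_L2 3).
  by apply: contrapT => h; apply/n1/H1 => /= /(_ _) h'; apply: h; apply: h'; rewrite in_itv.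
have cv t : 0 < t < T -> ~ N t ->
    Hnorm l 3 (fun x => f x t - s n x t) @[n --> \oo] --> 0%E.
  move=> tT; rewrite not_orP => -[_ n2].
  by apply: contrapT => h; apply/n2/H2 => /= h'; apply/h/h'; rewrite in_itv.
pose D : set mR := `]0, T[%classic `\` N.
have mD : measurable D by exact: measurableD.
have mc k : measurable_fun D (f_coef l f k).
  apply: (@measurable_fun_cvg _ mR R D (fun n => f_coef l (s n) k)).
    by move=> n; apply: measurable_funTS; case: (simple_coef k (ss n)).
  move=> t [/=]; rewrite in_itv/= => tT nN.
  have Lft := Lf t tT nN.
  have Ls n : L2 l ((s n)^~ t) by case: (simple_coef k (ss n)).
  have /fine_cvgP[[n0 _ fin] h0] := cv t tT nN.
  pose a n := fine (Hnorm l 3 (fun x => f x t - s n x t)).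
  have a_ge0 n : 0 <= a n by apply: fine_ge0; exact: poweR_ge0.
  have [C C0 C2] : exists2 C : R, 0 <= C & C ^+ 2 = 2 / l.
    by exists (Num.sqrt (2 / l)); rewrite ?sqrtr_ge0 ?sqr_sqrtr ?divr_ge0 ?(ltW l_gt0).
  have le n : (n0 <= n)%N -> `|f_coef l f k t - f_coef l (s n) k t| <= C * a n.
    move=> nn; have LD := L2B Lft (Ls n).
    rewrite -[f_coef l f k t]/(psi_coef l (f^~ t) k).
    rewrite -[f_coef l (s n) k t]/(psi_coef l ((s n)^~ t) k) -(psi_coefB k Lft (Ls n)).
    rewrite -(@ler_pXn2r _ 2)// ?nnegrE ?mulr_ge0//.
    rewrite real_normK ?num_real// (exprMn 2 C).
    rewrite C2.
    apply: (le_trans (psi_coef_le k LD)).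
    rewrite ler_wpM2l ?divr_ge0 ?(ltW l_gt0)//.
    have := L2norm_le_Hnorm 3 (fun x => f x t - s n x t).
    rewrite -(fineK (fin n nn)) -/(a n) => hl.
    rewrite -lee_fin -(L2norm_ip LD).
    have -> : ((a n ^+ 2)%:E = (a n)%:E `^ 2)%E.
      by rewrite /= -[2]/(2%:R) powR_mulrn.
    apply: gt0_ler_poweR => //; rewrite in_itv/= leey andbT ?lee_fin//.
    exact: Lnorm_ge0.
  apply/cvgrPdist_le => eps e0.
  have Ca : C * a n @[n --> \oo] --> (0 : R).
    by rewrite -(mulr0 C); apply: cvgMl_tmp; exact: h0.
  have [n1 _ h1] := cvgr_le _ Ca _ e0.
  exists (maxn n0 n1) => // n /=; rewrite geq_max => /andP[/le h /h1].
  by apply: le_trans.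
exists (fun k => (f_coef l f k) \_ D), N.
have mF k : measurable_fun setT ((f_coef l f k) \_ D).
  by apply/(measurable_restrictT _ _).1.
split => // [t tT nN k|k].
  by rewrite /patch mem_set//; split => //=; rewrite in_itv.
apply/L2P; split; first exact: (measurable_funTS (mF k)).
apply/integrableP; split.
  by apply/measurable_EFinP; apply: measurable_funTS; exact: measurable_funX.
have l2 : 0 <= 2 / l by rewrite divr_ge0// ltW.
pose G : R -> R := fun t => (f_coef l f k \_ D) t ^+ 2.
have mG : measurable_fun setT (fun t : mR => (G t)%:E).
  by apply/measurable_EFinP; exact: measurable_funX.
have G0 t : 0 <= G t by exact: sqr_ge0.
under eq_integral do rewrite /= ger0_norm ?sqr_ge0//.
rewrite -/(G _).
suff : ((l / 2)%:E * \int[leb]_(t in `]0%R, T[) (G t)%:E < +oo)%E.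
  move=> h; rewrite ltey; apply/negP => /eqP Goo; move: h.
  by rewrite Goo gt0_muley ?ltxx// lte_fin divr_gt0.
have hl : (0 <= (l / 2)%:E)%E by rewrite lee_fin divr_ge0// ltW.
have mG' : measurable_fun (`]0, T[ : set mR) (fun t : mR => (G t)%:E).
  exact: measurable_funTS.
have GE0 t : (`]0, T[%classic : set mR) t -> (0 <= (G t)%:E)%E by move=> _; rewrite lee_fin.
rewrite -(ge0_integralZl leb (measurable_itv _) mG' GE0 hl).
apply: (@le_lt_trans _ _ ((L2norm T (fun t => Hnorm l 3 (f^~ t))) `^ 2)%E); last first.
  by rewrite poweR_lty.
rewrite [X in (_ <= X `^ _)%E]/L2norm poweR_Lnorm// [leLHS]integral_mkcond.
apply: (@ge0_le_integral_negligible _ mR R leb _ N) => //.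
- move=> t _; rewrite /patch; case: ifP => // _; rewrite -EFinM lee_fin mulr_ge0// divr_ge0// ltW.
- by move=> t _; exact: poweR_ge0.
- move=> t _ nN; rewrite /patch mem_setE in_itv/=; case: ifP => [tT|_]; last exact: poweR_ge0.
  rewrite /G /patch mem_set; last by split => //=; rewrite in_itv.
  rewrite gee0_abs; last exact: poweR_ge0.
  apply: (@le_trans _ _ ((L2norm l (EFin \o f^~ t)) `^ 2)%E).
    rewrite (L2norm_ip (Lf t tT nN)) -EFinM lee_fin.
    have := psi_coef_le k (Lf t tT nN) => h.
    rewrite -ler_pdivlMl; last by rewrite divr_gt0.
    by rewrite invf_div.
  apply: gt0_ler_poweR => //; rewrite ?in_itv/= ?leey ?andbT.
  + exact: Lnorm_ge0.
  + exact: poweR_ge0.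
  + exact: L2norm_le_Hnorm.
Qed.

End time_coefficients.

(** * Cutoff functions on an interval *)

Section cutoff.
Context {R : realType}.
Local Notation leb := (@lebesgue_measure R).
Local Notation mR := (measurableTypeR R).
Implicit Types (x y : R) (n : nat).

(** Turns the differentiability of [ramp^2] at its kink into an algebraic
    inequality. *)
Lemma is_derive_quadratic_remainder (f : R -> R) y d :
  (forall h, `|f (y + h) - f y - d * h| <= h ^+ 2) -> is_derive y 1 f d.
Proof.
move=> H.
have cv : h^-1 *: ((f \o shift y) (h *: (1 : R)) - f y) @[h --> 0^'] --> (d : R).
  apply/cvgrPdist_le => e e0; near=> h.
  have h0 : h != 0 by near: h; exact: nbhs_dnbhs_neq.
  have he : `|h| <= e.
    near: h; apply: dnbhs0_le => //.
  rewrite /= -[h *: 1]/(h * 1) mulr1 -[h^-1 *: _]/(h^-1 * _) [h + y]addrC.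
  rewrite -(ler_pM2l (x := `|h|)) ?normr_gt0// -normrM mulrBr mulVKf//.
  rewrite distrC (mulrC h d) (le_trans (H h))// -(real_normK (num_real h)) expr2.
  by rewrite ler_wpM2l.
split; first by apply/cvg_ex; exists d.
exact: cvg_lim cv.
Unshelve. all: by end_near. Qed.

Definition ramp y : R := Num.max y 0.

Lemma continuous_ramp : continuous ramp.
Proof.
move=> x; apply: continuous_max; first exact: cvg_id.
exact: cvg_cst.
Qed.

Lemma is_derive_ramp_sqr y : is_derive y 1 (fun z => ramp z ^+ 2) (2 * ramp y).
Proof.
apply: is_derive_quadratic_remainder => h; rewrite /ramp ler_norml.
by case: (leP y 0) => y0; case: (leP (y + h) 0) => yh; apply/andP; split; nra.
Qed.

(** The piecewise quadratic [C^1] step from [0] to [1] on [[0, 1]], written with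
    the truncated squares [ramp^2] so that its derivative is a combination of
    ramps. *)
Definition smoothstep y : R :=
  2 * ramp y ^+ 2 - 4 * ramp (y - 2^-1) ^+ 2 + 2 * ramp (y - 1) ^+ 2.

Definition dsmoothstep y : R :=
  4 * ramp y - 8 * ramp (y - 2^-1) + 4 * ramp (y - 1).

Lemma is_derive_smoothstep y : is_derive y 1 smoothstep (dsmoothstep y).
Proof.
have sh a : is_derive y 1 (fun z => ramp (z - a) ^+ 2) (2 * ramp (y - a)).
  have h1 := is_derive_ramp_sqr (y - a).
  have h2 : is_derive y 1 (fun z : R => z - a) 1.
    by apply: is_derive_eq; rewrite subr0.
  have := @is_derive1_comp R (fun z => ramp z ^+ 2) (fun z => z - a) y _ _ h1 h2.
  by rewrite mulr1.
have h0 := is_derive_ramp_sqr y.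
apply: is_derive_eq; rewrite /dsmoothstep /GRing.scale/=; ring.
Qed.

Lemma smoothstep0 y : y <= 0 -> smoothstep y = 0 /\ dsmoothstep y = 0.
Proof.
by move=> y0; rewrite /smoothstep /dsmoothstep /ramp !max_r; [split; ring|lra..].
Qed.

Lemma smoothstep1 y : 1 <= y -> smoothstep y = 1 /\ dsmoothstep y = 0.
Proof.
by move=> y1; rewrite /smoothstep /dsmoothstep /ramp !max_l; [split; field|lra..].
Qed.

Lemma smoothstep_bound y : `|smoothstep y| <= 1.
Proof.
rewrite /smoothstep /ramp ler_norml.
case: (leP y 0) => h1; case: (leP (y - 2^-1) 0) => h2;
  case: (leP (y - 1) 0) => h3; apply/andP; split; nra.
Qed.

Lemma dsmoothstep_bound y : 0 <= dsmoothstep y <= 2.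
Proof.
rewrite /dsmoothstep /ramp.
case: (leP y 0) => h1; case: (leP (y - 2^-1) 0) => h2;
  case: (leP (y - 1) 0) => h3; apply/andP; split; lra.
Qed.

Lemma continuous_dsmoothstep : continuous dsmoothstep.
Proof.
have cs a : continuous (fun y : R => ramp (y - a)).
  move=> y; apply: (@continuous_comp _ _ _ (fun z : R => z - a) ramp).
    by apply: cvgB; [exact: cvg_id|exact: cvg_cst].
  exact: continuous_ramp.
move=> y; apply: cvgD; last by apply: cvgMl_tmp; exact: cs.
by apply: cvgB; apply: cvgMl_tmp; [exact: continuous_ramp|exact: cs].
Qed.

Variable l : R.
Hypothesis l_gt0 : 0 < l.

(** Comparable on [[0, l]] to the distance to the boundary, but smooth. *)
Definition bump x : R := x * (l - x).

Definition cutoff n x : R := smoothstep (n.+1%:R * bump x - 1).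

Definition dcutoff n x : R :=
  dsmoothstep (n.+1%:R * bump x - 1) * (n.+1%:R * (l - 2 * x)).

Lemma bump_gt0 x : 0 < x < l -> 0 < bump x.
Proof. by move=> /andP[x0 xl]; rewrite mulr_gt0// subr_gt0. Qed.

Lemma is_derive_cutoff n x : is_derive x 1 (cutoff n) (dcutoff n x).
Proof.
have h2 : is_derive x 1 (fun x => n.+1%:R * bump x - 1) (n.+1%:R * (l - 2 * x)).
  rewrite /bump; apply: is_derive_eq; rewrite /GRing.scale/=; ring.
exact: (is_derive1_comp (is_derive_smoothstep _) h2).
Qed.

Lemma continuous_dcutoff n : continuous (dcutoff n).
Proof.
have cb : continuous bump.
  move=> x; apply: cvgM; first exact: cvg_id.
  by apply: cvgB; [exact: cvg_cst|exact: cvg_id].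
move=> x; apply: cvgM.
  apply: (@continuous_comp _ _ _ (fun x => n.+1%:R * bump x - 1) dsmoothstep).
    by apply: cvgB; [apply: cvgMl_tmp; exact: cb|exact: cvg_cst].
  exact: continuous_dsmoothstep.
apply: cvgMl_tmp; apply: cvgB; first exact: cvg_cst.
by apply: cvgMl_tmp; exact: cvg_id.
Qed.

Lemma continuous_cutoff n : continuous (cutoff n).
Proof.
move=> x; apply: differentiable_continuous; apply/derivable1_diffP.
by case: (is_derive_cutoff n x).
Qed.

Lemma measurable_cutoff n : measurable_fun setT (cutoff n : mR -> R).
Proof. exact: continuous_measurable_fun (@continuous_cutoff n). Qed.

Lemma measurable_dcutoff n : measurable_fun setT (dcutoff n : mR -> R).
Proof. exact: continuous_measurable_fun (@continuous_dcutoff n). Qed.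

Lemma cutoff_bound n x : `|cutoff n x| <= 1. Proof. exact: smoothstep_bound. Qed.

Lemma cutoff_stable x : 0 < x < l -> exists n0, forall n, (n0 <= n)%N ->
  cutoff n x = 1 /\ dcutoff n x = 0.
Proof.
move=> xl; have q0 := bump_gt0 xl.
exists (Num.truncn (2 / bump x)) => n hn.
have h : 2 <= n.+1%:R * bump x.
  rewrite -ler_pdivrMr// (le_trans (ltW (truncnS_gt _)))// ler_nat ltnS //.
rewrite /cutoff /dcutoff; have [|-> ->] := @smoothstep1 (n.+1%:R * bump x - 1).
  by rewrite lerBrDr.
by rewrite mul0r.
Qed.

(** [dcutoff n] is of size [n] where [bump] is of size [1/n], and vanishes
    elsewhere. *)
Lemma dcutoff_bump n x : 0 <= x <= l -> bump x * `|dcutoff n x| <= 4 * l.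
Proof.
move=> /andP[x0 xl]; have q0 : 0 <= bump x by rewrite mulr_ge0// subr_ge0.
have l2 : `|l - 2 * x| <= l by rewrite ler_norml; lra.
have n0 : 0 <= n.+1%:R :> R by [].
have [h|h] := leP 1 (n.+1%:R * bump x - 1).
  by rewrite /dcutoff (proj2 (smoothstep1 h)) mul0r normr0 mulr0 mulr_ge0// ltW.
have /andP[d0 d2] := dsmoothstep_bound (n.+1%:R * bump x - 1).
rewrite /dcutoff normrM (ger0_norm d0) normrM (ger0_norm n0).
have -> : bump x * (dsmoothstep (n.+1%:R * bump x - 1) * (n.+1%:R * `|l - 2 * x|)) =
  (dsmoothstep (n.+1%:R * bump x - 1) * (n.+1%:R * bump x)) * `|l - 2 * x| by ring.
apply: ler_pM => //; first by apply: mulr_ge0 => //; apply: mulr_ge0.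
have -> : (4 : R) = 2 * 2 by ring.
apply: ler_pM => //; first by apply: mulr_ge0.
by move: h; rewrite ltrBlDr => /ltW.
Qed.

Lemma cutoff_support n : exists a b, [/\ 0 < a, b < l &
  forall x, x \notin `[a, b] -> cutoff n x = 0].
Proof.
pose a := (n.+1%:R * l)^-1.
have a0 : 0 < a by rewrite invr_gt0 mulr_gt0.
exists a, (l - a); split => //; first by rewrite ltrBlDr ltrDl.
move=> x; rewrite in_itv/= => xab; apply: (proj1 (smoothstep0 _)).
rewrite lerBlDr add0r.
have na : n.+1%:R * l * a = 1 by rewrite mulfV// gt_eqF// mulr_gt0.
have n0 : 0 < n.+1%:R :> R by [].
have key y : 0 <= y -> y <= l -> y <= a -> n.+1%:R * (y * (l - y)) <= 1.
  move=> y0 yl ya; rewrite -[leRHS]na -mulrA ler_wpM2l// mulrC.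
  by apply: ler_pM; rewrite ?subr_ge0// lerBlDr lerDl.
have neg y z : y <= 0 -> 0 <= z -> n.+1%:R * (y * z) <= 1.
  move=> y0 z0; rewrite (le_trans _ ler01)// mulr_ge0_le0// mulr_le0_ge0//.
move: xab; rewrite negb_and -!ltNge => /orP[xa|xa].
  have [x0|x0] := leP x 0; first by apply: neg => //; rewrite subr_ge0 (le_trans x0)// ltW.
  have [xl|xl] := leP x l; first by apply: key => //; exact: ltW.
  rewrite /bump (mulrC x); apply: neg; [by rewrite subr_le0 ltW|exact: ltW].
have [xl|xl] := leP x l; last first.
  by rewrite /bump (mulrC x); apply: neg; [rewrite subr_le0 ltW|rewrite ltW// (lt_trans l_gt0)].
have [x0|x0] := leP x 0; first by apply: neg => //; rewrite subr_ge0.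
rewrite /bump (mulrC x) -{2}(subKr l x).
by apply: key; [rewrite subr_ge0|rewrite lerBlDr lerDl ltW|rewrite lerBlDr -lerBlDl ltW].
Qed.

(** The cutoff is monotone on both halves of the interval and vanishes at the
    ends, so its total variation is twice its value in the middle. *)
Lemma cutoff_variation n : \int[leb]_(x in `]0, l[) `|dcutoff n x| <= 2.
Proof.
have l20 : 0 < l / 2 by rewrite divr_gt0.
have l2l : l / 2 < l by rewrite ltr_pdivrMr// ltr_pMr// ltr1n.
have FTC a b : a < b -> \int[leb]_(x in `]a, b[) dcutoff n x = cutoff n b - cutoff n a.
  move=> ab; rewrite /Rintegral -(@integral_itv_bndoo _ a b _ true false); last first.
    by apply/measurable_EFinP; apply: measurable_funTS; exact: measurable_dcutoff.
  rewrite (@continuous_FTC2 R (dcutoff n) (cutoff n))//.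
  - by apply: continuous_subspaceT; exact: continuous_dcutoff.
  - split.
    + by move=> x _; case: (is_derive_cutoff n x).
    + by apply: cvg_at_right_filter; exact: continuous_cutoff.
    + by apply: cvg_at_left_filter; exact: continuous_cutoff.
  - by move=> x _; rewrite derive1E; case: (is_derive_cutoff n x).
have bnd x : 0 <= x <= l -> `|dcutoff n x| <= 2 * (n.+1%:R * l).
  move=> /andP[x0 xl]; have /andP[d0 d2] := dsmoothstep_bound (n.+1%:R * bump x - 1).
  rewrite /dcutoff normrM (ger0_norm d0); apply: ler_pM => //.
  rewrite normrM ger0_norm// ler_wpM2l// ler_norml; lra.
have iabs : leb.-integrable `]0, l[ (EFin \o (fun x => `|dcutoff n x|)).
  apply: (@le_integrable _ mR R leb _ _ _ (EFin \o (cst (2 * (n.+1%:R * l))))) => //.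
  - apply/measurable_EFinP; apply: measurable_funTS.
    by apply: measurableT_comp => //; exact: measurable_dcutoff.
  - move=> x /=; rewrite in_itv/= => /andP[/ltW x0 /ltW xl].
    rewrite lee_fin normr_id (le_trans _ (ler_norm _))// bnd// x0 xl //.
  - by apply: (@bounded_integrable _ `|2 * (n.+1%:R * l)|).
rewrite (Rintegral_split (ltW l20) (ltW l2l) iabs).
have -> : \int[leb]_(x in `]0, l / 2[) `|dcutoff n x| = \int[leb]_(x in `]0, l / 2[) dcutoff n x.
  apply: eq_Rintegral => x; rewrite inE/= in_itv/= => /andP[x0 xl].
  rewrite ger0_norm// /dcutoff mulr_ge0//; first by case/andP: (dsmoothstep_bound (n.+1%:R * bump x - 1)).
  by rewrite mulr_ge0//; lra.
have -> : \int[leb]_(x in `]l / 2, l[) `|dcutoff n x| = - \int[leb]_(x in `]l / 2, l[) dcutoff n x.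
  rewrite -mulN1r -RintegralZl//.
    apply: eq_Rintegral => x; rewrite inE/= in_itv/= => /andP[x0 xl].
    rewrite ler0_norm ?mulN1r// /dcutoff mulr_ge0_le0//; first by case/andP: (dsmoothstep_bound (n.+1%:R * bump x - 1)).
    by rewrite mulr_ge0_le0//; lra.
  apply: (@le_integrable _ mR R leb _ _ _ (EFin \o (fun x => `|dcutoff n x|))) => //.
  - by apply/measurable_EFinP; apply: measurable_funTS; exact: measurable_dcutoff.
  - by move=> x _ /=; rewrite normr_id.
  - by apply: integrableS iabs => //; apply: subset_itvr; rewrite bnd_simp ltW.
rewrite !FTC//.
have e0 : cutoff n 0 = 0 by apply: (proj1 (smoothstep0 _)); rewrite /bump mul0r mulr0 sub0r lerN10.
have el : cutoff n l = 0 by apply: (proj1 (smoothstep0 _)); rewrite /bump subrr !mulr0 sub0r lerN10.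
rewrite e0 el; have := cutoff_bound n (l / 2); rewrite ler_norml => /andP[_ h]; lra.
Qed.

End cutoff.

(** * Integration by parts and the decay of psi_k *)

Section integration_by_parts.
Context {R : realType}.
Local Notation leb := (@lebesgue_measure R).
Local Notation mR := (measurableTypeR R).
Variable l : R.
Hypothesis l_gt0 : 0 < l.
Implicit Types (x y : R) (n k : nat) (u g b db p v : R -> R).

Lemma L2_cst (c : R) : L2 l (cst c).
Proof. by apply: (@L2_bounded _ l `|c|). Qed.

Lemma itv_bounded_integrable (f : R -> R) (c : R) :
  measurable_fun (`]0, l[ : set R) f -> (forall x, 0 < x < l -> `|f x| <= c) ->
  leb.-integrable `]0, l[ (EFin \o f).
Proof.
move=> mf fc; apply: (@le_integrable _ mR R leb _ _ _ (EFin \o cst c)) => //.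
- exact/measurable_EFinP.
- move=> x /=; rewrite in_itv/= => xl; rewrite lee_fin (le_trans (fc x xl))//.
  exact: ler_norm.
- by apply: (@bounded_integrable _ `|c|).
Qed.

Lemma L2_bounded_prod u p (c : R) : L2 l u -> measurable_fun setT (p : mR -> R) ->
  (forall x, 0 < x < l -> `|p x| <= c) ->
  leb.-integrable `]0, l[ (EFin \o (fun x => u x * p x)).
Proof.
move=> Lu mp pc.
have iu : leb.-integrable `]0, l[ (EFin \o (fun x => c * `|u x * 1|)).
  rewrite (_ : _ \o _ = fun x => (c%:E * `|(u x * 1)%:E|)%E); last first.
    by apply/funext => x /=; rewrite EFinM.
  apply: integrableZl => //; apply: (@integrable_abse _ mR) => //.
  exact: (L2_prod Lu (L2_cst 1)).
case: (Lu) => mu _.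
apply: (@le_integrable _ mR R leb _ _ _ _ _ _ iu) => //.
  by apply/measurable_EFinP; apply: measurable_funM => //; exact: measurable_funTS.
move=> x /=; rewrite in_itv/= => xl.
rewrite lee_fin (le_trans _ (ler_norm _))// normrM mulr1 mulrC ler_wpM2r//.
exact: pc.
Qed.

Lemma L2_dominated u (p_ : nat -> R -> R) p (c : R) : L2 l u ->
  (forall n, measurable_fun setT (p_ n : mR -> R)) ->
  (forall n x, 0 < x < l -> `|p_ n x| <= c) ->
  (forall x, 0 < x < l -> p_ n x @[n --> \oo] --> p x) ->
  \int[leb]_(x in `]0, l[) (u x * p_ n x) @[n --> \oo] -->
  \int[leb]_(x in `]0, l[) (u x * p x).
Proof.
move=> Lu mp pc pp; case: (Lu) => mu _.
have iu := @integrable_abse _ mR R leb _ _ (L2_bounded_prod Lu (measurable_cst c)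
  (fun x _ => lexx `|c|)).
apply: (@Rdominated_cvg _ mR R leb _ _ _ (fun x => `|u x * c|)) => //.
- by move=> n; apply: measurable_funM => //; exact: measurable_funTS.
- by move=> x /=; rewrite in_itv/= => xl; apply: cvgMl_tmp; exact: pp.
- move=> n x /=; rewrite in_itv/= => xl; rewrite !normrM ler_wpM2l//.
  by rewrite (le_trans (pc n x xl))// ler_norm.
Qed.

Lemma eventually_cvg (a_ : nat -> R) (a : R) :
  (exists n0, forall n, (n0 <= n)%N -> a_ n = a) -> a_ n @[n --> \oo] --> a.
Proof.
move=> [n0 h]; apply/cvgrPdist_le => e e0; exists n0 => // n /= hn.
by rewrite h// subrr normr0 ltW.
Qed.

Lemma cutoff_limit u b (B0 : R) : L2 l u -> measurable_fun setT (b : mR -> R) ->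
  (forall x, `|b x| <= B0) ->
  \int[leb]_(x in `]0, l[) (u x * (cutoff l n x * b x)) @[n --> \oo] -->
  \int[leb]_(x in `]0, l[) (u x * b x).
Proof.
move=> Lu mb bB; apply: (@L2_dominated _ _ _ B0) => //.
- by move=> n; apply: measurable_funM => //; exact: measurable_cutoff.
- by move=> n x _; rewrite normrM -[leRHS]mul1r; apply: ler_pM => //; exact: cutoff_bound.
- move=> x xl; apply: eventually_cvg; have [n0 h] := cutoff_stable xl.
  by exists n0 => n /h[-> _]; rewrite mul1r.
Qed.

(** If [b] vanishes at the boundary, the integrands are dominated by a multiple
    of [|u|]. *)
Lemma dcutoff_limit_bump u b (K : R) : 0 <= K -> L2 l u ->
  measurable_fun setT (b : mR -> R) ->
  (forall x, 0 <= x <= l -> `|b x| <= K * bump l x) ->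
  \int[leb]_(x in `]0, l[) (u x * (dcutoff l n x * b x)) @[n --> \oo] --> (0 : R).
Proof.
move=> K0 Lu mb bB.
have e0 : \int[leb]_(x in `]0, l[) (u x * cst 0 x) = 0.
  under eq_Rintegral do rewrite mulr0.
  by rewrite Rintegral_cst// mul0r.
have H := @L2_dominated u (fun n x => dcutoff l n x * b x) (cst 0) (K * (4 * l)) Lu.
rewrite e0 in H; apply: H.
- by move=> n; apply: measurable_funM => //; exact: measurable_dcutoff.
- move=> n x /andP[/ltW x0 /ltW xl]; have x0l : 0 <= x <= l by rewrite x0.
  rewrite normrM.
  have := ler_wpM2l (normr_ge0 (dcutoff l n x)) (bB x x0l).
  move/le_trans; apply; rewrite mulrCA ler_wpM2l// mulrC.
  exact: (dcutoff_bump l_gt0).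
- move=> x xl; apply: eventually_cvg; have [n0 h] := cutoff_stable xl.
  by exists n0 => n /h[_ ->]; rewrite mul0r.
Qed.

(** Near the ends [|v| <= e]; elsewhere [bump] is bounded below. *)
Lemma boundary_bound v (e : R) : {within `[0, l], continuous v} ->
  v 0 = 0 -> v l = 0 -> 0 < e ->
  exists2 K : R, 0 <= K & forall x, 0 < x < l -> `|v x| <= e + K * bump l x.
Proof.
move=> cv v0 vl e0.
have [_ cv0 cvl] := (continuous_within_itvP _ l_gt0).1 cv.
rewrite v0 in cv0; rewrite vl in cvl.
have n0 : `|v x| @[x --> 0^'+] --> (0 : R) by rewrite -[X in _ --> X](@normr0 R R); apply: cvg_norm.
have nl : `|v x| @[x --> l^'-] --> (0 : R) by rewrite -[X in _ --> X](@normr0 R R); apply: cvg_norm.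
have [d1 /= d10 h1] := cvgr_le _ n0 _ e0.
have [d2 /= d20 h2] := cvgr_le _ nl _ e0.
have [c1 _ m1] := EVT_max (ltW l_gt0) cv.
have [c2 _ m2] := EVT_min (ltW l_gt0) cv.
(* A bound for |v|, from its extrema; the width d of the boundary layers then
   gives bump >= d^2 outside of them. *)
pose M := `|v c1| + `|v c2|.
have M0 : 0 <= M by rewrite addr_ge0.
have vM x : 0 < x < l -> `|v x| <= M.
  move=> /andP[/ltW x0 /ltW xl].
  have xi : x \in `[0, l] by rewrite in_itv/= x0.
  rewrite ler_norml (le_trans (m1 x xi)) ?andbT; last first.
    by rewrite (le_trans (ler_norm _))// lerDl.
  rewrite (le_trans _ (m2 x xi))// lerNl.
  by rewrite (le_trans (ler_norm _))// normrN lerDr.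
pose d := Num.min d1 d2.
have d0 : 0 < d by rewrite lt_min d10.
have dd : 0 < d * d by rewrite mulr_gt0.
exists (M / (d * d)); first by rewrite divr_ge0// ltW.
move=> x xl; have /andP[x0 xl'] := xl; have q0 := ltW (bump_gt0 xl).
have Kq : 0 <= M / (d * d) * bump l x by rewrite mulr_ge0// divr_ge0// ltW.
have [xd|xd] := ltP x d.
  rewrite (@le_trans _ _ e) ?lerDl//; apply: h1 => //=.
  by rewrite sub0r normrN gtr0_norm// (lt_le_trans xd)// ge_min lexx.
have [xd'|xd'] := ltP (l - x) d.
  rewrite (@le_trans _ _ e) ?lerDl//; apply: h2 => //=.
  by rewrite gtr0_norm ?subr_gt0// (lt_le_trans xd')// ge_min lexx orbT.
rewrite (le_trans (vM x xl))// -[leLHS]add0r lerD ?(ltW e0)//.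
rewrite mulrAC ler_pdivlMr// ler_wpM2l// /bump; apply: ler_pM => //; exact: ltW.
Qed.

(** The mass of [dcutoff n] stays bounded ([cutoff_variation]) and concentrates
    at the boundary, where [u] is small. By [boundary_bound] the integral is at
    most a constant times [2 e + K * int bump |dcutoff n|], and the last integral
    tends to zero by dominated convergence. *)
Lemma dcutoff_limit_boundary u b (B0 : R) : L2 l u -> zero_boundary l u ->
  measurable_fun setT (b : mR -> R) -> (forall x, `|b x| <= B0) ->
  \int[leb]_(x in `]0, l[) (u x * (dcutoff l n x * b x)) @[n --> \oo] --> (0 : R).
Proof.
move=> Lu [v [cv [N [mN N0 vu]] v0 vl]] mb bB.
have B00 : 0 <= B0 := le_trans (normr_ge0 _) (bB 0).
have mv : measurable_fun setT (v \_ `[0, l] : mR -> R).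
  apply/(measurable_restrictT _ _).1 => //.
  exact: subspace_continuous_measurable_fun.
have mD n : measurable_fun setT (dcutoff l n : mR -> R) by exact: measurable_dcutoff.
have mDn n : measurable_fun setT (fun x : mR => `|dcutoff l n x|).
  by apply: measurableT_comp.
have mbump : measurable_fun setT (bump l : mR -> R).
  by apply: measurable_funM => //; exact: measurable_funB.
pose V := v \_ `[0, l].
have VE x : 0 < x < l -> V x = v x.
  by move=> /andP[x0 xl]; rewrite /V /patch mem_setE in_itv/= (ltW x0) (ltW xl).
have uV n : \int[leb]_(x in `]0, l[) (u x * (dcutoff l n x * b x)) =
    \int[leb]_(x in `]0, l[) (V x * (dcutoff l n x * b x)).
  congr fine; apply: (@integral_eq_negligible _ mR R leb _ N) => // x /=.
  rewrite in_itv/= => xl Nx; rewrite VE//.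
  have -> // : v x = u x.
  by apply: contrapT => h; apply/Nx/vu => /= h'; apply/h/h'; rewrite in_itv.
pose Q n := \int[leb]_(x in `]0, l[) (1 * (bump l x * `|dcutoff l n x|)).
have Q0 : Q n @[n --> \oo] --> (0 : R).
  have e0 : \int[leb]_(x in `]0, l[) (cst 1 x * cst 0 x) = 0.
    under eq_Rintegral do rewrite mulr0.
    by rewrite Rintegral_cst// mul0r.
  have H := @L2_dominated (cst 1) (fun n x => bump l x * `|dcutoff l n x|)
    (cst 0) (4 * l) (L2_cst 1).
  rewrite e0 in H; apply: H.
  - by move=> n; apply: measurable_funM => //; apply: measurableT_comp.
  - move=> n x /andP[/ltW x0 /ltW xl].
    rewrite ger0_norm; first by apply: (dcutoff_bump l_gt0); rewrite x0.
    by rewrite mulr_ge0// mulr_ge0// subr_ge0.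
  - move=> x xl; apply: eventually_cvg; have [n0 h] := cutoff_stable xl.
    by exists n0 => n /h[_ ->]; rewrite normr0 mulr0.
have dbnd n x : 0 < x < l -> `|dcutoff l n x| <= 2 * (n.+1%:R * l).
  move=> /andP[x0 xl]; have /andP[d0 d2] := dsmoothstep_bound (n.+1%:R * bump l x - 1).
  rewrite /dcutoff normrM (ger0_norm d0); apply: ler_pM => //.
  rewrite normrM ger0_norm// ler_wpM2l// ler_norml.
  by apply/andP; split; lra.
have bumple x : 0 < x < l -> `|bump l x| <= l * l.
  move=> xl; rewrite ger0_norm ?(ltW (bump_gt0 xl))//; case/andP: xl => x0 xl.
  by rewrite /bump; apply: ler_pM; rewrite ?subr_ge0 ?ltW// ltrBlDr ltrDl.
have est e : 0 < e -> exists2 K : R, 0 <= K & forall n,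
    `|\int[leb]_(x in `]0, l[) (u x * (dcutoff l n x * b x))| <= B0 * (e * 2 + K * Q n).
  move=> e0; have [K K0 vK] := boundary_bound cv v0 vl e0.
  exists K => // n; rewrite uV.
  have i1 : leb.-integrable `]0, l[ (EFin \o (fun x => `|dcutoff l n x|)).
    apply: (@itv_bounded_integrable _ (2 * (n.+1%:R * l))).
      exact: (measurable_funTS (mDn n)).
    by move=> x xl; rewrite normr_id; exact: dbnd.
  have i2 : leb.-integrable `]0, l[ (EFin \o (fun x => 1 * (bump l x * `|dcutoff l n x|))).
    apply: (@itv_bounded_integrable _ (4 * l)).
      have mm : measurable_fun setT (fun x : mR => 1 * (bump l x * `|dcutoff l n x|)).
        by apply: measurable_funM => //; apply: measurable_funM.
      exact: (measurable_funTS mm).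
    move=> x /andP[/ltW x0 /ltW xl]; rewrite mul1r normrM normr_id ger0_norm.
      by apply: (dcutoff_bump l_gt0); rewrite x0.
    by rewrite mulr_ge0// subr_ge0.
  pose w x := B0 * (e * `|dcutoff l n x| + K * (1 * (bump l x * `|dcutoff l n x|))).
  have ii : leb.-integrable `]0, l[ (EFin \o (fun x =>
      e * `|dcutoff l n x| + K * (1 * (bump l x * `|dcutoff l n x|)))).
    rewrite (_ : _ \o _ = fun x => (e%:E * (`|dcutoff l n x|)%:E +
       K%:E * (1 * (bump l x * `|dcutoff l n x|))%:E)%E); last first.
      by apply/funext => x /=; rewrite -!EFinM -EFinD.
    by apply: integrableD => //; exact: integrableZl.
  have iw : leb.-integrable `]0, l[ (EFin \o w).
    rewrite (_ : _ \o _ = fun x => (B0%:E * (e * `|dcutoff l n x| +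
        K * (1 * (bump l x * `|dcutoff l n x|)))%:E)%E); last first.
      by apply/funext => x /=; rewrite -EFinM.
    exact: integrableZl.
  have Vw x : 0 < x < l -> `|V x * (dcutoff l n x * b x)| <= w x.
    move=> xl; rewrite VE// (normrM (v x)) (normrM (dcutoff l n x)) /w.
    have := vK x xl; have := bB x; have := normr_ge0 (b x); have := normr_ge0 (v x).
    have := normr_ge0 (dcutoff l n x); have := bump_gt0 xl.
    move: `|v x| `|b x| `|dcutoff l n x| (bump l x) => a c f q q0 f0 a0 c0 cB aK.
    have h := ler_wpM2r f0 aK.
    have h2 := ler_pM c0 (mulr_ge0 a0 f0) cB h.
    have -> : a * (f * c) = c * (a * f) by ring.
    by rewrite (le_trans h2)// le_eqVlt; apply/orP; left; apply/eqP; ring.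
  have iV : leb.-integrable `]0, l[ (EFin \o (fun x => V x * (dcutoff l n x * b x))).
    apply: (@le_integrable _ mR R leb _ _ _ _ _ _ iw) => //.
      apply/measurable_EFinP; apply: measurable_funTS.
      by apply: measurable_funM => //; apply: measurable_funM.
    move=> x /=; rewrite in_itv/= => xl.
    by rewrite lee_fin (le_trans (Vw x xl))// ler_norm.
  apply: (le_trans (le_normr_Rintegral _ iV)) => //.
  apply: (@le_trans _ _ (\int[leb]_(x in `]0, l[) w x)).
    apply: le_Rintegral => //.
      have := @integrable_abse _ mR R leb _ _ iV.
      by apply: eq_integrable.
  rewrite /w RintegralZl// ler_wpM2l//.
  rewrite RintegralD//; last 2 first.
  - rewrite (_ : _ \o _ = fun x => (e%:E * (`|dcutoff l n x|)%:E)%E); last first.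
      by apply/funext => x /=; rewrite -EFinM.
    exact: integrableZl.
  - rewrite (_ : _ \o _ = fun x => (K%:E * (1 * (bump l x * `|dcutoff l n x|))%:E)%E); last first.
      by apply/funext => x /=; rewrite -EFinM.
    exact: integrableZl.
  rewrite (RintegralZl e)// (RintegralZl K)//.
  by apply: lerD => //; rewrite ler_wpM2l ?(ltW e0)// cutoff_variation.
apply/cvgrPdist_le => e e0.
have e1 : 0 < e / (4 * (B0 + 1)) by rewrite divr_gt0// mulr_gt0// ltr_wpDl.
have [K K0 h] := est _ e1.
have KQ : B0 * (K * Q n) @[n --> \oo] --> (0 : R).
  by rewrite -(mulr0 B0) -(mulr0 K); do 2 apply: cvgMl_tmp.
have e2 : 0 < e / 2 by rewrite divr_gt0.
have [n0 _ hn] := cvgr_le _ KQ _ e2.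
exists n0 => // n /= /hn le1; rewrite sub0r normrN (le_trans (h n))//.
rewrite mulrDr.
have : B0 * (e / (4 * (B0 + 1)) * 2) <= e / 2.
  have -> : B0 * (e / (4 * (B0 + 1)) * 2) = e / 2 * (B0 / (B0 + 1)).
    by field; rewrite gt_eqF// ltr_wpDl.
  rewrite ler_piMr ?(ltW e2)// ler_pdivrMr ?ltr_wpDl// mul1r lerDl //.
move: le1; move: (B0 * (K * Q n)) (B0 * (e / (4 * (B0 + 1)) * 2)) => X Y; lra.
Qed.

Lemma cutoff_test n b db : (forall x, is_derive x 1 b (db x)) -> continuous db ->
  test_fun l (fun x => cutoff l n x * b x) /\
  forall x, derive1 (fun x => cutoff l n x * b x) x =
    dcutoff l n x * b x + cutoff l n x * db x.
Proof.
move=> bd cdb.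
have dE x : is_derive x 1 (fun x => cutoff l n x * b x)
    (dcutoff l n x * b x + cutoff l n x * db x).
  have h := is_deriveM (is_derive_cutoff l n x) (bd x).
  apply: (is_derive_eq h); rewrite /GRing.scale/=; ring.
have d1E x : derive1 (fun x => cutoff l n x * b x) x =
    dcutoff l n x * b x + cutoff l n x * db x.
  by rewrite derive1E; case: (dE x).
have cb : continuous b.
  move=> x; apply: differentiable_continuous; apply/derivable1_diffP.
  by case: (bd x).
split => //; split.
- by move=> x; case: (dE x).
- rewrite (_ : derive1 _ = fun x => dcutoff l n x * b x + cutoff l n x * db x); last exact/funext.
  move=> x; apply: cvgD; apply: cvgM.
  + exact: continuous_dcutoff.
  + exact: cb.
  + exact: continuous_cutoff.
  + exact: cdb.
- have [a [c [a0 cl h]]] := cutoff_support l_gt0 n.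
  by exists a, c; split => // x /h ->; rewrite mul0r.
Qed.

(** Test the weak derivative against [cutoff n * b] and let [n] tend to
    infinity. The term with [dcutoff n] vanishes in the limit if either factor
    vanishes at the boundary. *)
Lemma weak_integration_by_parts u g b db (B0 : R) :
  weak_derivative l u g -> (forall x, is_derive x 1 b (db x)) -> continuous db ->
  (forall x, `|b x| <= B0) -> (forall x, `|db x| <= B0) ->
  (zero_boundary l u \/ exists2 K : R, 0 <= K &
     forall x, 0 <= x <= l -> `|b x| <= K * bump l x) ->
  \int[leb]_(x in `]0, l[) (u x * db x) = - \int[leb]_(x in `]0, l[) (g x * b x).
Proof.
move=> [Lu Lg wd] bd cdb bB dbB bdry.
have cb : continuous b.
  move=> x; apply: differentiable_continuous; apply/derivable1_diffP.
  by case: (bd x).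
have mb : measurable_fun setT (b : mR -> R) by exact: continuous_measurable_fun.
have mdb : measurable_fun setT (db : mR -> R) by exact: continuous_measurable_fun.
have l1 : \int[leb]_(x in `]0, l[) (u x * (dcutoff l n x * b x)) @[n --> \oo] --> (0 : R).
  by case: bdry => [zb|[K K0 bK]];
    [exact: (dcutoff_limit_boundary Lu zb mb bB)|exact: (dcutoff_limit_bump K0 Lu mb bK)].
have l2 := cutoff_limit Lu mdb dbB.
have l3 := cutoff_limit Lg mb bB.
have E n : \int[leb]_(x in `]0, l[) (u x * (dcutoff l n x * b x)) +
    \int[leb]_(x in `]0, l[) (u x * (cutoff l n x * db x)) =
    - \int[leb]_(x in `]0, l[) (g x * (cutoff l n x * b x)).
  have [tf d1E] := cutoff_test n bd cdb.
  rewrite -(wd _ tf) -RintegralD//.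
  - by apply: eq_Rintegral => x _; rewrite d1E mulrDr.
  - apply: (@L2_bounded_prod _ _ (2 * (n.+1%:R * l) * B0)) => //.
      by apply: measurable_funM => //; exact: measurable_dcutoff.
    move=> x /andP[x0 xl]; rewrite normrM; apply: ler_pM => //.
    have /andP[d0 d2] := dsmoothstep_bound (n.+1%:R * bump l x - 1).
    rewrite /dcutoff normrM (ger0_norm d0); apply: ler_pM => //.
    rewrite normrM ger0_norm// ler_wpM2l// ler_norml.
    by apply/andP; split; lra.
  - apply: (@L2_bounded_prod _ _ (1 * B0)) => //.
      by apply: measurable_funM => //; exact: measurable_cutoff.
    by move=> x _; rewrite normrM; apply: ler_pM => //; exact: cutoff_bound.
pose X n : R := - \int[leb]_(x in `]0, l[) (g x * (cutoff l n x * b x)).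
have c2 : X n @[n --> \oo] --> - \int[leb]_(x in `]0, l[) (g x * b x).
  exact: cvgN l3.
have c3 : X n @[n --> \oo] --> \int[leb]_(x in `]0, l[) (u x * db x).
  rewrite -[X in _ --> X]add0r (_ : X = fun n =>
    \int[leb]_(x in `]0, l[) (u x * (dcutoff l n x * b x)) +
    \int[leb]_(x in `]0, l[) (u x * (cutoff l n x * db x))); last first.
    by apply/funext => n; rewrite E.
  exact: cvgD l1 l2.
exact: (cvg_unique _ c3 c2).
Qed.

Lemma sin_le_id y : 0 <= y -> `|sin y| <= y.
Proof.
rewrite le_eqVlt => /predU1P[<-|y0]; first by rewrite sin0 normr0.
have [|c _] := @MVT R sin cos 0 y y0 (fun x _ => is_derive_sin x).
  by apply: continuous_subspaceT; exact: continuous_sin.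
rewrite sin0 !subr0 => ->; rewrite normrM (gtr0_norm y0) ler_piMl ?(ltW y0)//.
exact: cos_max.
Qed.

(** Two integrations by parts turn [psi_k] into [- lambda_k^-1] times the
    coefficient of [psi'']: in the first one [psi] vanishes at the boundary, in
    the second one the sine does. *)
Lemma psi_coef_decay psi : admissible_psi l psi ->
  exists2 C : R, 0 <= C & forall k, (0 < k)%N -> `|psi_coef l psi k| <= C / lambda l k.
Proof.
move=> [[Lpsi [g [wg [Lg [h [wh _]]]]]] zb _].
have [_ Lh _] := wh.
exists (2 / l * \int[leb]_(x in `]0, l[) `|h x * 1|).
  by rewrite mulr_ge0 ?divr_ge0 ?(ltW l_gt0)//; apply: Rintegral_ge0.
move=> k k0.
pose om := k%:R * pi / l.
have om0 : 0 < om by rewrite divr_gt0// mulr_gt0 ?pi_gt0// ltr0n.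
have dsin x : is_derive x 1 (fun x => sin (om * x)) (om * cos (om * x)).
  apply: is_derive_eq; rewrite /GRing.scale/=; ring.
have dcos x : is_derive x 1 (fun x => om * cos (om * x)) (- om ^+ 2 * sin (om * x)).
  apply: is_derive_eq; rewrite /GRing.scale/=; ring.
have cs : continuous (fun x => sin (om * x)).
  by move=> x; apply: continuous_comp; [exact: mulrl_continuous|exact: continuous_sin].
have cc : continuous (fun x => cos (om * x)).
  by move=> x; apply: continuous_comp; [exact: mulrl_continuous|exact: continuous_cos].
have sbump x : 0 <= x <= l -> `|sin (om * x)| <= 2 * om / l * bump l x.
  move=> /andP[x0 xl].
  have s1 : `|sin (om * x)| <= om * x by rewrite sin_le_id// mulr_ge0// ltW.
  have s2 : `|sin (om * x)| <= om * (l - x).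
    have -> : `|sin (om * x)| = `|sin (om * (l - x))|.
      rewrite mulrBr (_ : om * l = k%:R * pi); last by rewrite /om divfK// gt_eqF.
      rewrite sinB sin_natpi mul0r sub0r normrN normrM.
      suff -> : `|cos (k%:R * pi : R)| = 1 by rewrite mul1r.
      apply/eqP; rewrite -(@pexpr_eq1 _ _ 2)// real_normK ?num_real//.
      by rewrite cos2sin2 sin_natpi expr0n subr0.
    by rewrite sin_le_id// mulr_ge0 ?subr_ge0// ltW.
  rewrite /bump.
  have lx0 : 0 <= l - x by rewrite subr_ge0.
  have h1 := ler_wpM2l x0 s2; have h2 := ler_wpM2l lx0 s1.
  have -> : 2 * om / l * (x * (l - x)) = (x * (om * (l - x)) + (l - x) * (om * x)) / l.
    by field; rewrite gt_eqF.
  by rewrite ler_pdivlMr// (le_trans _ (lerD h1 h2))// -mulrDl addrCA subrr addr0 mulrC.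
have I1 : \int[leb]_(x in `]0, l[) (psi x * (- om ^+ 2 * sin (om * x))) =
   - \int[leb]_(x in `]0, l[) (g x * (om * cos (om * x))).
  apply: (@weak_integration_by_parts psi g _ _ (om + om ^+ 2) wg dcos).
  - by move=> x; apply: cvgMl_tmp; exact: cs.
  - move=> x; rewrite normrM (gtr0_norm om0) (@le_trans _ _ om) ?lerDl ?sqr_ge0//.
    by rewrite ler_piMr ?(ltW om0)// cos_max.
  - move=> x; rewrite normrM normrN normrX (gtr0_norm om0) (@le_trans _ _ (om ^+ 2)) ?lerDr ?(ltW om0)//.
    by rewrite ler_piMr ?sqr_ge0// sin_max.
  - by left.
have I2 : \int[leb]_(x in `]0, l[) (g x * (om * cos (om * x))) =
   - \int[leb]_(x in `]0, l[) (h x * sin (om * x)).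
  apply: (@weak_integration_by_parts g h _ _ (om + 1) wh dsin).
  - by move=> x; apply: cvgMl_tmp; exact: cc.
  - by move=> x; rewrite (le_trans (sin_max _))// lerDr ltW.
  - move=> x; rewrite normrM (gtr0_norm om0) (@le_trans _ _ om) ?lerDl//.
    by rewrite ler_piMr ?(ltW om0)// cos_max.
  - right; exists (2 * om / l) => //.
    by apply: divr_ge0; [apply: mulr_ge0 => //; exact: ltW|exact: ltW].
have Is : \int[leb]_(x in `]0, l[) (psi x * (- om ^+ 2 * sin (om * x))) =
    - om ^+ 2 * \int[leb]_(x in `]0, l[) (psi x * e l k x).
  rewrite -RintegralZl//; last exact: (L2_prod Lpsi (L2_e l k)).
  apply: eq_Rintegral => x _; rewrite /e /om.
  have -> : k%:R * pi * x / l = k%:R * pi / l * x by rewrite mulrAC.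
  by ring.
rewrite I1 I2 opprK in Is.
have ib : `|\int[leb]_(x in `]0, l[) (h x * sin (om * x))| <=
    \int[leb]_(x in `]0, l[) `|h x * 1|.
  have ms : measurable_fun setT ((fun x => sin (om * x)) : mR -> R).
    exact: continuous_measurable_fun.
  have i1 : leb.-integrable `]0, l[ (EFin \o (fun x => h x * sin (om * x))).
    by apply: (@L2_bounded_prod _ _ 1) => // x _; exact: sin_max.
  apply: (le_trans (le_normr_Rintegral _ i1)) => //.
  apply: le_Rintegral => //.
  - by have := @integrable_abse _ mR R leb _ _ i1; apply: eq_integrable.
  - by have := @integrable_abse _ mR R leb _ _ (L2_prod Lh (L2_cst 1)); apply: eq_integrable.
  - by move=> x _; rewrite !normrM normr1 ler_wpM2l// sin_max.
rewrite /psi_coef normrM ger0_norm; last by rewrite divr_ge0// ltW.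
rewrite -[leRHS]mulrA; apply: ler_wpM2l; first by apply: divr_ge0 => //; exact: ltW.
rewrite ler_pdivlMr ?lambda_gt0// (le_trans _ ib)// Is normrM normrN normrX (gtr0_norm om0).
by rewrite mulrC.
Qed.

End integration_by_parts.

(** * The stability estimate *)

Section reconstruction_bound.
Context {R : realType}.
Local Notation leb := (@lebesgue_measure R).
Local Notation mR := (measurableTypeR R).
Variables l T : R.
Hypotheses (l_gt0 : 0 < l) (T_gt0 : 0 < T).
Implicit Types (u v w psi : R -> R) (f : R -> R -> R) (F : nat -> R -> R).

(** The quadratic polynomial [c |-> |u + c v|^2] is nonnegative. *)
Lemma ip_cauchy_schwarz u v : L2 T u -> L2 T v ->
  ip T u v ^+ 2 <= ip T u u * ip T v v.
Proof.
move=> Lu Lv.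
have quad c : 0 <= ip T u u + 2 * c * ip T u v + c ^+ 2 * ip T v v.
  apply: (le_trans (ip_ge0 T (fun x => u x + c * v x))).
  have Luv := L2_comb c Lu Lv.
  rewrite (ip_comb c Lu Lv Luv) !(ipC T _ (fun x => u x + c * v x)).
  rewrite (ip_comb c Lu Lv Lu) (ip_comb c Lu Lv Lv) (ipC T v u).
  by rewrite le_eqVlt; apply/orP; left; apply/eqP; ring.
have [v0|v0] := eqVneq (ip T v v) 0.
  have [->|p0] := eqVneq (ip T u v) 0; first by rewrite v0 mulr0 expr0n.
  have := quad (- (ip T u u + 1) / (2 * ip T u v)).
  rewrite v0 mulr0 addr0.
  have -> : ip T u u + 2 * (- (ip T u u + 1) / (2 * ip T u v)) * ip T u v = -1.
    by field; rewrite p0.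
  by rewrite oppr_ge0 ler10.
have vp : 0 < ip T v v by rewrite lt_def v0 ip_ge0.
have := quad (- ip T u v / ip T v v).
have -> : ip T u u + 2 * (- ip T u v / ip T v v) * ip T u v +
    (- ip T u v / ip T v v) ^+ 2 * ip T v v =
    ip T u u - ip T u v ^+ 2 / ip T v v by field.
by rewrite subr_ge0 ler_pdivrMr.
Qed.

Lemma ip_weight_le u w (b : R) : L2 T u -> measurable_fun setT (w : mR -> R) ->
  (forall x, `|w x| <= b) -> ip T u w ^+ 2 <= b ^+ 2 * T * ip T u u.
Proof.
move=> Lu mw wb; have Lw := L2_bounded T mw wb.
apply: (le_trans (ip_cauchy_schwarz Lu Lw)); rewrite mulrC.
apply: ler_wpM2r; first exact: ip_ge0.
have b2 : leb.-integrable `]0, T[ (EFin \o cst (b ^+ 2)).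
  by apply: (@bounded_integrable _ `|b ^+ 2|).
apply: (@le_trans _ _ (\int[leb]_(x in `]0, T[) (cst (b ^+ 2) x))).
  apply: le_Rintegral => //; first exact: L2_prod.
  move=> x _ /=; rewrite -expr2 -[w x ^+ 2]real_normK ?num_real//.
  by rewrite lerXn2r// nnegrE (le_trans _ (wb x)).
rewrite Rintegral_cst//= lebesgue_measure_itv/= lte_fin T_gt0 -EFinB/= subr0.
exact: lexx.
Qed.

(** The coefficients are [O(1/k^2)], and
    [1/(k+1)^2 <= 2 (1/(k+1) - 1/(k+2))] telescopes. *)
Lemma sine_series_cvg (c : nat -> R) (C : R) x :
  (forall k, (0 < k)%N -> `|c k| <= C / lambda l k) ->
  cvgn (fun N => \sum_(1 <= k < N) c k * e l k x).
Proof.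
move=> cC.
have C0 : 0 <= C.
  have := le_trans (normr_ge0 _) (cC 1%N isT).
  by rewrite pmulr_lge0// invr_gt0 lambda_gt0.
pose D := C / (pi / l) ^+ 2.
have pl : 0 < (pi / l) ^+ 2 by rewrite exprn_gt0// divr_gt0// pi_gt0.
have D0 : 0 <= D by apply: divr_ge0 => //; exact: ltW.
have bnd k : `|c k.+1 * e l k.+1 x| <= D * 2 * (k.+1%:R^-1 - k.+2%:R^-1).
  apply: (@le_trans _ _ (C / lambda l k.+1)).
    by rewrite normrM (le_trans _ (cC k.+1 isT))// ler_piMr// e_le1.
  have -> : C / lambda l k.+1 = D * (k.+1%:R ^+ 2)^-1.
    rewrite /D /lambda -[k.+1%:R * pi / l]mulrA exprMn.
    by rewrite [in LHS](mulrC (k.+1%:R ^+ 2)) invfM mulrA.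
  rewrite -mulrA ler_wpM2l//.
  have k1 : (0 : R) < k.+1%:R by rewrite ltr0n.
  have k1' : (1 : R) <= k.+1%:R by rewrite ler1n.
  have -> : (k.+2%:R : R) = k.+1%:R + 1 by rewrite -(natr1 k.+1).
  move: (k.+1%:R : R) k1 k1' => y y0 y1.
  have y10 : 0 < y + 1 by apply: addr_gt0.
  have -> : 2 * (y^-1 - (y + 1)^-1) = 2 / (y * (y + 1)).
    by field; rewrite !gt_eqF.
  rewrite -[leLHS]mul1r ler_pdivrMr ?exprn_gt0// mulrAC ler_pdivlMr ?mulr_gt0//.
  by rewrite mul1r expr2; nra.
have tele N : \sum_(0 <= k < N) (D * 2 * (k.+1%:R^-1 - k.+2%:R^-1)) =
    D * 2 * (1 - N.+1%:R^-1).
  elim: N => [|N IH]; first by rewrite big_nil invr1 subrr mulr0.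
  by rewrite big_nat_recr//= IH -mulrDr; congr (_ * _); ring.
have cvgs : cvgn (series (fun k => c k.+1 * e l k.+1 x)).
  apply: normed_cvg.
  apply: nondecreasing_is_cvgn.
    by apply: nondecreasing_series => n _ _; exact: normr_ge0.
  exists (D * 2) => _ [N _ <-]; rewrite /series/=.
  apply: (@le_trans _ _ (D * 2 * (1 - N.+1%:R^-1))).
    by rewrite -tele; apply: ler_sum => k _; exact: bnd.
  apply: ler_piMr; first exact: mulr_ge0.
  by rewrite gerBl invr_ge0.
apply/cvg_ex; exists (limn (series (fun k => c k.+1 * e l k.+1 x))).
rewrite -cvg_shiftS.
rewrite (_ : (fun n => _) = series (fun k => c k.+1 * e l k.+1 x))//.
by apply/funext => N; rewrite /series/= big_add1.
Qed.

Lemma L2norm_le_fin v (b : R) : 0 <= b ->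
  (\int[leb]_(x in `]0%R, l[) (v x ^+ 2)%:E <= (b ^+ 2)%:E)%E ->
  (L2norm l (EFin \o v) <= b%:E)%E.
Proof.
move=> b0 vb; rewrite L2normE.
have -> : (b%:E = (b ^+ 2)%:E `^ 2^-1)%E.
  by rewrite poweR_EFin powR12_sqrt ?sqr_ge0// sqrtr_sqr ger0_norm.
apply: gt0_ler_poweR => //; rewrite ?in_itv/= ?leey ?andbT ?lee_fin ?sqr_ge0//.
by apply: integral_ge0 => x _; rewrite lee_fin sqr_ge0.
Qed.

Lemma Bochner_L2L2_lty m f : Bochner_L2H l T m f -> (L2L2norm l T f < +oo)%E.
Proof.
move=> [_ _ fT]; apply: le_lt_trans fT.
have L0 g : (0 <= L2norm T g)%E by exact: Lnorm_ge0.
have LE g : (L2norm T g = (L2norm T g `^ 2) `^ 2^-1)%E.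
  by rewrite -poweRrM mulfV// poweRe1.
rewrite /L2L2norm [leLHS]LE [leRHS]LE.
apply: gt0_ler_poweR => //; rewrite ?in_itv/= ?leey ?andbT ?poweR_ge0//.
rewrite /L2norm !poweR_Lnorm//.
apply: (@ge0_le_integral_negligible _ mR R leb _ set0) => //.
- by move=> t _; exact: poweR_ge0.
- by move=> t _; exact: poweR_ge0.
- move=> t _ _; rewrite /patch; case: ifP => _ //.
  apply: gt0_ler_poweR; rewrite ?in_itv/= ?leey ?andbT ?abse_ge0//.
  rewrite !gee0_abs; [exact: L2norm_le_Hnorm|exact: poweR_ge0|exact: Lnorm_ge0].
Qed.

(** The core estimate, for abstract numbers [a k] and [b k] in place of [A_k(T)]
    and [B_k(T)], so that it applies both to one data set and to the difference
    of two. *)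
Lemma reconstruction_L2_le (c0 D : R) (a b : nat -> R) psi f F N v :
  0 < c0 -> 0 <= D -> L2 l psi -> tame l T f F N ->
  (forall k, (0 < k)%N -> c0 <= a k) ->
  (forall k, (0 < k)%N -> b k ^+ 2 <= D ^+ 2 * T * ip T (F k) (F k)) ->
  (forall x, 0 < x < l ->
    \sum_(1 <= k < n) (psi_coef l psi k - b k) / a k * e l k x
      @[n --> \oo] --> v x) ->
  (L2norm l (EFin \o v) <= (2 / c0 * (1 + D))%:E *
     (L2norm l (EFin \o psi) + (Num.sqrt T)%:E * L2L2norm l T f))%E.
Proof.
move=> c00 D0 Lpsi tf ac bc vc.
have C0 : 0 < 2 / c0 * (1 + D).
  by apply: mulr_gt0; [exact: divr_gt0|rewrite ltr_pwDl].
have sT : 0 < Num.sqrt T by rewrite sqrtr_gt0.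
have := L2norm_ip Lpsi; have := Lnorm_ge0 leb 2%:E ((EFin \o psi) \_ `]0, l[).
rewrite -/(L2norm l (EFin \o psi)).
have := proj2 Lpsi; case: (L2norm l (EFin \o psi)) => [p| |]//= _.
rewrite lee_fin => p0 pE.
have {}pE : ip l psi psi = p ^+ 2.
  by move: pE; rewrite -[2]/(2%:R) powR_mulrn// => -[].
have tE K := tame_energy l_gt0 K tf.
have y0 : (0 <= L2L2norm l T f)%E by exact: Lnorm_ge0.
move: (L2L2norm l T f) y0 tE => [y| |]//= y0 tE; last first.
  by rewrite gt0_muley ?lte_fin// addey// gt0_muley ?lte_fin// leey.
rewrite lee_fin in y0.
have {}tE K : l / 2 * \sum_(1 <= k < K.+1) ip T (F k) (F k) <= y ^+ 2.
  by have := tE K; rewrite -[2 in X in (_ <= X)%E]/(2%:R) powR_mulrn// lee_fin.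
rewrite -[leRHS]/((2 / c0 * (1 + D) * (p + Num.sqrt T * y))%:E).
pose Y := Num.sqrt T * y.
have Y0 : 0 <= Y by rewrite mulr_ge0// ltW.
have YE : Y ^+ 2 = T * y ^+ 2 by rewrite exprMn sqr_sqrtr// ltW.
(* From ((p - b) / a)^2 <= 2 (p^2 + b^2) / c0^2 and Bessel's inequality. *)
have bound n : \sum_(1 <= k < n.+1) ((psi_coef l psi k - b k) / a k) ^+ 2 <=
    2 / c0 ^+ 2 * (2 / l * p ^+ 2 + D ^+ 2 * T * (2 / l * y ^+ 2)).
  apply: (@le_trans _ _ (\sum_(1 <= k < n.+1)
      2 / c0 ^+ 2 * (psi_coef l psi k ^+ 2 + D ^+ 2 * T * ip T (F k) (F k)))).
    rewrite !big_nat; apply: ler_sum => k /andP[k0 _].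
    rewrite expr_div_n.
    have ak : c0 ^+ 2 <= a k ^+ 2.
      by rewrite lerXn2r ?nnegrE ?(ac _ k0)// ltW// (lt_le_trans c00 (ac _ k0)).
    have c02 : 0 < c0 ^+ 2 by rewrite exprn_gt0.
    have sq : (psi_coef l psi k - b k) ^+ 2 <=
        2 * (psi_coef l psi k ^+ 2 + D ^+ 2 * T * ip T (F k) (F k)).
      apply: (@le_trans _ _ (2 * (psi_coef l psi k ^+ 2 + b k ^+ 2))).
        move: (psi_coef l psi k) (b k) => X Z; rewrite -subr_ge0.
        have -> : 2 * (X ^+ 2 + Z ^+ 2) - (X - Z) ^+ 2 = (X + Z) ^+ 2 by ring.
        exact: sqr_ge0.
      by rewrite ler_pM2l// lerD2l bc.
    rewrite [leRHS]mulrAC; apply: ler_pM; [exact: sqr_ge0| |exact: sq|].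
      by rewrite invr_ge0 sqr_ge0.
    by rewrite lef_pV2// posrE// (lt_le_trans c02).
  rewrite -mulr_sumr big_split/= -mulr_sumr.
  have := bessel l_gt0 n Lpsi; rewrite pE => h1.
  have h2 : \sum_(1 <= k < n.+1) ip T (F k) (F k) <= 2 / l * y ^+ 2.
    have := tE n; rewrite -ler_pdivlMl; last by rewrite divr_gt0.
    by rewrite invf_div.
  apply: ler_wpM2l; first by rewrite divr_ge0// sqr_ge0.
  apply: lerD => //; apply: ler_wpM2l => //.
  by apply: mulr_ge0; [exact: sqr_ge0|exact: ltW].
have := sine_series_bound l_gt0 bound vc => vb.
apply: L2norm_le_fin.
  by apply: mulr_ge0; [exact: ltW|exact: addr_ge0].
apply: le_trans vb _; rewrite lee_fin -/Y.
have -> : l / 2 * (2 / c0 ^+ 2 * (2 / l * p ^+ 2 + D ^+ 2 * T * (2 / l * y ^+ 2))) =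
    2 / c0 ^+ 2 * (p ^+ 2 + D ^+ 2 * (T * y ^+ 2)) by field; rewrite !gt_eqF.
rewrite -YE.
have -> : (2 / c0 * (1 + D) * (p + Y)) ^+ 2 =
  2 / c0 ^+ 2 * (2 * ((1 + D) * (p + Y)) ^+ 2) by field; rewrite gt_eqF.
apply: ler_wpM2l; first by rewrite divr_ge0// sqr_ge0.
clear - p0 Y0 D0.
apply: (@le_trans _ _ ((p + D * Y) ^+ 2)).
  by have := mulr_ge0 p0 (mulr_ge0 D0 Y0); nra.
apply: (@le_trans _ _ (((1 + D) * (p + Y)) ^+ 2)).
  have DY : 0 <= D * Y by exact: mulr_ge0.
  have h : p + D * Y <= (1 + D) * (p + Y).
    by have := mulr_ge0 D0 p0; nra.
  by rewrite lerXn2r ?nnegrE//; [exact: addr_ge0|apply: le_trans h; exact: addr_ge0].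
by have := sqr_ge0 ((1 + D) * (p + Y)); nra.
Qed.

End reconstruction_bound.

(** The [k]-th coefficients of two reconstructions share the denominator
    [A_k(T)]. *)
Lemma combine_modes {R : realFieldType} (p q r s a y : R) :
  (p - q - (r - s)) / a * y = (p - r) / a * y - (q - s) / a * y.
Proof. by rewrite -mulrBl -mulrBl; congr (_ / _ * _); ring. Qed.

Section reconstruction_series.
Context {R : realType}.
Local Notation leb := (@lebesgue_measure R).
Variables l T : R.
Hypotheses (l_gt0 : 0 < l) (T_gt0 : 0 < T).

(** Both [psi_k] and [b k] are [O(1 / lambda_k)]. *)
Lemma reconstruction_cvg (c0 Cw : R) (a b : nat -> R) psi f F N x :
  0 < c0 -> 0 < Cw -> admissible_psi l psi -> (L2L2norm l T f < +oo)%E ->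
  tame l T f F N ->
  (forall k, (0 < k)%N -> c0 <= a k) ->
  (forall k, (0 < k)%N ->
    b k ^+ 2 <= (Cw / lambda l k) ^+ 2 * T * ip T (F k) (F k)) ->
  cvgn (fun n => \sum_(1 <= k < n) (psi_coef l psi k - b k) / a k * e l k x).
Proof.
move=> c00 Cw0 apsi ffin tf ac bc.
have [Cp Cp0 Cpk] := psi_coef_decay l_gt0 apsi.
have [E E0 FE] : exists2 E, 0 <= E &
    forall k, (0 < k)%N -> T * ip T (F k) (F k) <= E ^+ 2.
  have := tame_energy l_gt0 _ tf; move: ffin.
  have := Lnorm_ge0 leb 2%:E
    ((fun t => L2norm l (EFin \o f^~ t)) \_ `]0%R, T[).
  rewrite -/(L2norm T _) -/(L2L2norm l T f).
  case: (L2L2norm l T f) => [y| |]//= y0 _ yE; rewrite lee_fin in y0.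
  exists (Num.sqrt (T * (2 / l * y ^+ 2))) => [|[//|k] _]; first exact: sqrtr_ge0.
  rewrite sqr_sqrtr; last first.
    apply: mulr_ge0; first exact: ltW.
    by apply: mulr_ge0; [apply: divr_ge0 => //; exact: ltW|exact: sqr_ge0].
  rewrite ler_pM2l//.
  have := yE k.+1; rewrite -[2 in X in (_ <= X)%E]/(2%:R) powR_mulrn// lee_fin.
  rewrite -ler_pdivlMl; last by rewrite divr_gt0.
  rewrite invf_div; apply: le_trans.
  by rewrite big_nat_recr//= lerDr sumr_ge0// => j _; exact: ip_ge0.
apply: (@sine_series_cvg _ _ l_gt0 _ ((Cp + Cw * E) / c0)) => k k0.
have lk := lambda_gt0 l_gt0 k0.
have Cl0 : 0 <= Cw / lambda l k by rewrite divr_ge0// ltW.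
have bk : `|b k| <= Cw / lambda l k * E.
  have CE0 := mulr_ge0 Cl0 E0.
  rewrite -(ler_pXn2r (ltn0Sn 1)) ?nnegrE// real_normK ?num_real//.
  apply: (le_trans (bc k k0)); rewrite -[leLHS]mulrA [leRHS]exprMn.
  by apply: ler_wpM2l; [exact: sqr_ge0|exact: FE].
have ak : 0 < a k by exact: lt_le_trans (ac k k0).
rewrite normrM normfV (gtr0_norm ak) ler_pdivrMr//.
apply: (@le_trans _ _ ((Cp + Cw * E) / lambda l k)).
  rewrite mulrDl [Cw * E / _]mulrAC; apply: (le_trans (ler_normB _ _)).
  exact: lerD (Cpk k k0) bk.
have -> : (Cp + Cw * E) / c0 / lambda l k * a k =
    (Cp + Cw * E) / lambda l k * (a k / c0) by field; rewrite !gt_eqF.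
apply: ler_peMr; last by rewrite ler_pdivlMr// mul1r ac.
apply: divr_ge0; last exact: ltW.
by apply: addr_ge0 => //; apply: mulr_ge0 => //; exact: ltW.
Qed.

End reconstruction_series.

Theorem proposition2p6 (R : realType) (alpha l T mu0 M : R)
    (alpha_gt0 : 0 < alpha) (alpha_lt1 : alpha < 1)
    (l_gt0 : 0 < l) (T_gt0 : 0 < T) (mu0_gt0 : 0 < mu0) :
  exists C : R, 0 < C /\
    forall mu : R -> R, admissible_mu T mu0 M mu ->
      (forall (psi : R -> R) (f : R -> R -> R) (u : R -> R -> R) (u0 : R -> R),
         admissible_psi l psi -> admissible_f l T f ->
         reconstruction alpha mu l T psi f u u0 ->
         (L2norm l (EFin \o u0) <=
          C%:E * (L2norm l (EFin \o psi)
                  + (Num.sqrt T)%:E * L2L2norm l T f))%E) /\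
      (forall (psi1 psi2 : R -> R) (f1 f2 : R -> R -> R)
              (u1 u2 : R -> R -> R) (u01 u02 : R -> R),
         admissible_psi l psi1 -> admissible_f l T f1 ->
         admissible_psi l psi2 -> admissible_f l T f2 ->
         reconstruction alpha mu l T psi1 f1 u1 u01 ->
         reconstruction alpha mu l T psi2 f2 u2 u02 ->
         (L2norm l (EFin \o (fun x => (u01 x - u02 x)%R)) <=
          C%:E * (L2norm l (EFin \o (fun x => (psi1 x - psi2 x)%R))
                  + (Num.sqrt T)%:E *
                    L2L2norm l T (fun x t => (f1 x t - f2 x t)%R)))%E).
Proof.
have [c0 [Cw [c00 Cw0 modes]]] :=
  modes_uniform alpha_gt0 alpha_lt1 l_gt0 T_gt0 mu0_gt0.
pose D := Cw / lambda l 1.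
have D0 : 0 <= D by apply: divr_ge0; rewrite ltW// lambda_gt0.
(* Fixed before mu: c0 and D depend on alpha, l, T and mu0 only. *)
exists (2 / c0 * (1 + D)); split.
  by apply: mulr_gt0; [exact: divr_gt0|rewrite ltr_pwDl].
move=> mu /modes{modes} modes.
have Age k k0 := (modes k k0).1.
have wD k : (0 < k)%N -> (Cw / lambda l k) ^+ 2 <= D ^+ 2.
  move=> k0; have lk := lambda_gt0 l_gt0 k0; have l1 := lambda_gt0 l_gt0 (ltn0Sn 0).
  rewrite lerXn2r ?nnegrE//; first by apply: divr_ge0; exact: ltW.
  by apply: ler_wpM2l; [exact: ltW|rewrite lef_pV2 ?posrE//; exact: lambda1_le].
have L2_integrable F : L2 T F ->
    lebesgue_measure.-integrable `]0, T[ (EFin \o (F : measurableTypeR R -> R)).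
  move=> LF; have L1 : L2 T (cst 1) by apply: (@L2_bounded _ _ 1) => // x; rewrite normr1.
  have := L2_prod LF L1; apply: eq_integrable => // x _ /=.
  by rewrite mulr1.
(* B_k(T) is a pairing of the k-th coefficient of f with a weight w that does
   not depend on f; this gives its size and its linearity in f. *)
have Bpair k : (0 < k)%N -> exists w : R -> R,
    [/\ forall f F N, tame l T f F N -> B alpha mu l f k T = ip T (F k) w, L2 T w &
        forall G, L2 T G -> ip T G w ^+ 2 <= (Cw / lambda l k) ^+ 2 * T * ip T G G].
  move=> k0; have [_ [w [mw wb Bw]]] := modes k k0.
  exists w; split.
  - move=> f F N [mN N0 _ fF LF].
    apply: (Bw f (F k) N mN N0); last exact: L2_integrable.
    by move=> t tT nN; exact: fF.
  - exact: L2_bounded mw wb.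
  - by move=> G LG; exact: ip_weight_le mw wb.
have Bsqr f F N : tame l T f F N -> forall k, (0 < k)%N ->
    B alpha mu l f k T ^+ 2 <= (Cw / lambda l k) ^+ 2 * T * ip T (F k) (F k).
  move=> tf k k0; have [w [BE _ wb]] := Bpair k k0.
  by rewrite (BE _ _ _ tf); apply: wb; exact: tame_sqr tf k.
have wDip k (G : R -> R) : (0 < k)%N ->
    (Cw / lambda l k) ^+ 2 * T * ip T G G <= D ^+ 2 * T * ip T G G.
  move=> k0; rewrite ler_wpM2r ?ip_ge0// ler_wpM2r ?wD//; exact: ltW.
pose c psi f k := (psi_coef l psi k - B alpha mu l f k T) / A alpha mu l k T.
(* The series converge, thanks to the boundary conditions on psi; so u0 is an
   actual limit and not a default value. *)
have cvgc psi f u u0 : admissible_psi l psi -> admissible_f l T f ->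
    reconstruction alpha mu l T psi f u u0 -> forall x, 0 < x < l ->
    \sum_(1 <= k < n) c psi f k * e l k x @[n --> \oo] --> u0 x.
  move=> apsi [bf _] [_ u0E] x /andP[x0 xl].
  have [F [N tf]] := bochner_tame l_gt0 bf.
  rewrite u0E; last by rewrite in_itv/= !ltW.
  exact: (reconstruction_cvg l_gt0 T_gt0 c00 Cw0 apsi (Bochner_L2L2_lty bf) tf
    Age (Bsqr _ _ _ tf)).
have L2psi psi : admissible_psi l psi -> L2 l psi.
  by case=> [Hpsi _ _]; exact: Hspace_L2 Hpsi.
split=> [psi f u u0 apsi af rec|
    psi1 psi2 f1 f2 u1 u2 u01 u02 apsi1 af1 apsi2 af2 rec1 rec2].
  have [F [N tf]] := bochner_tame l_gt0 af.1.
  apply: (reconstruction_L2_le l_gt0 T_gt0 c00 D0 (L2psi _ apsi) tf Age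
    _ (cvgc _ _ _ _ apsi af rec)) => k k0.
  exact: le_trans (Bsqr _ _ _ tf k k0) (wDip _ _ k0).
have [F1 [N1 t1]] := bochner_tame l_gt0 af1.1.
have [F2 [N2 t2]] := bochner_tame l_gt0 af2.1.
have Lp1 := L2psi _ apsi1; have Lp2 := L2psi _ apsi2.
have t12 := tameB t1 t2.
apply: (@reconstruction_L2_le R l T l_gt0 T_gt0 c0 D
  (fun k => A alpha mu l k T)
  (fun k => B alpha mu l f1 k T - B alpha mu l f2 k T)
  _ _ _ _ _ c00 D0 (L2B Lp1 Lp2) t12 Age).
- move=> k k0; have [w [BE Lw wb]] := Bpair k k0.
  have L1 := tame_sqr t1 k; have L2' := tame_sqr t2 k.
  rewrite (BE _ _ _ t1) (BE _ _ _ t2).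
  have -> : ip T (F1 k) w - ip T (F2 k) w = ip T (fun t => F1 k t - F2 k t) w.
    rewrite (_ : (fun t => F1 k t - F2 k t) = fun t => F1 k t + -1 * F2 k t).
      by rewrite ip_comb// mulN1r.
    by apply/funext => t; rewrite mulN1r.
  exact: le_trans (wb _ (L2B L1 L2')) (wDip _ _ k0).
- move=> x xl.
  rewrite (_ : (fun n => _) = fun n => \sum_(1 <= k < n) c psi1 f1 k * e l k x -
      \sum_(1 <= k < n) c psi2 f2 k * e l k x).
    exact: cvgB (cvgc _ _ _ _ apsi1 af1 rec1 x xl)
      (cvgc _ _ _ _ apsi2 af2 rec2 x xl).
  apply/funext => n; rewrite -sumrB; apply: eq_bigr => k _.
  rewrite (psi_coefB k Lp1 Lp2); exact: combine_modes.
Qed.
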